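(* Let $\nu>0$, $f\in H$, and let $u$ be a strong solution of the periodic two-dimensional Navier--Stokes equations $u_t+\nu Au+B(u,u)=f$, $u(0)=u_0\in V$. Fix $t_0\ge0$ and assume $$U_1:=\operatorname*{ess\,sup}_{t\ge t_0}\|u(t)\|<\infty .$$ Let $m\in W^{1,\infty}(\mathbb T^2;\mathbb R^2)$ be a time-independent unit vector field that is kernel-free on $H$, i.e. $\{e\in H:e\cdot m=0\}=\{0\}$, and define $\Lambda_*:=\frac{C_{\rm nl}}{\nu}U_1^2$. Choose $\eta>0$ so that $\Lambda_*\eta\le\frac{\nu}{4}$, and let $C_\eta<\infty$ be a constant such that $$|e|^2\le C_\eta|e\cdot m|^2+\eta\|e\|^2\qquad\text{for all }e\in V .$$ Let $I_h:L^2(\mathbb T^2)\to L^2(\mathbb T^2)$, $h>0$, be linear operators satisfying $\|I_h\phi\|_{L^2}\le c_0\|\phi\|_{L^2}$ for $\phi\in L^2(\mathbb T^2)$ and $\|\phi-I_h\phi\|_{L^2}\le c_1h\|\nabla\phi\|_{L^2}$ for $\phi\in H^1(\mathbb T^2)$, with constants $c_0,c_1>0$ independent of $h$. If $\mu>0$, $$\mu\ge2\Lambda_*C_\eta\qquad\text{and}\qquad c_1^2C_{\rm fr}\,\mu h^2\le\frac{\nu}{4},$$ then the strong solution $v$ of $$v_t+\nu Av+B(v,v)=f-\mu P_\sigma\bigl(\bigl(I_h((v-u)\cdot m)\bigr)m\bigr),\qquad v(0)=v_0\in V,$$ satisfies $$|v(t)-u(t)|^2\le\exp\Bigl(-\frac{\nu\lambda_1}{2}(t-t_0)\Bigr)|v(t_0)-u(t_0)|^2,\qquad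 t\ge t_0 .$$
   Context: $\mathbb T^2=(\mathbb R/2\pi\mathbb Z)^2$. $H$ is the space of divergence-free, mean-zero fields in $L^2(\mathbb T^2)^2$, and $V=H^1(\mathbb T^2)^2\cap H$. $|\cdot|$ is the $L^2$ norm; $\|u\|=\|\nabla u\|_{L^2}$ for $u\in V$. $\lambda_1>0$ is a fixed Poincaré constant: $\lambda_1|u|^2\le\|u\|^2$ for $u\in V$ (one may take $\lambda_1=1$). $P_\sigma:L^2(\mathbb T^2)^2\to H$ is the orthogonal projection, $A=-P_\sigma\Delta$ with $D(A)=H^2(\mathbb T^2)^2\cap H$, $B(u,v)=P_\sigma((u\cdot\nabla)v)$, $b(u,v,w)=\int_{\mathbb T^2}(u\cdot\nabla v)\cdot w\,dx$. A strong solution (of either system) is one that for every $T>0$ lies in $C([0,T];V)\cap L^2(0,T;D(A))$ with time derivative in $L^2(0,T;H)$. A unit field satisfies $|m|=1$ a.e. $C_{\rm nl}$ is a fixed constant such that $|b(e,u,e)|\le\frac{\nu}{4}\|e\|^2+\frac{C_{\rm nl}}{\nu}\|u\|^2|e|^2$ for all $e,u\in V$. $C_{\rm fr}$ is a fixed constant, depending only on $\|m\|_{W^{1,\infty}}$ and the Poincaré constant, such that $\|e\cdot m\|_{H^1(\mathbb T^2)}^2\le C_{\rm fr}\|\nabla e\|_{L^2}^2$ for all $e\in V$. For a kernel-free field $m$, a constant $C_\eta$ as in the claim exists for every $\eta>0$. *)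

(* Defs.v *)
From HB Require Import structures.
From mathcomp Require Import all_boot all_order all_algebra.
From mathcomp Require Import all_classical all_reals all_analysis.
From mathcomp Require Import ess_sup_inf.

Set Implicit Arguments.
Unset Strict Implicit.
Unset Printing Implicit Defensive.

Import Order.TTheory GRing.Theory Num.Theory.
Import numFieldNormedType.Exports.

Local Open Scope classical_set_scope.
Local Open Scope ring_scope.

(* A function on the torus (R / 2 pi Z)^2 is given by its values on the cell
   [0, 2 pi]^2: the measure [torus] below lives on that cell, so what a
   function does outside of it is irrelevant, and elements of L^p are
   representatives, compared almost everywhere for [torus].  Periodicity
   enters through the test functions, which are smooth and periodic on the
   whole plane. *)

Notation torusfun R := ((R * R)%type -> R).
Notation vfield R := ('I_2 -> (R * R)%type -> R).

Section Torus.
Context {R : realType}.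

Definition leb : {measure set (measurableTypeR R) -> \bar R} :=
  @lebesgue_measure R.

Definition cell : set (measurableTypeR R * measurableTypeR R) := `[0, 2 * pi] `*` `[0, 2 * pi].

Lemma measurable_cell : measurable cell.
Proof. by apply: measurableX; exact: measurable_itv. Qed.

Definition torus :
    {measure set (measurableTypeR R * measurableTypeR R) -> \bar R} :=
  mrestr (@lebesgue_measure R \x @lebesgue_measure R)%E measurable_cell.

Definition int_torus (f : torusfun R) : R := \int[torus]_x f x.

Definition L2 (f : torusfun R) : Prop := f \in Lfun torus 2%:E.

Definition Linf (f : torusfun R) : Prop := f \in Lfun torus +oo%E.

Definition L2norm (f : torusfun R) : R := fine ('N[torus]_2%:E [EFin \o f])%E.

(** Periodic test functions and weak derivatives *)

Definition basis_vec (i : 'I_2) : R * R := if i == ord0 then (1, 0) else (0, 1).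

Definition partial (i : 'I_2) (phi : torusfun R) : torusfun R :=
  fun x => 'D_(basis_vec i) phi x.

Definition smooth (phi : torusfun R) : Prop :=
  forall s : seq 'I_2, let psi := foldr partial phi s in
    continuous psi /\ forall i x, derivable psi x (basis_vec i).

Definition periodic (phi : torusfun R) : Prop :=
  forall x y, phi (x + 2 * pi, y) = phi (x, y) /\ phi (x, y + 2 * pi) = phi (x, y).

Definition test_fun (phi : torusfun R) : Prop := smooth phi /\ periodic phi.

Definition is_wpartial (i : 'I_2) (f g : torusfun R) : Prop :=
  [/\ torus.-integrable setT (EFin \o f),
      torus.-integrable setT (EFin \o g) &
      forall phi, test_fun phi ->
        int_torus (fun x => f x * partial i phi x) =
        - int_torus (fun x => g x * phi x)].

(* The weak partial derivative, with junk value 0 when there is none. *)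
Definition wd (i : 'I_2) (f : torusfun R) : torusfun R :=
  xget (fun=> 0) [set g | is_wpartial i f g].

(** Sobolev spaces *)

Definition H1 (f : torusfun R) : Prop :=
  L2 f /\ forall i, is_wpartial i f (wd i f) /\ L2 (wd i f).

Definition H2 (f : torusfun R) : Prop := H1 f /\ forall i, H1 (wd i f).

Definition W1inf (f : torusfun R) : Prop :=
  Linf f /\ forall i, is_wpartial i f (wd i f) /\ Linf (wd i f).

Definition gradnorm (f : torusfun R) : R := Num.sqrt (\sum_i L2norm (wd i f) ^+ 2).

Definition H1norm (f : torusfun R) : R :=
  Num.sqrt (L2norm f ^+ 2 + gradnorm f ^+ 2).

(** Vector fields *)

Definition dot (u v : vfield R) : torusfun R := fun x => \sum_i u i x * v i x.

Definition scale (f : torusfun R) (m : vfield R) : vfield R :=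
  fun i x => f x * m i x.

Definition eq_field (u v : vfield R) : Prop :=
  {ae torus, forall x, forall i, u i x = v i x}.

Definition L2field (u : vfield R) : Prop := forall i, L2 (u i).

Definition ip (u v : vfield R) : R := int_torus (dot u v).

Definition hnorm (u : vfield R) : R := Num.sqrt (\sum_i L2norm (u i) ^+ 2).

Definition vnorm (u : vfield R) : R :=
  Num.sqrt (\sum_i gradnorm (u i) ^+ 2).

Definition H2norm (u : vfield R) : R :=
  Num.sqrt (\sum_i (H1norm (u i) ^+ 2
                    + \sum_j gradnorm (wd j (u i)) ^+ 2)).

Definition divergence_free (u : vfield R) : Prop :=
  forall phi, test_fun phi ->
    int_torus (fun x => \sum_i u i x * partial i phi x) = 0.

Definition H (u : vfield R) : Prop :=
  [/\ L2field u, divergence_free u & forall i, int_torus (u i) = 0].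

Definition V (u : vfield R) : Prop := H u /\ forall i, H1 (u i).

Definition DA (u : vfield R) : Prop := H u /\ forall i, H2 (u i).

(* [is_leray g p]: p is (a representative of) the orthogonal projection
   P_sigma g of g in (L^2)^2 onto H. *)
Definition is_leray (g p : vfield R) : Prop :=
  [/\ L2field g, H p & forall phi, H phi -> ip (g - p) phi = 0].

Definition laplacian (u : vfield R) : vfield R :=
  fun i x => \sum_j wd j (wd j (u i)) x.

Definition advect (u v : vfield R) : vfield R :=
  fun i x => \sum_j u j x * wd j (v i) x.

Definition is_A (u a : vfield R) : Prop :=
  DA u /\ is_leray (laplacian u) (- a).

Definition is_B (u v b : vfield R) : Prop := is_leray (advect u v) b.

Definition trilinear (u v w : vfield R) : R := ip (advect u v) w.

(** Functions of time with values in a space of fields *)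

Definition simple_in (X : vfield R -> Prop) (s : R -> vfield R) : Prop :=
  exists (n : nat) (E : 'I_n -> set R) (c : 'I_n -> vfield R),
    [/\ forall k, measurable (E k), forall k, X (c k) &
        s = fun t => \sum_(k < n) (fun i x => \1_(E k) t * c k i x)].

(* L^2(0, T; X) for the norm N on X: strong (Bochner) measurability together
   with square integrability of the norm. *)
Definition L2time (X : vfield R -> Prop) (N : vfield R -> R) (T : R)
    (u : R -> vfield R) : Prop :=
  [/\ {ae leb, forall t, 0 < t < T -> X (u t)},
      exists s : nat -> R -> vfield R,
        (forall n, simple_in X (s n)) /\
        {ae leb, forall t, 0 < t < T ->
           (fun n => N (u t - s n t)) @ \oo --> (0 : R)} &
      (\int[leb]_(t in `]0%R, T[) (N (u t) ^+ 2)%:E < +oo)%E].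

Definition CtimeV (T : R) (u : R -> vfield R) : Prop :=
  (forall t, 0 <= t <= T -> V (u t)) /\
  forall t0, 0 <= t0 <= T ->
    (fun t => vnorm (u t - u t0)) @ within `[0, T] (nbhs t0) --> (0 : R).

Definition Cc_infty (T : R) (psi : R -> R) : Prop :=
  (forall n t, derivable (derive1n n psi) t 1) /\
  exists a b, [/\ 0 < a, b < T & forall t, ~~ (a <= t <= b) -> psi t = 0].

(* w is the H-valued distributional derivative of u on (0, T): the identity
   between the Bochner integrals of psi' u and - psi w is tested against H. *)
Definition is_time_derivative (T : R) (u w : R -> vfield R) : Prop :=
  forall psi, Cc_infty T psi -> forall phi, H phi ->
    \int[leb]_(t in `]0, T[) (ip (u t) phi * derive1 psi t) =
    - \int[leb]_(t in `]0, T[) (ip (w t) phi * psi t).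

(* Strong solution on [0, +oo[ of  u_t + nu A u + B(u, u) = F,  u(0) = u0. *)
Definition strong_solution (nu : R) (F : R -> vfield R) (u0 : vfield R)
    (u : R -> vfield R) : Prop :=
  exists w : R -> vfield R,
    [/\ forall T, 0 < T ->
          [/\ CtimeV T u, L2time DA H2norm T u,
              L2time H hnorm T w & is_time_derivative T u w],
        {ae leb, forall t, 0 < t -> exists a b,
           [/\ is_A (u t) a, is_B (u t) (u t) b &
               eq_field (w t + (fun i x => nu * a i x) + b) (F t)]} &
        eq_field (u 0) u0].

(** The data of the assimilation problem *)

Definition ess_sup_from (t0 : R) (g : R -> R) : \bar R :=
  ess_sup (mrestr leb (measurable_itv `[t0, +oo[)) (EFin \o g).

Definition unit_field (m : vfield R) : Prop :=
  {ae torus, forall x, Num.sqrt (\sum_i m i x ^+ 2) = 1}.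

Definition kernel_free (m : vfield R) : Prop :=
  forall e, H e -> {ae torus, forall x, dot e m x = 0} -> eq_field e 0.

(* Linear operators I_h on L^2; since elements of L^2 are represented by
   functions, compatibility with a.e. equality is part of the data and
   linearity holds a.e. *)
Definition interpolants (I : R -> torusfun R -> torusfun R) (c0 c1 : R) : Prop :=
  forall h, 0 < h ->
    [/\ forall f, L2 f -> L2 (I h f),
        forall f g, L2 f -> L2 g -> {ae torus, forall x, f x = g x} ->
          {ae torus, forall x, I h f x = I h g x},
        forall (a : R) f g, L2 f -> L2 g ->
          {ae torus, forall x, I h (fun y => a * f y + g y) x =
                               a * I h f x + I h g x},
        forall f, L2 f -> L2norm (I h f) <= c0 * L2norm f &
        forall f, H1 f -> L2norm (f - I h f) <= c1 * h * gradnorm f].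

End Torus.

(* Main.v *)
Require Import Defs.
From mathcomp Require Import all_boot all_order all_algebra.
From mathcomp Require Import all_classical all_reals all_analysis.
From mathcomp Require Import measurable_realfun ess_sup_inf.
From mathcomp Require finmap.
From mathcomp Require Import ring lra.

(** Write [e = v - u].  Subtracting the two equations and testing with [e]
    gives, at almost every time,

      <e_t, e> = - nu ||e||^2 - b(e, u, e) - mu <I_h(e.m), e.m>,

    because <B(v, v) - B(u, u), e> = b(e, u, e) + b(v, e, e) and the transport
    term b(v, e, e) vanishes ([transport_zero], [energy_identity]).  Up to the
    interpolation error, which costs nu/8 ||e||^2 by the smallness of mu h^2,
    the feedback dissipates mu/2 |e.m|^2 ([feedback_bound]).  The nonlinear term
    is at most nu/4 ||e||^2 + Lambda |e|^2, and the kernel-free inequality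
    turns Lambda |e|^2 into mu/2 |e.m|^2 + nu/4 ||e||^2.  What remains is
    - 3/8 nu ||e||^2, so that the Poincare inequality yields
    d/dt |e|^2 <= - (nu lambda1 / 2) |e|^2 ([decay_rate]), and the claim is
    Gronwall's lemma for this inequality ([ac_decay]).

    In space, everything known about a weak derivative is its pairing with
    smooth periodic functions.  The tool is the orthogonal projection onto the
    trigonometric polynomials of degree at most [N]: it contracts L2, it
    commutes with weak differentiation ([proj_partial]), and it converges to
    the identity ([proj_cvg]).  It gives integration by parts in H1 ([H1_ibp])
    and the boundedness of H2 functions ([H2_bounded]), which makes the
    products v_j d_j e square integrable.  The density of trigonometric
    polynomials and the uniqueness of weak derivatives both come from one
    monotone class theorem ([trig_monotone_class]), which starts from explicit
    trigonometric polynomials converging boundedly to the indicator of a half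
    line inside the period ([approximable_ray]).

    In time, the derivative [w] of a solution is a distributional one.  Testing
    with smooth steps gives <u(b) - u(a), phi> as the integral of <w, phi> over
    the interval from [a] to [b] ([weak_increment]).  The energy is reached
    without a product rule: |e(b)|^2 - |e(a)|^2 = <e(b) - e(a), e(a) + e(b)> is
    the integral of <e_t(r), e(a) + e(b)>, and replacing e(a) + e(b) by 2 e(r)
    costs an arbitrarily small multiple of the integral of |e_t| on short
    intervals, since [e] is continuous ([ac_decay_step]).  These local
    estimates add up to the monotonicity of exp(nu lambda1 t / 2) |e(t)|^2
    ([local_decrease]). *)

Set Implicit Arguments.
Unset Strict Implicit.
Unset Printing Implicit Defensive.
Import Order.TTheory GRing.Theory Num.Theory.
Import numFieldNormedType.Exports.

Local Open Scope classical_set_scope.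
Local Open Scope ring_scope.

(** * Integrals of almost everywhere equal functions, and square integrability *)

Section AeIntegral.
Context d (T : measurableType d) (R : realType) (mu : {measure set T -> \bar R}).
Import HBNNSimple.

(** A simple function below [f], cut to zero on the exceptional null set, lies
    below [g] and keeps its integral.  Arguing with simple functions covers
    non-measurable functions too. *)
Let ae_le_nnintegral (f g : T -> \bar R) : (forall x, 0 <= f x)%E ->
  (forall x, 0 <= g x)%E ->
  {ae mu, forall x, f x = g x} -> (\int[mu]_x f x <= \int[mu]_x g x)%E.
Proof.
move=> f0 g0 [N [mN N0 sN]].
rewrite !ge0_integralTE//; apply: ge_ereal_sup => _ [h hf <-].
pose h' : {nnsfun T >-> R} := proj_nnsfun h (measurableC mN).
have h'E x : h' x = h x * (x \in ~` N)%:R by rewrite /h' /=.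
have -> : sintegral mu h = sintegral mu h'.
  rewrite -!integralT_nnsfun; apply: ae_eq_integral => //.
  - by apply/measurable_EFinP.
  - by apply/measurable_EFinP.
  exists N; split => // x /= xh; apply: contrapT => xN; apply: xh => _.
  by rewrite mindicE mem_set// mulr1.
apply: ereal_sup_ubound; exists h' => //= x.
rewrite mindicE; have [/set_mem xN|] := boolP (x \in ~` N); last by rewrite mulr0.
rewrite mulr1 -(_ : f x = g x) ?hf//.
by apply: contrapT => fgx; apply: xN; exact: sN.
Qed.

Lemma ae_integral (f g : T -> \bar R) (D : set T) :
  {ae mu, forall x, D x -> f x = g x} ->
  (\int[mu]_(x in D) f x = \int[mu]_(x in D) g x)%E.
Proof.
move=> fg.
have fgD : {ae mu, forall x, (f \_ D) x = (g \_ D) x}.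
  apply: filterS fg => x; rewrite /patch; case: ifPn => // /set_mem xD; exact.
rewrite [LHS]integral_mkcond [RHS]integral_mkcond [LHS]integralE [RHS]integralE.
by congr (_ - _)%E; apply/eqP; rewrite eq_le !ae_le_nnintegral//;
  apply: filterS fgD => x; rewrite unlock => ->.
Qed.

Lemma ae_Rintegral (f g : T -> R) (D : set T) :
  {ae mu, forall x, D x -> f x = g x} ->
  \int[mu]_(x in D) f x = \int[mu]_(x in D) g x.
Proof.
move=> fg; congr fine; apply: ae_integral.
by apply: filterS fg => x h Dx; rewrite h.
Qed.
End AeIntegral.

Section Itg.
Context d (T : measurableType d) (R : realType) (mu : {measure set T -> \bar R}).
Implicit Types (D : set T) (f g : T -> R).

Lemma itg_ext D f g : f =1 g -> mu.-integrable D (EFin \o f) ->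
  mu.-integrable D (EFin \o g).
Proof. by move=> /funext ->. Qed.

Lemma itg_meas D f : mu.-integrable D (EFin \o f) -> measurable_fun D f.
Proof. by move=> /measurable_int/measurable_EFinP. Qed.

Lemma itgD D f g : measurable D -> mu.-integrable D (EFin \o f) ->
  mu.-integrable D (EFin \o g) -> mu.-integrable D (EFin \o (fun x => f x + g x)).
Proof. by move=> mD hf hg; have := integrableD mD hf hg. Qed.

Lemma itgZ D (a : R) f : measurable D -> mu.-integrable D (EFin \o f) ->
  mu.-integrable D (EFin \o (fun x => a * f x)).
Proof. by move=> mD hf; have := integrableZl mD a hf. Qed.

Lemma itgN D f : measurable D -> mu.-integrable D (EFin \o f) ->
  mu.-integrable D (EFin \o (fun x => - f x)).
Proof. by move=> mD /(itgZ (-1) mD); apply: itg_ext => x; rewrite mulN1r. Qed.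

Lemma itgB D f g : measurable D -> mu.-integrable D (EFin \o f) ->
  mu.-integrable D (EFin \o g) -> mu.-integrable D (EFin \o (fun x => f x - g x)).
Proof. by move=> mD hf hg; apply: itgD => //; exact: itgN. Qed.

Lemma itg_sum D (I : Type) (s : seq I) (F : I -> T -> R) : measurable D ->
  (forall i, mu.-integrable D (EFin \o F i)) ->
  mu.-integrable D (EFin \o (fun x => \sum_(i <- s) F i x)).
Proof.
move=> mD hF; elim: s => [|i s IH].
  apply: (@itg_ext _ (fun=> 0)) => [x|]; first by rewrite big_nil.
  exact: integrable0.
apply: (@itg_ext _ (fun x => F i x + \sum_(j <- s) F j x)) => [x|].
  by rewrite big_cons.
exact: itgD.
Qed.

Lemma Rint_sum D (I : Type) (s : seq I) (F : I -> T -> R) : measurable D ->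
  (forall i, mu.-integrable D (EFin \o F i)) ->
  \int[mu]_(x in D) (\sum_(i <- s) F i x) = \sum_(i <- s) \int[mu]_(x in D) F i x.
Proof.
move=> mD hF; elim: s => [|i s IH].
  rewrite big_nil; under eq_Rintegral do rewrite big_nil.
  by rewrite Rintegral_cst// mul0r.
rewrite big_cons -IH -RintegralD//; last exact: itg_sum.
by apply: eq_Rintegral => x _; rewrite big_cons.
Qed.

Lemma itg_le D f g : measurable D -> measurable_fun D f ->
  (forall x, D x -> `|f x| <= g x) -> mu.-integrable D (EFin \o g) ->
  mu.-integrable D (EFin \o f).
Proof.
move=> mD mf fg; apply: le_integrable => //; first exact/measurable_EFinP.
by move=> x Dx /=; rewrite lee_fin (le_trans (fg x Dx))// ler_norm.
Qed.

End Itg.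

(** A quadratic form that is nonnegative has nonpositive discriminant; when
    [c = 0] a value of [t] that makes the form equal to [-1] excludes [a <> 0]. *)
Lemma discriminant (R : realFieldType) (a b c : R) : 0 <= b -> 0 <= c ->
  (forall s t, 0 <= s ^+ 2 * b + (t ^+ 2 * c + 2 * s * t * a)) -> a ^+ 2 <= b * c.
Proof.
move=> b0 c0 q; have [c1|] := ltP 0 c.
  have := q c (- a); have -> : c ^+ 2 * b + ((- a) ^+ 2 * c + 2 * c * - a * a) =
    c * (b * c - a ^+ 2) by ring.
  by rewrite pmulr_rge0// subr_ge0.
move=> c1; have {c0}c0 : c = 0 by apply/eqP; rewrite eq_le c1 c0.
rewrite c0 mulr0; have [->|a0] := eqVneq a 0; first by rewrite expr0n.
have := q 1 (- (b + 1) / (2 * a)); rewrite c0 mulr0 add0r expr1n mul1r mulr1.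
have -> : 2 * (- (b + 1) / (2 * a)) * a = - (b + 1) by field.
by rewrite opprD addrA subrr add0r oppr_ge0 ler10.
Qed.

Section L2gen.
Context d (T : measurableType d) (R : realType) (mu : {measure set T -> \bar R}).
Implicit Types f g : T -> R.
Local Notation l2 f := (f \in Lfun mu 2%:E).
Local Notation itg f := (mu.-integrable setT (EFin \o f)).

Lemma l2_meas f : l2 f -> measurable_fun setT f.
Proof. by rewrite inE => /andP[/[!inE]]. Qed.

Lemma l2_sqr f : l2 f -> itg (fun x => f x ^+ 2).
Proof. exact: Lfun2_integrable_sqr. Qed.

Let norm_powR2 (r : R) : (`|r| `^ 2)%R = r ^+ 2.
Proof. by rewrite powR_mulrn// real_normK// num_real. Qed.

Lemma l2P f : measurable_fun setT f -> itg (fun x => f x ^+ 2) -> l2 f.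
Proof.
move=> mf /integrableP[_ fi]; rewrite inE; apply/andP; split; rewrite inE//=.
rewrite /finite_norm unlock /Lnorm poweR_lty//.
apply: le_lt_trans fi; apply: ge0_le_integral => //.
- move=> x _; exact: poweR_ge0.
- apply/measurable_EFinP; apply: (@measurableT_comp _ _ _ _ _ _ (@powR R ^~ 2)) => //.
  exact: measurableT_comp.
- by apply/measurable_EFinP; apply: measurableT_comp => //; exact: measurable_funX.
- by move=> x _ /=; rewrite lee_fin norm_powR2 ler_norm.
Qed.

Lemma l2norm_sqr f : l2 f ->
  fine ('N[mu]_2%:E [EFin \o f])%E ^+ 2 = \int[mu]_x (f x ^+ 2).
Proof.
move=> l2f.
have fin : ('N[mu]_2%:E[EFin \o f] \is a fin_num)%E.
  rewrite ge0_fin_numE ?Lnorm_ge0//.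
  by move: l2f; rewrite inE => /andP[_]; rewrite inE.
have := powR_Lnorm mu (EFin \o f) (r := 2) (ltac:(by rewrite pnatr_eq0)).
rewrite -{1}(fineK fin) /= powR_mulrn ?fine_ge0 ?Lnorm_ge0// => e.
rewrite /Rintegral.
transitivity (fine ((fine 'N[mu]_2%:E[EFin \o f]%E ^+ 2)%:E)) => //.
rewrite e; congr fine; apply: eq_integral => x _.
by rewrite /= norm_powR2.
Qed.

Lemma l2M f g : l2 f -> l2 g -> itg (fun x => f x * g x).
Proof. by move=> lf lg; apply/Lfun1_integrable; exact: Lfun2_mul_Lfun1. Qed.

Lemma l2D f g : l2 f -> l2 g -> l2 (fun x => f x + g x).
Proof.
move=> lf lg; apply: l2P.
  by apply: measurable_funD; exact: l2_meas.
apply: (@itg_ext _ _ _ _ _ (fun x => (f x ^+ 2 + g x ^+ 2) + 2 * (f x * g x))).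
  by move=> x; ring.
apply: itgD => //; first by apply: itgD => //; exact: l2_sqr.
by apply: itgZ => //; exact: l2M.
Qed.

Lemma l2Z a f : l2 f -> l2 (fun x => a * f x).
Proof.
move=> lf; apply: l2P.
  by apply: measurable_funM => //; exact: l2_meas.
apply: (@itg_ext _ _ _ _ _ (fun x => (a ^+ 2) * f x ^+ 2)).
  by move=> x; ring.
by apply: itgZ => //; exact: l2_sqr.
Qed.

Lemma l2N f : l2 f -> l2 (fun x => - f x).
Proof.
by move=> /(l2Z (-1)); rewrite (_ : (fun x => -1 * f x) = (fun x => - f x))//;
  apply/funext => x; rewrite mulN1r.
Qed.

Lemma l2B f g : l2 f -> l2 g -> l2 (fun x => f x - g x).
Proof. by move=> lf lg; apply: l2D => //; exact: l2N. Qed.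

Lemma l2_0 : l2 (fun=> 0).
Proof.
apply: l2P => //; apply: (@itg_ext _ _ _ _ _ (fun=> 0)); last exact: integrable0.
by move=> x; rewrite expr0n.
Qed.

Lemma l2_sum (I : Type) (s : seq I) (F : I -> T -> R) :
  (forall i, l2 (F i)) -> l2 (fun x => \sum_(i <- s) F i x).
Proof.
move=> hF; elim: s => [|i s IH].
  by rewrite (_ : (fun _ => _) = (fun=> 0)); [exact: l2_0|apply/funext => x; rewrite big_nil].
rewrite (_ : (fun _ => _) = (fun x => F i x + \sum_(j <- s) F j x)); first exact: l2D.
by apply/funext => x; rewrite big_cons.
Qed.

Lemma l2_bndM (M : R) f g : measurable_fun setT g ->
  {ae mu, forall x, `|g x| <= M} -> l2 f -> l2 (fun x => g x * f x).
Proof.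
move=> mg gM lf; have mf := l2_meas lf; apply: l2P; first exact: measurable_funM.
have /integrableP[_ fi] := itgZ (M ^+ 2) measurableT (l2_sqr lf).
apply/integrableP; split.
  by apply/measurable_EFinP; apply: measurable_funX; exact: measurable_funM.
apply: le_lt_trans fi; apply: ae_ge0_le_integral => //.
- apply: measurableT_comp => //; apply/measurable_EFinP.
  by apply: measurable_funX; exact: measurable_funM.
- apply: measurableT_comp => //; apply/measurable_EFinP.
  by apply: measurable_funM => //; exact: measurable_funX.
apply: filterS gM => x gM _; rewrite /= lee_fin.
have h0 : 0 <= f x ^+ 2 by exact: sqr_ge0.
have h : g x ^+ 2 <= M ^+ 2.
  rewrite -[g x ^+ 2]real_normK ?num_real//.
  by rewrite ler_pXn2r// nnegrE (le_trans _ gM).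
have h1 : 0 <= g x ^+ 2 * f x ^+ 2 by rewrite mulr_ge0// sqr_ge0.
have h2 : 0 <= M ^+ 2 * f x ^+ 2 by rewrite mulr_ge0// sqr_ge0.
by rewrite exprMn (ger0_norm h1) (ger0_norm h2); exact: ler_wpM2r.
Qed.

Lemma l2_CS_sqr f g : l2 f -> l2 g ->
  (\int[mu]_x (f x * g x)) ^+ 2 <=
  (\int[mu]_x (f x ^+ 2)) * (\int[mu]_x (g x ^+ 2)).
Proof.
move=> lf lg.
set a := \int[mu]_x (f x * g x); set b := \int[mu]_x (f x ^+ 2).
set c := \int[mu]_x (g x ^+ 2).
have q s t : 0 <= s ^+ 2 * b + (t ^+ 2 * c + 2 * s * t * a).
  have := @Rintegral_ge0 _ _ _ mu setT (fun x => (s * f x + t * g x) ^+ 2)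
    (fun x _ => sqr_ge0 _).
  rewrite (@eq_Rintegral _ _ _ _ _
    (fun x => s ^+ 2 * f x ^+ 2 + (t ^+ 2 * g x ^+ 2 + 2 * s * t * (f x * g x)))).
    have i1 := itgZ (s ^+ 2) measurableT (l2_sqr lf).
    have i2 := itgZ (t ^+ 2) measurableT (l2_sqr lg).
    have i3 := itgZ (2 * s * t) measurableT (l2M lf lg).
    rewrite RintegralD//; last exact: itgD.
    by rewrite RintegralD// !RintegralZl//; [exact: l2M|exact: l2_sqr|exact: l2_sqr].
  by move=> x _; ring.
by apply: (discriminant _ _ q); apply: Rintegral_ge0 => x _; exact: sqr_ge0.
Qed.
End L2gen.

(** * Trigonometric polynomials *)

Section Span.
Context (X : Type) (R : realType) (I : eqType) (F : I -> X -> R).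

(** The span is that of a list, so that orthogonal projections can be built by
    recursion on the generators. *)
Fixpoint in_span (s : seq I) (f : X -> R) : Prop :=
  if s is i :: s' then
    exists a g, in_span s' g /\ f = (fun x => a * F i x + g x)
  else f = (fun=> 0).

Lemma span0 s : in_span s (fun=> 0).
Proof.
elim: s => //= i s IH; exists 0, (fun=> 0); split => //.
by apply/funext => x; rewrite mul0r addr0.
Qed.

Lemma spanD s f g : in_span s f -> in_span s g -> in_span s (fun x => f x + g x).
Proof.
elim: s f g => [f g -> ->|i s IH f g [a [f' [hf ->]]] [b [g' [hg ->]]]] /=.
  by apply/funext => x; rewrite addr0.
exists (a + b), (fun x => f' x + g' x); split; first exact: IH.
by apply/funext => x; ring.
Qed.

Lemma spanZ s c f : in_span s f -> in_span s (fun x => c * f x).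
Proof.
elim: s f => [f ->|i s IH f [a [f' [hf ->]]]] /=.
  by apply/funext => x; rewrite mulr0.
exists (c * a), (fun x => c * f' x); split; first exact: IH.
by apply/funext => x; ring.
Qed.

Lemma span_mem s i : i \in s -> in_span s (F i).
Proof.
elim: s => // j s IH; rewrite inE => /orP[/eqP ->|/IH h] /=.
  exists 1, (fun=> 0); split; first exact: span0.
  by apply/funext => x; rewrite mul1r addr0.
by exists 0, (F i); split => //; apply/funext => x; rewrite mul0r add0r.
Qed.

Lemma span_ind (P : (X -> R) -> Prop) s :
  P (fun=> 0) -> (forall i, i \in s -> P (F i)) ->
  (forall a f g, P f -> P g -> P (fun x => a * f x + g x)) ->
  forall f, in_span s f -> P f.
Proof.
move=> P0 PF PD; elim: s PF => [_ f ->//|i s IH PF f [a [g [hg ->]]]].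
apply: PD; first by apply: PF; rewrite mem_head.
by apply: IH => // j js; apply: PF; rewrite inE js orbT.
Qed.
End Span.

Section Trig.
Context {R : realType}.
Implicit Types (N : nat) (z : R * R).

Definition trig1 (p : nat * nat) (x : R) : R := cos x ^+ p.1 * sin x ^+ p.2.

Definition trig2 (q : (nat * nat) * (nat * nat)) : torusfun R :=
  fun z => trig1 q.1 z.1 * trig1 q.2 z.2.

(** Monomials in cosines and sines, of bounded degree in each variable: products
    add degrees and differentiation does not raise them. *)
Definition degs N : seq (nat * nat) :=
  [seq p <- allpairs pair (iota 0 N.+1) (iota 0 N.+1) | (p.1 + p.2 <= N)%N].

Lemma mem_degs N p : (p \in degs N) = (p.1 + p.2 <= N)%N.
Proof.
case: p => a b; rewrite mem_filter; case: leqP => // h; rewrite andTb.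
by apply/allpairsP; exists (a, b); rewrite !mem_iota /= !add0n !ltnS; split => //;
  apply: leq_trans h; rewrite ?leq_addr ?leq_addl.
Qed.

Definition trigpoly N : torusfun R -> Prop :=
  in_span trig2 (allpairs pair (degs N) (degs N)).

Lemma trigpoly0 N : trigpoly N (fun=> 0).
Proof. exact: span0. Qed.

Lemma trigpolyD N f g : trigpoly N f -> trigpoly N g ->
  trigpoly N (fun z => f z + g z).
Proof. exact: spanD. Qed.

Lemma trigpolyZ N c f : trigpoly N f -> trigpoly N (fun z => c * f z).
Proof. exact: spanZ. Qed.

Lemma trigpoly_trig2 N p q : (p.1 + p.2 <= N)%N -> (q.1 + q.2 <= N)%N ->
  trigpoly N (trig2 (p, q)).
Proof.
by move=> hp hq; apply: span_mem; apply/allpairsP; exists (p, q); rewrite !mem_degs.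
Qed.

Lemma trigpoly_ind N (P : torusfun R -> Prop) :
  P (fun=> 0) ->
  (forall p q, (p.1 + p.2 <= N)%N -> (q.1 + q.2 <= N)%N -> P (trig2 (p, q))) ->
  (forall a f g, P f -> P g -> P (fun x => a * f x + g x)) ->
  forall f, trigpoly N f -> P f.
Proof.
move=> P0 PF PD; apply: span_ind => // -[p q] /allpairsP[[p' q'] /= [hp hq [-> ->]]].
by apply: PF; rewrite -mem_degs.
Qed.

Lemma trigpoly_cst c : trigpoly 0 (fun=> c).
Proof.
have -> : (fun=> c) = (fun z => c * trig2 ((0, 0), (0, 0))%N z).
  by apply/funext => z; rewrite /trig2 /trig1 /= !expr0 !mulr1.
by apply: trigpolyZ; exact: trigpoly_trig2.
Qed.

Lemma trigpoly_le N M f : (N <= M)%N -> trigpoly N f -> trigpoly M f.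
Proof.
move=> NM; apply: trigpoly_ind => [|p q hp hq|a g h hg hh].
- exact: trigpoly0.
- by apply: trigpoly_trig2; apply: leq_trans NM.
- by apply: trigpolyD => //; exact: trigpolyZ.
Qed.

Lemma trigpolyM N M f g : trigpoly N f -> trigpoly M g ->
  trigpoly (N + M) (fun z => f z * g z).
Proof.
move=> hf hg; move: f hf; apply: trigpoly_ind.
- have -> : (fun z => 0 * g z) = (fun=> 0) by apply/funext => z; rewrite mul0r.
  exact: trigpoly0.
- move=> p q hp hq; move: g hg; apply: trigpoly_ind.
  + have -> : (fun z => trig2 (p, q) z * 0) = (fun=> 0).
      by apply/funext => z; rewrite mulr0.
    exact: trigpoly0.
  + move=> p' q' hp' hq'.
    have -> : (fun z => trig2 (p, q) z * trig2 (p', q') z) =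
        trig2 ((p.1 + p'.1, p.2 + p'.2), (q.1 + q'.1, q.2 + q'.2))%N.
      by apply/funext => z; rewrite /trig2 /trig1 /= !exprD; ring.
    by apply: trigpoly_trig2; rewrite /= addnACA leq_add.
  + move=> a g h hg hh.
    have -> : (fun z => trig2 (p, q) z * (a * g z + h z)) =
        (fun z => a * (trig2 (p, q) z * g z) + trig2 (p, q) z * h z).
      by apply/funext => z; ring.
    by apply: trigpolyD => //; exact: trigpolyZ.
- move=> a f h hf hh.
  have -> : (fun z => (a * f z + h z) * g z) = (fun z => a * (f z * g z) + h z * g z).
    by apply/funext => z; ring.
  by apply: trigpolyD => //; exact: trigpolyZ.
Qed.

Lemma trigpoly_exp N f k : trigpoly N f -> trigpoly (k * N) (fun z => f z ^+ k).
Proof.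
move=> hf; elim: k => [|k IH]; first exact: trigpoly_cst.
have -> : (fun z => f z ^+ k.+1) = (fun z => f z * f z ^+ k).
  by apply/funext => z; rewrite exprS.
by rewrite mulSn; exact: trigpolyM.
Qed.

Definition dtrig1 (p : nat * nat) (x : R) : R :=
  - p.1%:R * trig1 (p.1.-1, p.2.+1) x + p.2%:R * trig1 (p.1.+1, p.2.-1) x.

Lemma is_derive_trig1 p (x : R) : is_derive x (1 : R) (trig1 p) (dtrig1 p x).
Proof.
have -> : trig1 p = (cos ^+ p.1 * sin ^+ p.2 : R -> R).
  by apply/funext => y; rewrite /trig1 !fctE.
apply: is_derive_eq; rewrite /dtrig1 /trig1 /= ?exprfctE /GRing.scale /=.
rewrite ?exprfctE; case: p => -[|a] [|b] /=; rewrite ?expr0 ?exprS; ring.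
Qed.

Lemma trig1_periodic p (x : R) : trig1 p (x + 2 * pi) = trig1 p x.
Proof.
by rewrite /trig1 (_ : 2 * pi = pi *+ 2) ?cosD2pi ?sinD2pi// mulr_natl.
Qed.

Lemma trig1_continuous p : continuous (trig1 p).
Proof.
move=> x; apply: differentiable_continuous; apply/derivable1_diffP.
by apply: ex_derive; exact: is_derive_trig1.
Qed.

Lemma trig1_le1 p (x : R) : `|trig1 p x| <= 1.
Proof.
rewrite /trig1 normrM !normrX mulr_ile1 ?exprn_ge0 ?exprn_ile1//.
exact: cos_max. exact: sin_max.
Qed.

Let slice0 (f : torusfun R) z h :
  h^-1 *: ((f \o shift z) (h *: basis_vec ord0) - f z) =
  h^-1 *: (((fun x => f (x, z.2)) \o shift z.1) (h *: 1) - f (z.1, z.2)).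
Proof.
case: z => x y; rewrite /= /basis_vec eqxx; congr (_ *: (f _ - f _)).
by transitivity (h *: (1 : R) + x, h *: (0 : R) + y) => //; rewrite scaler0 add0r.
Qed.

Let slice1 (f : torusfun R) z h :
  h^-1 *: ((f \o shift z) (h *: basis_vec ord_max) - f z) =
  h^-1 *: (((fun y => f (z.1, y)) \o shift z.2) (h *: 1) - f (z.1, z.2)).
Proof.
case: z => x y; rewrite /= /basis_vec /=; congr (_ *: (f _ - f _)).
by transitivity (h *: (0 : R) + x, h *: (1 : R) + y) => //; rewrite scaler0 add0r.
Qed.

Lemma derivable_slice0 (f : torusfun R) z :
  derivable f z (basis_vec ord0) <-> derivable (fun x => f (x, z.2)) z.1 1.
Proof. by rewrite /derivable; under eq_fun do rewrite slice0. Qed.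

Lemma derivable_slice1 (f : torusfun R) z :
  derivable f z (basis_vec ord_max) <-> derivable (fun y => f (z.1, y)) z.2 1.
Proof. by rewrite /derivable; under eq_fun do rewrite slice1. Qed.

Lemma partial0E (f : torusfun R) z : partial ord0 f z = 'D_1 (fun x => f (x, z.2)) z.1.
Proof. by rewrite /partial /derive; under eq_fun do rewrite slice0. Qed.

Lemma partial1E (f : torusfun R) z : partial ord_max f z = 'D_1 (fun y => f (z.1, y)) z.2.
Proof. by rewrite /partial /derive; under eq_fun do rewrite slice1. Qed.

Lemma ord2_cases (P : 'I_2 -> Prop) : P ord0 -> P ord_max -> forall i, P i.
Proof.
by move=> p0 p1 [[|[|//]] h];
  [rewrite (_ : Ordinal h = ord0)|rewrite (_ : Ordinal h = ord_max)] => //; exact: val_inj.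
Qed.

Lemma is_derive_trig2 i q z :
  is_derive z (basis_vec i) (trig2 q)
    (if i == ord0 then dtrig1 q.1 z.1 * trig1 q.2 z.2
     else trig1 q.1 z.1 * dtrig1 q.2 z.2).
Proof.
move: i; apply: ord2_cases => /=.
- have D : is_derive z.1 1 (fun x => trig2 q (x, z.2)) (dtrig1 q.1 z.1 * trig1 q.2 z.2).
    have -> : (fun x => trig2 q (x, z.2)) = trig1 q.2 z.2 *: trig1 q.1.
      by apply/funext => x; rewrite /trig2 /= mulrC.
    have := is_derive_trig1 q.1 z.1 => h.
    by apply: is_derive_eq; rewrite mulrC.
  split; first by apply/derivable_slice0; exact: ex_derive.
  by have := partial0E (trig2 q) z; rewrite derive_val.
- have D : is_derive z.2 1 (fun y => trig2 q (z.1, y)) (trig1 q.1 z.1 * dtrig1 q.2 z.2).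
    have -> : (fun y => trig2 q (z.1, y)) = trig1 q.1 z.1 *: trig1 q.2.
      by apply/funext => y; rewrite /trig2.
    have := is_derive_trig1 q.2 z.2 => h.
    exact: is_derive_eq.
  split; first by apply/derivable_slice1; exact: ex_derive.
  by have := partial1E (trig2 q) z; rewrite derive_val.
Qed.

Lemma trigpoly_derivable N f i z : trigpoly N f -> derivable f z (basis_vec i).
Proof.
move: f; apply: trigpoly_ind => [|p q _ _|a f g hf hg].
- exact: derivable_cst.
- by have D := is_derive_trig2 i (p, q) z; exact: ex_derive.
- by apply: (@derivableD _ _ _ (a *: f) g) => //; exact: derivableZ.
Qed.

Lemma partial_lin N i a f g : trigpoly N f -> trigpoly N g ->
  partial i (fun x => a * f x + g x) = (fun x => a * partial i f x + partial i g x).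
Proof.
move=> hf hg; apply/funext => z; rewrite /partial.
have df : derivable f z (basis_vec i) := trigpoly_derivable hf.
have dg : derivable g z (basis_vec i) := trigpoly_derivable hg.
rewrite (_ : (fun x => a * f x + g x) = a *: f + g)//.
by rewrite deriveD ?deriveZ//; exact: derivableZ.
Qed.

(** Differentiation lowers one exponent of a monomial and raises the other; when
    the exponent to be lowered is 0 the coefficient vanishes, so the truncated
    predecessor does no harm. *)
Lemma trigpoly_partial N i f : trigpoly N f -> trigpoly N (partial i f).
Proof.
move=> hf; suff : trigpoly N f /\ trigpoly N (partial i f) by case.
move: f hf; apply: trigpoly_ind => [|p q hp hq|a f g [hf pf] [hg pg]].
- split; first exact: trigpoly0.
  have -> : partial i (fun=> 0 : R) = (fun=> 0).
    by apply/funext => z; rewrite /partial derive_cst.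
  exact: trigpoly0.
- split; first exact: trigpoly_trig2.
  have -> : partial i (trig2 (p, q)) = (fun z => if i == ord0 then
      dtrig1 p z.1 * trig1 q z.2 else trig1 p z.1 * dtrig1 q z.2).
    by apply/funext => z; rewrite /partial; have D := is_derive_trig2 i (p, q) z;
      rewrite derive_val.
  have aux (c1 c2 : R) q1 q2 : (c1 != 0 -> trigpoly N (trig2 q1)) ->
      (c2 != 0 -> trigpoly N (trig2 q2)) ->
      trigpoly N (fun z => c1 * trig2 q1 z + c2 * trig2 q2 z).
    move=> h1 h2; apply: trigpolyD; [have [->|/h1 h] := eqVneq c1 0|have [->|/h2 h] := eqVneq c2 0].
    + by under eq_fun do rewrite mul0r; exact: trigpoly0.
    + exact: trigpolyZ.
    + by under eq_fun do rewrite mul0r; exact: trigpoly0.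
    + exact: trigpolyZ.
  have nz a : - a%:R != 0 :> R -> (0 < a)%N by rewrite oppr_eq0 pnatr_eq0 lt0n.
  have nz' a : a%:R != 0 :> R -> (0 < a)%N by rewrite pnatr_eq0 lt0n.
  case: p hp => a b /= ab; case: q hq => c e /= ce.
  case: eqP => _.
  + have -> : (fun z => dtrig1 (a, b) z.1 * trig1 (c, e) z.2) = (fun z =>
        - a%:R * trig2 ((a.-1, b.+1), (c, e)) z + b%:R * trig2 ((a.+1, b.-1), (c, e)) z).
      by apply/funext => z; rewrite /dtrig1 /trig2 /=; ring.
    by apply: aux => [/nz|/nz'] h; apply: trigpoly_trig2 => //=;
      [rewrite addnS -addSn prednK|rewrite addSn -addnS prednK].
  + have -> : (fun z => trig1 (a, b) z.1 * dtrig1 (c, e) z.2) = (fun z =>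
        - c%:R * trig2 ((a, b), (c.-1, e.+1)) z + e%:R * trig2 ((a, b), (c.+1, e.-1)) z).
      by apply/funext => z; rewrite /dtrig1 /trig2 /=; ring.
    by apply: aux => [/nz|/nz'] h; apply: trigpoly_trig2 => //=;
      [rewrite addnS -addSn prednK|rewrite addSn -addnS prednK].
- split; first by apply: trigpolyD => //; exact: trigpolyZ.
  by rewrite (partial_lin i a hf hg); apply: trigpolyD => //; exact: trigpolyZ.
Qed.

Lemma trigpoly_continuous N f : trigpoly N f -> continuous f.
Proof.
move: f; apply: trigpoly_ind => [|p q _ _|a f g hf hg] z.
- exact: cst_continuous.
- apply: (@continuousM _ _ (fun z => trig1 p z.1) (fun z => trig1 q z.2)).
  + by apply: continuous_comp; [exact: cvg_fst|exact: trig1_continuous].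
  + by apply: continuous_comp; [exact: cvg_snd|exact: trig1_continuous].
- apply: (@continuousD _ _ _ (fun x => a * f x) g); last exact: hg.
  by apply: (@continuousM _ _ (fun=> a) f); [exact: cst_continuous|exact: hf].
Qed.

Lemma trigpoly_periodic N f : trigpoly N f -> Defs.periodic f.
Proof.
move: f; apply: trigpoly_ind => [|p q _ _|a f g hf hg] x y.
- by [].
- by rewrite /trig2 /= !trig1_periodic.
- by case: (hf x y) (hg x y) => -> -> [-> ->].
Qed.

Lemma trigpoly_test N f : trigpoly N f -> test_fun f.
Proof.
move=> hf; split; last exact: trigpoly_periodic hf.
move=> s /=; have {}hf : trigpoly N (foldr partial f s).
  by elim: s => //= i s; exact: trigpoly_partial.
split; first exact: trigpoly_continuous hf.
by move=> i x; exact: trigpoly_derivable hf.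
Qed.

Lemma trigpoly_bounded N f : trigpoly N f -> exists M, forall z, `|f z| <= M.
Proof.
move: f; apply: trigpoly_ind => [|p q _ _|a f g [M hM] [K hK]].
- by exists 0 => z; rewrite normr0.
- by exists 1 => z; rewrite /trig2 normrM mulr_ile1// trig1_le1.
- exists (`|a| * M + K) => z; rewrite (le_trans (ler_normD _ _))// normrM.
  by rewrite lerD// ler_wpM2l.
Qed.

Lemma trigpoly_measurable N f : trigpoly N f ->
  measurable_fun (setT : set (measurableTypeR R * measurableTypeR R)) f.
Proof.
have m1 p : measurable_fun setT (trig1 p : measurableTypeR R -> R).
  by apply: continuous_measurable_fun; exact: trig1_continuous.
move: f; apply: trigpoly_ind => [|p q _ _|a f g hf hg].
- exact: measurable_cst.
- by apply: measurable_funM; [exact: (measurableT_comp (m1 p) measurable_fst)|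
    exact: (measurableT_comp (m1 q) measurable_snd)].
- by apply: measurable_funD => //; exact: measurable_funM.
Qed.
End Trig.

(** * Integration on the torus *)

Section Mrestr.
Context d (T : measurableType d) (R : realType) (mu : {measure set T -> \bar R}).
Context (D : set T) (mD : measurable D).

Lemma integral_mrestr (f : T -> \bar R) :
  (\int[mrestr mu mD]_x f x = \int[mu]_(x in D) f x)%E.
Proof.
transitivity (\int[mrestr mu mD]_(x in D) f x)%E; last first.
  by apply: eq_measure_integral => A mA AD; rewrite /mrestr/= /mrestr setIidl.
rewrite [RHS]integral_mkcond; apply: ae_integral.
exists (~` D); split; first exact: measurableC.
  by rewrite /= /mrestr setICl measure0.
by move=> x /= h xD; apply: h => _; rewrite patchE mem_set.
Qed.

Lemma integrable_mrestr (f : T -> \bar R) :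
  (mrestr mu mD).-integrable setT f -> mu.-integrable D f.
Proof.
move=> /integrableP[mf fi]; apply/integrableP; split.
  exact: measurable_funTS.
by rewrite -integral_mrestr.
Qed.
End Mrestr.

Section TorusMeasure.
Context {R : realType}.
Local Notation leb := (@lebesgue_measure R).
Local Notation X2 := (measurableTypeR R * measurableTypeR R)%type.
Local Notation torus := (@torus R).
Implicit Types f g : torusfun R.

Definition circ : set (measurableTypeR R) := `[0, 2 * pi].

Lemma pi2_gt0 : 0 < 2 * pi :> R. Proof. by rewrite mulr_gt0// pi_gt0. Qed.

Lemma leb_circ : leb circ = (2 * pi)%:E.
Proof. by rewrite lebesgue_measure_itv /= lte_fin pi2_gt0 sube0. Qed.

Lemma torusE (A : set X2) : torus A = (leb \x leb)%E (A `&` cell).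
Proof. by []. Qed.

Lemma torusT : torus setT = ((2 * pi) ^+ 2)%:E.
Proof.
rewrite torusE setTI; transitivity (leb circ * leb circ)%E.
  by apply: product_measure1E; exact: measurable_itv.
by rewrite leb_circ -EFinM expr2.
Qed.

Lemma torusT_lty : (torus setT < +oo)%E.
Proof. by rewrite torusT ltry. Qed.

Lemma torus_bnd_integrable (f : torusfun R) (M : R) :
  measurable_fun (setT : set X2) f -> (forall z, cell z -> `|f z| <= M) ->
  torus.-integrable setT (EFin \o f).
Proof.
move=> mf fM; apply/integrableP; split; first exact/measurable_EFinP.
rewrite integral_mrestr.
apply: (@le_lt_trans _ _ (\int[leb \x leb]_(z in cell) (M%:E))%E).
  apply: ge0_le_integral => //; first exact: measurable_cell.
  by apply: measurableT_comp => //; apply/measurable_EFinP; exact: measurable_funTS.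
rewrite integral_cst; last exact: measurable_cell.
rewrite [X in (_ * X)%E](_ : _ = ((2 * pi) ^+ 2)%:E); first exact: ltry.
by rewrite -torusT torusE setTI.
Qed.

Lemma torus_fubini1 (f : torusfun R) : torus.-integrable setT (EFin \o f) ->
  (\int[torus]_z (f z)%:E = \int[leb]_(x in circ) \int[leb]_(y in circ) (f (x, y))%:E)%E.
Proof.
move=> fi; rewrite integral_mrestr integral_mkcond.
rewrite -integral12_prod_meas1; last first.
  apply/(integrable_mkcond _ measurable_cell).
  exact: (@integrable_mrestr _ _ _ _ _ measurable_cell _ fi).
rewrite [RHS]integral_mkcond; apply: eq_integral => x _.
rewrite /fubini_F patchE; case: ifPn => [/set_mem xc|/negP xc].
  rewrite [RHS]integral_mkcond; apply: eq_integral => y _.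
  rewrite !patchE; case: (boolP (y \in circ)) => yc.
    by rewrite mem_set//; split => //; exact: set_mem.
  by rewrite memNset// => -[_ h]; move/negP: yc; apply; exact: mem_set.
apply: integral0_eq => y _; rewrite patchE memNset// => -[h _]; apply: xc.
exact: mem_set.
Qed.

Lemma torus_fubini2 (f : torusfun R) : torus.-integrable setT (EFin \o f) ->
  (\int[torus]_z (f z)%:E = \int[leb]_(y in circ) \int[leb]_(x in circ) (f (x, y))%:E)%E.
Proof.
move=> fi; rewrite integral_mrestr integral_mkcond.
rewrite -integral21_prod_meas1; last first.
  apply/(integrable_mkcond _ measurable_cell).
  exact: (@integrable_mrestr _ _ _ _ _ measurable_cell _ fi).
rewrite [RHS]integral_mkcond; apply: eq_integral => y _.
rewrite /fubini_G patchE; case: ifPn => [/set_mem yc|/negP yc].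
  rewrite [RHS]integral_mkcond; apply: eq_integral => x _.
  rewrite !patchE; case: (boolP (x \in circ)) => xc.
    by rewrite mem_set//; split => //; exact: set_mem.
  by rewrite memNset// => -[h _]; move/negP: xc; apply; exact: mem_set.
apply: integral0_eq => x _; rewrite patchE memNset// => -[_ h]; apply: yc.
exact: mem_set.
Qed.

Definition opencell : set X2 := `]0, 2 * pi[ `*` `]0, 2 * pi[.

Lemma measurable_opencell : measurable opencell.
Proof. by apply: measurableX; exact: measurable_itv. Qed.

(** The boundary of the cell is null.  This is what allows limits of periodic
    functions to be taken inside the period only. *)
Lemma ae_opencell : {ae torus, forall z, opencell z}.
Proof.
exists (~` opencell); split => //; first by apply: measurableC; exact: measurable_opencell.
have e : torus opencell = ((2 * pi) ^+ 2)%:E.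
  rewrite torusE setIidl; last first.
    by move=> z [] /= h1 h2; split => /=; apply: subset_itv_oo_cc.
  rewrite /opencell; transitivity (leb `]0%R, (2 * pi)%R[ * leb `]0%R, (2 * pi)%R[)%E.
    by apply: product_measure1E; exact: measurable_itv.
  rewrite (_ : leb _ = (2 * pi)%:E) -?EFinM ?expr2//.
  by rewrite lebesgue_measure_itv /= lte_fin pi2_gt0 sube0.
rewrite -setTD measureD//=; [|exact: measurable_opencell|exact: torusT_lty].
by rewrite setTI -/torus e torusT subee.
Qed.

Lemma ftc (g : R -> R) (a b : R) : a <= b -> (forall x : R, derivable g x 1) ->
  continuous (fun x : R => 'D_1 g x) ->
  (\int[leb]_(x in `[a, b]) ('D_1 g x)%:E = (g b - g a)%:E)%E.
Proof.
move=> ab dg cg; have cgg : continuous g.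
  by move=> x; apply: differentiable_continuous; exact/derivable1_diffP.
move: ab; rewrite le_eqVlt => /predU1P[->|ab].
  by rewrite set_itv1 integral_set1 subrr.
rewrite (@continuous_FTC2 _ _ g) ?EFinB//.
- exact: continuous_subspaceT.
- split; first by move=> x _; exact: dg.
    by apply: cvg_at_right_filter; exact: cgg.
  by apply: cvg_at_left_filter; exact: cgg.
- by move=> x _; rewrite derive1E.
Qed.

Lemma continuous_slice0 f y : continuous f -> continuous (fun x : R => f (x, y)).
Proof.
move=> cf x; apply: (@continuous_comp _ _ _ (fun x : R => (x, y)) f); last exact: cf.
by apply: (@cvg_pair _ _ _ (nbhs x) (nbhs x) (nbhs y)); [exact: cvg_id|exact: cvg_cst].
Qed.

Lemma continuous_slice1 f x : continuous f -> continuous (fun y : R => f (x, y)).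
Proof.
move=> cf y; apply: (@continuous_comp _ _ _ (fun y : R => (x, y)) f); last exact: cf.
by apply: (@cvg_pair _ _ _ (nbhs y) (nbhs x) (nbhs y)); [exact: cvg_cst|exact: cvg_id].
Qed.

Lemma int_partial0 N (f : torusfun R) (a b y : R) : a <= b -> trigpoly N f ->
  (\int[leb]_(x in `[a, b]) (partial ord0 f (x, y))%:E = (f (b, y) - f (a, y))%:E)%E.
Proof.
move=> ab hf; have -> : (fun x : R => (partial ord0 f (x, y))%:E) =
    (fun x : R => ('D_1 (fun x : R => f (x, y)) x)%:E).
  by apply/funext => x; rewrite partial0E.
apply: (@ftc (fun x => f (x, y))) => //.
- move=> x; have := @trigpoly_derivable _ _ _ ord0 (x, y) hf.
  by move/derivable_slice0.
- have -> : (fun x : R => 'D_1 (fun x0 : R => f (x0, y)) x) =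
      (fun x : R => partial ord0 f (x, y)).
    by apply/funext => x; rewrite partial0E.
  by apply: continuous_slice0; apply: trigpoly_continuous; exact: trigpoly_partial hf.
Qed.

Lemma int_partial1 N (f : torusfun R) (a b x : R) : a <= b -> trigpoly N f ->
  (\int[leb]_(y in `[a, b]) (partial ord_max f (x, y))%:E = (f (x, b) - f (x, a))%:E)%E.
Proof.
move=> ab hf; have -> : (fun y : R => (partial ord_max f (x, y))%:E) =
    (fun y : R => ('D_1 (fun y : R => f (x, y)) y)%:E).
  by apply/funext => y; rewrite partial1E.
apply: (@ftc (fun y => f (x, y))) => //.
- move=> y; have := @trigpoly_derivable _ _ _ ord_max (x, y) hf.
  by move/derivable_slice1.
- have -> : (fun y : R => 'D_1 (fun y0 : R => f (x, y0)) y) =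
      (fun y : R => partial ord_max f (x, y)).
    by apply/funext => y; rewrite partial1E.
  by apply: continuous_slice1; apply: trigpoly_continuous; exact: trigpoly_partial hf.
Qed.

Lemma trigpoly_integrable N f : trigpoly N f -> torus.-integrable setT (EFin \o f).
Proof.
move=> hf; have [M fM] := trigpoly_bounded hf.
by apply: (@torus_bnd_integrable _ M) => //; exact: trigpoly_measurable hf.
Qed.

(** Integrating first in the direction of the derivative leaves boundary terms
    that cancel by periodicity. *)
Lemma int_trigpoly_partial N i f : trigpoly N f -> int_torus (partial i f) = 0.
Proof.
move=> hf; have p0 : 0 <= 2 * pi :> R by rewrite ltW// pi2_gt0.
rewrite /int_torus /Rintegral.
suff -> : (\int[torus]_z (partial i f z)%:E = 0)%E by [].
have := trigpoly_integrable (trigpoly_partial i hf).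
move: i; apply: ord2_cases => fi.
- rewrite torus_fubini2//; apply: integral0_eq => y _.
  rewrite (@int_partial0 N)//.
  by have := (trigpoly_periodic hf 0 y).1; rewrite add0r => ->; rewrite subrr.
- rewrite torus_fubini1//; apply: integral0_eq => x _.
  rewrite (@int_partial1 N)//.
  by have := (trigpoly_periodic hf x 0).2; rewrite add0r => ->; rewrite subrr.
Qed.

Lemma trigpoly_ibp N M i f g : trigpoly N f -> trigpoly M g ->
  int_torus (fun z => f z * partial i g z) = - int_torus (fun z => partial i f z * g z).
Proof.
move=> hf hg; apply/eqP; rewrite -subr_eq0 opprK /int_torus; apply/eqP.
rewrite -RintegralD//; last 2 first.
- by apply: trigpoly_integrable; apply: trigpolyM hf _; exact: trigpoly_partial hg.
- by apply: trigpoly_integrable; apply: trigpolyM hg; exact: trigpoly_partial hf.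
rewrite -[RHS](int_trigpoly_partial i (trigpolyM hf hg)).
congr (Rintegral _ _ _); apply/funext => z; rewrite /partial.
have df : derivable f z (basis_vec i) := trigpoly_derivable hf.
have dg : derivable g z (basis_vec i) := trigpoly_derivable hg.
by rewrite (deriveM df dg) /GRing.scale /= [g z * _]mulrC.
Qed.

End TorusMeasure.

(** * Polynomials converging to a step *)

Section Step.
Context {R : realType}.

Lemma bernoulli_ge (y : R) M : 0 <= y <= 1 -> 1 - M%:R * y <= (1 - y) ^+ M.
Proof.
move=> /andP[y0 y1]; elim: M => [|M IH]; first by rewrite mul0r subr0 expr0.
rewrite exprS; apply: (@le_trans _ _ ((1 - y) * (1 - M%:R * y))); last first.
  by rewrite ler_wpM2l// subr_ge0.
have : 0 <= (M%:R : R) by exact: ler0n.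
rewrite -natr1; nra.
Qed.

(** The product of [(1 - y) ^ M] and [(1 + y) ^ M] is at most 1, and Bernoulli's
    inequality bounds the second factor from below. *)
Lemma bernoulli_le (y : R) M : 0 <= y <= 1 -> (1 - y) ^+ M <= (1 + M%:R * y)^-1.
Proof.
move=> /andP[y0 y1].
have b : 1 + M%:R * y <= (1 + y) ^+ M.
  elim: M => [|M IH]; first by rewrite mul0r addr0 expr0.
  rewrite exprS; apply: (@le_trans _ _ ((1 + y) * (1 + M%:R * y))); last first.
    by rewrite ler_wpM2l// addr_ge0.
  have : 0 <= (M%:R : R) by exact: ler0n.
  rewrite -natr1; nra.
have p : 0 < 1 + M%:R * y by rewrite ltr_pwDl// mulr_ge0.
rewrite -[leRHS]mul1r ler_pdivlMr//.
apply: (@le_trans _ _ ((1 - y) ^+ M * (1 + y) ^+ M)).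
  by rewrite ler_wpM2l// exprn_ge0// subr_ge0.
rewrite -exprMn -[leRHS](expr1n _ M) lerXn2r ?nnegrE//; nra.
Qed.

(** With [y = (z / k) ^ n] and [M = n k ^ n], the product [M y = n z ^ n] tends
    to 0 for [z < 1] and to infinity for [z >= 1], while
    [1 - M y <= (1 - y) ^ M <= 1 / (1 + M y)]: on [0, k] these polynomials
    converge boundedly to the indicator of [z < 1]. *)
Definition spoly (k n : nat) (z : R) : R :=
  (1 - (z / k%:R) ^+ n) ^+ (n * k ^ n).

Lemma spoly_itv k n (z : R) : 0 <= z <= k%:R -> 0 <= spoly k n z <= 1.
Proof.
move=> /andP[z0 zk]; have h : 0 <= (z / k%:R) ^+ n <= 1.
  rewrite exprn_ge0 ?divr_ge0//= exprn_ile1 ?divr_ge0//.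
  have [->|k0] := posnP k; first by rewrite invr0 mulr0.
  by rewrite ler_pdivrMr ?ltr0n// mul1r.
case/andP: h => h0 h1.
by rewrite exprn_ge0 ?subr_ge0//= exprn_ile1 ?subr_ge0// gerBl.
Qed.

(** Each of the [n] terms of the geometric sum is at least [w ^ n]. *)
Lemma natX_bound (w : R) n : 0 <= w < 1 -> n%:R * w ^+ n <= (1 - w)^-1.
Proof.
move=> /andP[w0 w1]; have p : 0 < 1 - w by rewrite subr_gt0.
have [->|n0] := posnP n; first by rewrite mul0r invr_ge0 ltW.
rewrite -[leRHS]mul1r ler_pdivlMr//.
have h : (n%:R * w ^+ n) <= \sum_(i < n) w ^+ i.
  rewrite mulr_natl -[n in _ *+ n]card_ord -sumr_const; apply: ler_sum => i _.
  by apply: ler_wiXn2l; [exact: w0|exact: ltW|exact/ltnW/ltn_ord].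
apply: (@le_trans _ _ ((\sum_(i < n) w ^+ i) * (1 - w))).
  by rewrite ler_wpM2r// ltW.
rewrite mulrC -[_ * _]opprK -mulNr opprB -subrX1 opprB gerBl exprn_ge0//.
Qed.

(** With [w] the square root of [z], [n z ^ n = (n w ^ n) w ^ n] is at most
    [w ^ n / (1 - w)]. *)
Lemma cvg_natX (z : R) : 0 <= z < 1 -> (fun n => n%:R * z ^+ n) @ \oo --> 0.
Proof.
move=> /andP[z0 z1]; pose w := Num.sqrt z.
have w0 : 0 <= w by exact: sqrtr_ge0.
have w1 : w < 1 by rewrite -sqrtr1 ltr_sqrt.
have -> : z = w * w by rewrite -expr2 sqr_sqrtr.
apply: (@squeeze_cvgr _ _ _ _ (cst 0) (fun n => (1 - w)^-1 * w ^+ n)).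
- apply: nearW => n; rewrite exprMn mulrA mulr_ge0 ?mulr_ge0 ?exprn_ge0 ?ler0n//=.
  by rewrite ler_wpM2r ?exprn_ge0// natX_bound// w0.
- exact: cvg_cst.
- have -> : (0 : R) = (1 - w)^-1 * 0 by rewrite mulr0.
  apply: cvgM; first exact: cvg_cst.
  by apply: cvg_expr; rewrite ger0_norm.
Qed.

Lemma cvg_spoly k (z : R) : 0 <= z <= k%:R ->
  (fun n => spoly k n z) @ \oo --> ((z < 1)%R%:R : R).
Proof.
move=> zk; have /andP[z0 zk'] := zk.
have [k0|k0] := posnP k.
  have -> : z = 0 by apply/eqP; rewrite eq_le z0 andbT (le_trans zk')// k0.
  rewrite ltr01 /spoly k0; apply: cvg_near_cst.
  by exists 1%N => // n /= n0; rewrite exp0n// muln0 expr0.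
have y01 n : 0 <= (z / k%:R) ^+ n <= 1.
  rewrite exprn_ge0 ?divr_ge0//= exprn_ile1 ?divr_ge0//.
  by rewrite ler_pdivrMr ?ltr0n// mul1r.
have My n : (n * k ^ n)%:R * (z / k%:R) ^+ n = n%:R * z ^+ n.
  rewrite natrM natrX expr_div_n [_ / _]mulrC mulrA -(mulrA n%:R) divff ?mulr1//.
  by rewrite expf_neq0// pnatr_eq0 -lt0n.
case: ltP => z1.
  apply: (@squeeze_cvgr _ _ _ _ (fun n => 1 - n%:R * z ^+ n) (cst 1)).
  - apply: nearW => n; have /andP[_ ->] := spoly_itv n zk; rewrite andbT.
    by rewrite -My; apply: bernoulli_ge.
  - rewrite -[X in _ --> X]subr0; apply: cvgB; first exact: cvg_cst.
    by apply: cvg_natX; rewrite z0.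
  - exact: cvg_cst.
apply: (@squeeze_cvgr _ _ _ _ (cst 0) (@harmonic R)).
- apply: nearW => n; have /andP[-> _] := spoly_itv n zk; rewrite andTb.
  apply: (le_trans (bernoulli_le _ (y01 n))); rewrite My /harmonic.
  rewrite lef_pV2 ?posrE ?ltr_pwDl ?mulr_ge0 ?exprn_ge0//.
  by rewrite -natr1 addrC lerD2l ler_peMr// exprn_ege1.
- exact: cvg_cst.
- exact: cvg_harmonic.
Qed.
End Step.

(** * A monotone class theorem for trigonometric polynomials *)

Section MonotoneClass.
Context {R : realType}.
Local Notation X2 := (measurableTypeR R * measurableTypeR R)%type.

Lemma trigpoly_shift_cos0 (c : R) : trigpoly 1 (fun z : R * R => cos (z.1 - c)).
Proof.
have -> : (fun z : R * R => cos (z.1 - c)) = (fun z => cos c * trig2 ((1, 0), (0, 0))%N z +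
    sin c * trig2 ((0, 1), (0, 0))%N z).
  by apply/funext => z; rewrite cosB /trig2 /trig1 /= !expr0 !expr1 !mulr1 mul1r; ring.
by apply: trigpolyD; apply: trigpolyZ; exact: trigpoly_trig2.
Qed.

Lemma trigpoly_shift_cos1 (c : R) : trigpoly 1 (fun z : R * R => cos (z.2 - c)).
Proof.
have -> : (fun z : R * R => cos (z.2 - c)) = (fun z => cos c * trig2 ((0, 0), (1, 0))%N z +
    sin c * trig2 ((0, 0), (0, 1))%N z).
  by apply/funext => z; rewrite cosB /trig2 /trig1 /= !expr0 !expr1 !mulr1 !mul1r; ring.
by apply: trigpolyD; apply: trigpolyZ; exact: trigpoly_trig2.
Qed.

Lemma trigpoly_spoly N f (a : R) k n : trigpoly N f ->
  exists M, trigpoly M (fun z => spoly k n ((1 - f z) / a)).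
Proof.
move=> hf; rewrite /spoly; eexists; apply: trigpoly_exp.
have -> : (fun z => 1 - ((1 - f z) / a / k%:R) ^+ n) =
   (fun z => 1 + -1 * ((- (a^-1 / k%:R)) * f z + (a^-1 / k%:R)) ^+ n).
  by apply/funext => z; congr (_ + _); rewrite mulN1r; congr (- (_ ^+ _)); ring.
apply: trigpolyD; first by apply: (trigpoly_le (leq0n _)); exact: trigpoly_cst.
apply: trigpolyZ; apply: trigpoly_exp; apply: trigpolyD; first exact: trigpolyZ hf.
by apply: (trigpoly_le (leq0n _)); exact: trigpoly_cst.
Qed.

(** Convergence is asked inside the period only, since a trigonometric
    polynomial takes the same value at 0 and at 2 pi.  The sequence is recorded
    as a polynomial in either coordinate, so that products reach rectangles. *)
Definition approximable (A : set R) := exists s : nat -> R -> R,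
  [/\ forall n x, 0 <= s n x <= 1,
      forall n, exists N, trigpoly N (fun z : R * R => s n z.1),
      forall n, exists N, trigpoly N (fun z : R * R => s n z.2) &
      forall x, 0 < x < 2 * pi -> s ^~ x @ \oo --> (\1_A x : R)].

Lemma approximable_cst (A : set R) (b : bool) :
  (forall x, 0 < x < 2 * pi -> (x \in A) = b) -> approximable A.
Proof.
move=> Ab; exists (fun _ _ => b%:R); split.
- by move=> n x; rewrite ler0n lern1 leq_b1.
- by move=> n; exists 0%N; exact: trigpoly_cst.
- by move=> n; exists 0%N; exact: trigpoly_cst.
- by move=> x /Ab; rewrite indicE => ->; exact: cvg_cst.
Qed.

(** For [0 < b < 2 pi] and [x] inside the period, [x < b] means that [x] is
    closer than [b / 2] to [b / 2] on the circle, that is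
    [cos (x - b / 2) > cos (b / 2)], that is [(1 - cos (x - b / 2)) / a < 1] with
    [a = 1 - cos (b / 2)].  The step polynomials are applied to this quotient. *)
Lemma approximable_ray (b : R) : approximable `]-oo, b[.
Proof.
have [b0|b0] := leP b 0.
  apply: (@approximable_cst _ false) => x /andP[x0 _].
  by rewrite memNset//= in_itv/= => xb; move: (lt_le_trans (lt_trans x0 xb) b0); rewrite ltxx.
have [b2|b2] := leP (2 * pi) b.
  apply: (@approximable_cst _ true) => x /andP[_ x2].
  by rewrite mem_set//= in_itv/= (lt_le_trans x2).
pose a := 1 - cos (b / 2).
have a0 : 0 < a.
  have h : 0 <= b / 2 <= pi by apply/andP; split; lra.
  have : cos (b / 2) < cos 0 by rewrite ltr_cos ?in_itv/= ?lexx ?pi_ge0//; lra.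
  by rewrite cos0 -subr_gt0.
have [k k0] : exists k : nat, 2 / a <= k%:R.
  have h : 0 <= 2 / a by rewrite divr_ge0// ltW.
  by exists (Num.bound (2 / a)); exact/ltW/archi_boundP.
exists (fun n x => spoly k n ((1 - cos (x - b / 2)) / a)).
have zk x : 0 <= (1 - cos (x - b / 2)) / a <= k%:R.
  apply/andP; split; first by rewrite divr_ge0 ?(ltW a0)// subr_ge0 cos_le1.
  by rewrite (le_trans _ k0)// ler_pM2r ?invr_gt0//; have := cos_geN1 (x - b / 2); lra.
split.
- by move=> n x; exact: spoly_itv.
- by move=> n; apply: trigpoly_spoly; exact: trigpoly_shift_cos0.
- by move=> n; apply: trigpoly_spoly; exact: trigpoly_shift_cos1.
move=> x /andP[x0 x2]; rewrite indicE.
have -> : (x \in `]-oo, b[%classic) = ((1 - cos (x - b / 2)) / a < 1).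
  rewrite ltr_pdivrMr// mul1r /a.
  transitivity (x < b).
    by apply/idP/idP => [/set_mem|xb]; [|apply: mem_set]; rewrite /= in_itv.
  have e : cos (x - b / 2) - cos (b / 2) = 2 * sin (x / 2) * sin ((b - x) / 2).
    have -> : x - b / 2 = x / 2 - (b - x) / 2 by field.
    rewrite [in cos (b / 2)](_ : b / 2 = x / 2 + (b - x) / 2); last by field.
    by rewrite cosB cosD; ring.
  have s0 : 0 < 2 * sin (x / 2).
    by rewrite mulr_gt0// sin_gt0_pi//; apply/andP; split; lra.
  have -> : (1 - cos (x - b / 2) < 1 - cos (b / 2)) =
     (0 < cos (x - b / 2) - cos (b / 2)).
    by apply/idP/idP; lra.
  rewrite e pmulr_rgt0//; apply/idP/idP => xb.
    by apply: sin_gt0_pi; apply/andP; split; lra.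
  rewrite ltNge; apply/negP => bx; move: xb; rewrite ltNge => /negP; apply.
  rewrite -[_ / 2]opprK sinN oppr_le0.
  by apply: sin_ge0_pi; apply/andP; split; lra.
exact: cvg_spoly.
Qed.

Context (P : torusfun R -> Prop).
Hypothesis PT : forall N f, trigpoly N f -> P f.
Hypothesis PL : forall a f g, P f -> P g -> P (fun z => a * f z + g z).
Hypothesis Plim : forall (F : nat -> torusfun R) f M,
  (forall n z, `|F n z| <= M) -> (forall n, P (F n)) ->
  (forall z, opencell z -> F ^~ z @ \oo --> f z) -> P f.

Let P0 : P (fun=> 0).
Proof. exact: PT (trigpoly0 0). Qed.

(** Dynkin's argument in the variable [phi z], with a fixed bounded factor [h].
    It serves for each coordinate in turn, from rays to Borel sets, and then
    from rectangles to all measurable sets. *)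
Let dynkin_P d (T : measurableType d) (G : set (set T)) (phi : R * R -> T)
    (h : torusfun R) : @measurable d T = <<s G >> -> setI_closed G ->
  (forall z, `|h z| <= 1) -> P h ->
  (forall S, G S -> P (fun z => \1_S (phi z) * h z)) ->
  forall S, measurable S -> P (fun z => \1_S (phi z) * h z).
Proof.
move=> GE GI h1 Ph PG S mS.
apply: (@dynkin_induction d T G (fun S => P (fun z => \1_S (phi z) * h z))) => //.
- rewrite (_ : (fun z => _) = h)//.
  by apply/funext => z; rewrite indicT mul1r.
- move=> A mA PA; have -> : (fun z => \1_(~` A) (phi z) * h z) =
     (fun z => -1 * (\1_A (phi z) * h z) + h z).
    apply/funext => z; rewrite indicC indicE; case: (_ \in _) => /=; ring.
  exact: PL.
- move=> F mF tF PF.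
  apply: (@Plim (fun n z => \1_(\bigcup_(i < n) F i) (phi z) * h z) _ 1).
  + move=> n z; rewrite normrM mulr_ile1// indicE.
    by case: (_ \in _); rewrite ?normr1 ?normr0.
  + elim => [|n IH].
      rewrite (_ : (fun z => _) = (fun=> 0))//.
      by apply/funext => z; rewrite bigcup_mkord big_ord0 indic0 mul0r.
    have -> : (fun z => \1_(\bigcup_(i < n.+1) F i) (phi z) * h z) =
       (fun z => 1 * (\1_(F n) (phi z) * h z) + \1_(\bigcup_(i < n) F i) (phi z) * h z).
      apply/funext => z; rewrite mul1r -mulrDl; congr (_ * _).
      rewrite !indicE; have [Fz|Fz] := boolP (phi z \in F n).
        rewrite mem_set; last by exists n => /=; [exact: ltnSn|exact: set_mem].
        rewrite memNset ?addr0// => -[i /= ni Fiz].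
        have ne : F i `&` F n !=set0 by exists (phi z); split => //; exact: set_mem.
        by move: ni; rewrite (tF i n I I ne) ltnn.
      rewrite add0r; congr (_%:R); congr nat_of_bool; apply/idP/idP => /set_mem[i /= ni Fiz].
        apply: mem_set; exists i => //=; move: ni; rewrite ltnS leq_eqVlt => /predU1P[ni|//].
        by move/negP: Fz; case; rewrite -ni; exact: mem_set.
      by apply: mem_set; exists i => //=; exact: leq_trans ni _.
    exact: PL.
  + move=> z _; apply: cvgM; last exact: cvg_cst.
    rewrite indicE; have [/set_mem[i _ Fiz]|Fz] := boolP (phi z \in \bigcup_k F k).
      apply: cvg_near_cst; exists i.+1 => // n /= ni; rewrite indicE mem_set//.
      by exists i.
    apply: cvg_near_cst; apply: nearW => n; rewrite indicE memNset// => -[i _ Fiz].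
    by move/negP: Fz; case; apply: mem_set; exists i.
- by rewrite -GE.
Qed.

Let rays : set (set (measurableTypeR R)) := [set A | exists x, A = `]-oo, x[%classic].

Let rays_gen : @measurable _ (measurableTypeR R) = <<s rays >>.
Proof. exact: RGenInftyO.measurableE. Qed.

Let raysI : setI_closed rays.
Proof.
move=> _ _ [a ->] [b ->]; exists (Num.min a b); apply/seteqP; split => x /=;
  rewrite !in_itv/= lt_min.
  by move=> [-> ->].
by move/andP.
Qed.

Let P_ray2 A B : rays A -> rays B -> P (fun z => \1_A z.1 * \1_B z.2).
Proof.
move=> [a ->] [b ->].
have [s [s01 s1 _ sl]] := approximable_ray a.
have [t [t01 _ t2 tl]] := approximable_ray b.
apply: (@Plim (fun n z => s n z.1 * t n z.2) _ 1).
- move=> n z; have /andP[? ?] := s01 n z.1; have /andP[? ?] := t01 n z.2.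
  by rewrite normrM mulr_ile1// ger0_norm.
- move=> n; have [N hN] := s1 n; have [M hM] := t2 n.
  exact: PT (trigpolyM hN hM).
- move=> z [/=]; rewrite !in_itv/= => h1 h2.
  by apply: cvgM; [exact: sl|exact: tl].
Qed.

Let P_one (A : set R) : rays A -> P (\1_A \o snd).
Proof.
move=> [a ->]; have [s [s01 _ s2 sl]] := approximable_ray a.
apply: (@Plim (fun n z => s n z.2) _ 1).
- by move=> n z; have /andP[? ?] := s01 n z.2; rewrite ger0_norm.
- by move=> n; have [N hN] := s2 n; exact: PT hN.
- by move=> z [/= _]; rewrite in_itv/=; exact: sl.
Qed.

Let indic_le1 T (A : set T) x : `|\1_A x : R| <= 1.
Proof. by rewrite indicE; case: (_ \in _); rewrite ?normr1 ?normr0. Qed.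

Let P_ray_snd (A B : set (measurableTypeR R)) :
  measurable A -> rays B -> P (fun z => \1_A z.1 * \1_B z.2).
Proof.
move=> mA rB; apply: (@dynkin_P _ _ rays fst (fun z => \1_B z.2)) => //.
- exact: P_one.
- by move=> S rS; exact: P_ray2.
Qed.

Let P_rect (A B : set (measurableTypeR R)) :
  measurable A -> measurable B -> P (fun z => \1_A z.1 * \1_B z.2).
Proof.
move=> mA mB.
have -> : (fun z : R * R => \1_A z.1 * \1_B z.2) = (fun z => \1_B z.2 * \1_A z.1 : R).
  by apply/funext => z; rewrite mulrC.
apply: (@dynkin_P _ _ rays snd (fun z => \1_A z.1)) => //.
- have -> : (fun z : R * R => \1_A z.1) = (fun z => \1_A z.1 * 1 : R).
    by apply/funext => z; rewrite mulr1.
  apply: (@dynkin_P _ _ rays fst (fun=> 1)) => //.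
  + by move=> z; rewrite normr1.
  + exact: PT (trigpoly_cst 1).
  + move=> S [a ->]; have [s [s01 s1 _ sl]] := approximable_ray a.
    apply: (@Plim (fun n z => s n z.1) _ 1).
    * by move=> n z; have /andP[? ?] := s01 n z.1; rewrite ger0_norm.
    * by move=> n; have [N hN] := s1 n; exact: PT hN.
    * move=> z [/= + _]; rewrite in_itv/= mulr1; exact: sl.
- move=> S rS.
  have -> : (fun z : R * R => \1_S z.2 * \1_A z.1) = (fun z => \1_A z.1 * \1_S z.2 : R).
    by apply/funext => z; rewrite mulrC.
  exact: P_ray_snd.
Qed.

(** Products of rays are bounded limits of trigonometric polynomials; Dynkin's
    argument does the rest.  Uniqueness and density are both instances. *)
Lemma trig_monotone_class (S : set X2) : measurable S -> P (\1_S).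
Proof.
move=> mS.
have -> : \1_S = (fun z => \1_S z * 1 : R) by apply/funext => z; rewrite mulr1.
apply: (@dynkin_P _ _ [set A `*` B | A in measurable & B in measurable] id (fun=> 1)) => //.
- exact: measurable_prod_measurableType.
- move=> _ _ [A mA [B mB <-]] [C mC [D mD <-]].
  exists (A `&` C); first exact: measurableI.
  by exists (B `&` D); [exact: measurableI|rewrite setXI].
- by move=> z; rewrite normr1.
- exact: PT (trigpoly_cst 1).
- move=> _ [A mA [B mB <-]].
  have -> : (fun z => \1_(A `*` B) z * 1) = (fun z : X2 => \1_A z.1 * \1_B z.2 : R).
    by apply/funext => z; rewrite mulr1 !indicE -natrM mulnb in_setX.
  exact: P_rect.
Qed.
End MonotoneClass.

(** * Uniqueness and density in L2 *)

Section Rdct.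
Context d (T : measurableType d) (R : realType) (mu : {measure set T -> \bar R}).

Lemma Rdominated (D : set T) (F : nat -> T -> R) (f g : T -> R) :
  measurable D -> (forall n, measurable_fun D (F n)) ->
  mu.-integrable D (EFin \o g) ->
  (forall n x, D x -> `|F n x| <= g x) ->
  (forall x, D x -> F ^~ x @ \oo --> f x) ->
  mu.-integrable D (EFin \o f) /\
  (fun n => \int[mu]_(x in D) F n x) @ \oo --> \int[mu]_(x in D) f x.
Proof.
move=> mD mF gi Fg Ff.
have mf : measurable_fun D f by exact: measurable_fun_cvg mF Ff.
have [||||| fi _ c] := @dominated_convergence _ T R mu D mD
  (fun n => EFin \o F n) (EFin \o f) (EFin \o g).
- by move=> n; exact/measurable_EFinP.
- exact/measurable_EFinP.
- by apply: aeW => x Dx; apply: cvg_EFin; [exact: nearW|exact: Ff].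
- exact: gi.
- by apply: aeW => x n Dx; rewrite lee_fin Fg.
split => //; apply: fine_cvg; rewrite fineK//.
exact: integrable_fin_num.
Qed.
End Rdct.

Section Density.
Import HBSimple HBNNSimple.
Context {R : realType}.
Local Notation X2 := (measurableTypeR R * measurableTypeR R)%type.
Local Notation torus := (@torus R).
Local Notation U := (@opencell R).
Implicit Types f g : torusfun R.

Let mU : measurable U := measurable_opencell.

Lemma int_torus_opencell f : int_torus f = \int[torus]_(z in U) f z.
Proof.
rewrite /int_torus [RHS]Rintegral_mkcond; apply: ae_Rintegral.
by apply: filterS (@ae_opencell R) => z Uz _; rewrite patchE mem_set.
Qed.

Let cst_int (M : R) : torus.-integrable U (EFin \o cst M).
Proof.
apply: (integrableS measurableT) => //; apply: (@torus_bnd_integrable _ _ `|M|) => //.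
Qed.

Let le_lim (u : nat -> R) (l M : R) : u @ \oo --> l -> (forall n, `|u n| <= M) -> `|l| <= M.
Proof.
move=> ul uM; have h : (fun n => `|u n|) @ \oo --> `|l| by exact: cvg_norm.
rewrite -(cvg_lim _ h)//; apply: limr_le; first by apply/cvg_ex; exists `|l|.
exact: nearW.
Qed.

(** For a fixed integrable [g], the bounded [phi] orthogonal to [g] are stable
    under linear combinations and, by dominated convergence, under bounded
    limits.  So [g] has integral zero over every measurable set. *)
Lemma trig_uniq g : torus.-integrable setT (EFin \o g) ->
  (forall N phi, trigpoly N phi -> int_torus (fun z => g z * phi z) = 0) ->
  {ae torus, forall z, g z = 0}.
Proof.
move=> gi g0.
have giU : torus.-integrable U (EFin \o g) by exact: integrableS gi.
have mg : measurable_fun U g by exact: itg_meas giU.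
have bndi (M : R) (phi : torusfun R) : measurable_fun U phi -> (forall z, U z -> `|phi z| <= M) ->
    torus.-integrable U (EFin \o (fun z => g z * phi z)).
  move=> mphi phiM; apply: (@itg_le _ _ _ torus U _ (fun z => M * `|g z|)) => //.
  - exact: measurable_funM.
  - by move=> z Uz; rewrite normrM mulrC ler_wpM2r// phiM.
  - by apply: itgZ => //; exact: integrable_norm giU.
pose P (phi : torusfun R) := [/\ measurable_fun U phi, exists M, forall z, U z -> `|phi z| <= M &
  \int[torus]_(z in U) (g z * phi z) = 0].
have PA : forall A : set X2, measurable A -> P (\1_A).
  apply: trig_monotone_class.
  - move=> N phi hphi; split.
    + by apply: measurable_funTS; exact: trigpoly_measurable hphi.
    + by have [M hM] := trigpoly_bounded hphi; exists M.
    + by rewrite -int_torus_opencell; exact: g0 hphi.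
  - move=> a f h [mf [M fM] f0] [mh [K hK] h0]; split.
    + by apply: measurable_funD => //; exact: measurable_funM.
    + exists (`|a| * M + K) => z Uz; rewrite (le_trans (ler_normD _ _))// normrM.
      by rewrite lerD ?hK// ler_wpM2l// fM.
    + rewrite (@eq_Rintegral _ _ _ torus U
        (fun z => a * (g z * f z) + g z * h z)); last by move=> z _; ring.
      have i1 := bndi _ _ mf fM; have i2 := bndi _ _ mh hK.
      by rewrite RintegralD// ?RintegralZl ?f0 ?h0 ?mulr0 ?addr0//; exact: itgZ.
  - move=> F f M FM PF Ff.
    have mF n : measurable_fun U (F n) by case: (PF n).
    have fM z : U z -> `|f z| <= M by move=> Uz; apply: le_lim (Ff z Uz) _.
    split; [exact: measurable_fun_cvg mF Ff|by exists M|].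
    have [||||_ c] := @Rdominated _ _ _ torus U
      (fun n z => g z * F n z) (fun z => g z * f z) (fun z => M * `|g z|) mU.
    + by move=> n; exact: measurable_funM.
    + by apply: itgZ => //; exact: integrable_norm giU.
    + by move=> n z Uz; rewrite normrM mulrC ler_wpM2r.
    + by move=> z Uz; apply: cvgM; [exact: cvg_cst|exact: Ff].
    rewrite -(cvg_lim _ c)//; apply: cvg_lim => //.
    have -> : (fun n => \int[torus]_(x in U) (g x * F n x)) = (fun=> 0).
      by apply/funext => n; case: (PF n).
    exact: cvg_cst.
have ae0 : ae_eq torus U (EFin \o g) (fun=> 0%E).
  apply: integral_ae_eq => //.
  move=> A AU mA; rewrite integral0.
  have [_ _ h] := PA A mA.
  have giA : torus.-integrable A (EFin \o g) by exact: integrableS gi.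
  rewrite -[LHS]fineK; last exact: integrable_fin_num.
  congr EFin; rewrite -[RHS]h.
  rewrite -/(Rintegral torus A g) -[in LHS](setIidr AU) Rintegral_mkcondr.
  apply: eq_Rintegral => z _; rewrite patchE indicE.
  by case: (_ \in _); rewrite ?mulr1 ?mulr0.
by apply: filterS2 (@ae_opencell R) ae0 => z Uz /(_ Uz) [].
Qed.

(** The squared norm and the inner product of L2, as plain integrals. *)
Definition nsq f : R := int_torus (fun z => f z ^+ 2).
Definition sip f g : R := int_torus (fun z => f z * g z).

Lemma nsq_ge0 f : 0 <= nsq f.
Proof. by apply: Rintegral_ge0 => z _; exact: sqr_ge0. Qed.

Lemma sipff f : sip f f = nsq f.
Proof. by apply: eq_Rintegral => z _; rewrite expr2. Qed.

Lemma sipC f g : sip f g = sip g f.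
Proof. by apply: eq_Rintegral => z _; rewrite mulrC. Qed.

Lemma sip_linl (a : R) f g h : L2 f -> L2 g -> L2 h ->
  sip (fun z => a * f z + g z) h = a * sip f h + sip g h.
Proof.
move=> lf lg lh; have i1 := l2M lf lh; have i2 := l2M lg lh.
rewrite /sip /int_torus -RintegralZl// -RintegralD//; last exact: itgZ.
by apply: eq_Rintegral => z _; ring.
Qed.

Lemma sip_linr (a : R) f g h : L2 f -> L2 g -> L2 h ->
  sip h (fun z => a * f z + g z) = a * sip h f + sip h g.
Proof. by move=> *; rewrite sipC sip_linl// !(sipC h). Qed.

Lemma sipDl f g h : L2 f -> L2 g -> L2 h ->
  sip (fun z => f z + g z) h = sip f h + sip g h.
Proof.
move=> lf lg lh; rewrite -[sip f h]mul1r -sip_linl//.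
by congr sip; apply/funext => z; rewrite mul1r.
Qed.

Lemma sipZl (a : R) f h : L2 f -> L2 h -> sip (fun z => a * f z) h = a * sip f h.
Proof.
by move=> lf lh; rewrite /sip /int_torus -RintegralZl//; [|exact: l2M];
  apply: eq_Rintegral => z _; rewrite mulrA.
Qed.

Lemma sipBl f g h : L2 f -> L2 g -> L2 h ->
  sip (fun z => f z - g z) h = sip f h - sip g h.
Proof.
move=> lf lg lh; have -> : (fun z => f z - g z) = (fun z => -1 * g z + f z).
  by apply/funext => z; ring.
by rewrite sip_linl//; ring.
Qed.

Lemma sipBr f g h : L2 f -> L2 g -> L2 h ->
  sip h (fun z => f z - g z) = sip h f - sip h g.
Proof. by move=> *; rewrite sipC sipBl// !(sipC h). Qed.

Lemma sipDr f g h : L2 f -> L2 g -> L2 h ->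
  sip h (fun z => f z + g z) = sip h f + sip h g.
Proof. by move=> *; rewrite sipC sipDl// !(sipC h). Qed.

Lemma sip_CS f g : L2 f -> L2 g -> (sip f g) ^+ 2 <= nsq f * nsq g.
Proof. exact: l2_CS_sqr. Qed.

Lemma nsq_D f g : L2 f -> L2 g ->
  nsq (fun z => f z + g z) = nsq f + 2 * sip f g + nsq g.
Proof.
move=> lf lg; have lfg := l2D lf lg.
by rewrite -sipff sipDl// !sipDr// (sipC g f) !sipff; ring.
Qed.

Lemma L2norm_sqr f : L2 f -> L2norm f ^+ 2 = nsq f.
Proof. exact: l2norm_sqr. Qed.

Lemma L2norm_ge0 f : 0 <= L2norm f.
Proof. by rewrite fine_ge0// Lnorm_ge0. Qed.

Lemma trigpoly_L2 N f : trigpoly N f -> L2 f.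
Proof.
move=> hf; apply: l2P; first exact: trigpoly_measurable hf.
exact: (trigpoly_integrable (trigpoly_exp 2 hf)).
Qed.

Let approx f := forall e, 0 < e -> exists N psi, trigpoly N psi /\
  \int[torus]_(z in U) ((f z - psi z) ^+ 2) < e.

(** The functions that trigonometric polynomials approximate in mean square.
    They form a vector space stable under limits dominated by a square
    integrable function, hence contain indicators, then the nonnegative
    functions as increasing limits of simple functions. *)
Let Q f := [/\ measurable_fun U f,
  torus.-integrable U (EFin \o (fun z => f z ^+ 2)) & approx f].

Let sqr_int f g : measurable_fun U f -> measurable_fun U g ->
  torus.-integrable U (EFin \o (fun z => f z ^+ 2)) ->
  torus.-integrable U (EFin \o (fun z => g z ^+ 2)) ->
  torus.-integrable U (EFin \o (fun z => (f z + g z) ^+ 2)).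
Proof.
move=> mf mg fi gi.
apply: (@itg_le _ _ _ torus U _ (fun z => 2 * f z ^+ 2 + 2 * g z ^+ 2)) => //.
- by apply: measurable_funX; exact: measurable_funD.
- move=> z _; rewrite ger0_norm ?sqr_ge0//.
  by have := sqr_ge0 (f z - g z); nra.
- by apply: itgD => //; exact: itgZ.
Qed.

Let le_sqr f g : measurable_fun U f -> measurable_fun U g ->
  torus.-integrable U (EFin \o (fun z => f z ^+ 2)) ->
  torus.-integrable U (EFin \o (fun z => g z ^+ 2)) ->
  \int[torus]_(z in U) ((f z + g z) ^+ 2) <=
  2 * \int[torus]_(z in U) (f z ^+ 2) + 2 * \int[torus]_(z in U) (g z ^+ 2).
Proof.
move=> mf mg fi gi; rewrite -!RintegralZl// -RintegralD//; try exact: itgZ.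
apply: le_Rintegral => //.
- exact: sqr_int.
- by apply: itgD => //; exact: itgZ.
- by move=> z _; have := sqr_ge0 (f z - g z); nra.
Qed.

Let trig_int N psi : trigpoly N psi ->
  torus.-integrable U (EFin \o (fun z => psi z ^+ 2)).
Proof.
move=> h; apply: (integrableS measurableT) => //.
exact: (trigpoly_integrable (trigpoly_exp 2 h)).
Qed.

Let trig_meas N psi : trigpoly N psi -> measurable_fun U psi.
Proof. by move=> h; apply: measurable_funTS; exact: trigpoly_measurable h. Qed.

Let Z_sqr (a : R) f : torus.-integrable U (EFin \o (fun z => f z ^+ 2)) ->
  torus.-integrable U (EFin \o (fun z => (a * f z) ^+ 2)).
Proof.
move=> /(itgZ (a ^+ 2) mU); apply: itg_ext => z; by rewrite exprMn.
Qed.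

Let B_sqr f N psi : measurable_fun U f -> trigpoly N psi ->
  torus.-integrable U (EFin \o (fun z => f z ^+ 2)) ->
  torus.-integrable U (EFin \o (fun z => (f z - psi z) ^+ 2)).
Proof.
move=> mf hp fi; apply: sqr_int => //.
- by apply: measurableT_comp => //; exact: trig_meas hp.
- by have := trig_int hp; apply: itg_ext => z; rewrite sqrrN.
Qed.

Let Qlin (a : R) f g : Q f -> Q g -> Q (fun z => a * f z + g z).
Proof.
move=> [mf fi fa] [mg gi ga]; split.
- by apply: measurable_funD => //; exact: measurable_funM.
- by apply: sqr_int => //; [exact: measurable_funM|exact: Z_sqr].
move=> e e0; pose K := 4 * (a ^+ 2 + 1).
have a2 : 0 <= a ^+ 2 by exact: sqr_ge0.
have K0 : 0 < K by rewrite /K; lra.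
have [N [p [hp pe]]] := fa (e / K) (divr_gt0 e0 K0).
have [M [q [hq qe]]] := ga (e / 4) (ltac:(lra)).
exists (maxn N M), (fun z => a * p z + q z); split.
  apply: trigpolyD; last exact: (trigpoly_le (leq_maxr N M)).
  by apply: trigpolyZ; exact: (trigpoly_le (leq_maxl N M)).
have -> : (fun z => (a * f z + g z - (a * p z + q z)) ^+ 2) =
    (fun z => (a * (f z - p z) + (g z - q z)) ^+ 2).
  by apply/funext => z; congr (_ ^+ 2); ring.
have mfp : measurable_fun U (fun z => f z - p z).
  by apply: measurable_funB => //; exact: trig_meas hp.
have mgq : measurable_fun U (fun z => g z - q z).
  by apply: measurable_funB => //; exact: trig_meas hq.
have ifp := B_sqr mf hp fi; have igq := B_sqr mg hq gi.
apply: le_lt_trans (le_sqr _ _ _ _) _ => //; [exact: measurable_funM|exact: Z_sqr|].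
have -> : \int[torus]_(z in U) ((a * (f z - p z)) ^+ 2) =
    a ^+ 2 * \int[torus]_(z in U) ((f z - p z) ^+ 2).
  by rewrite -RintegralZl//; apply: eq_Rintegral => z _; rewrite exprMn.
set x := \int[torus]_(z in U) ((f z - p z) ^+ 2) in pe *.
set y := \int[torus]_(z in U) ((g z - q z) ^+ 2) in qe *.
have x0 : 0 <= x by apply: Rintegral_ge0 => z _; exact: sqr_ge0.
move: pe; rewrite ltr_pdivlMr// /K => pe; nra.
Qed.

Let Qlim (F : nat -> torusfun R) f h :
  (forall n, Q (F n)) -> torus.-integrable U (EFin \o (fun z => h z ^+ 2)) ->
  (forall n z, U z -> `|F n z| <= h z) ->
  (forall z, U z -> F ^~ z @ \oo --> f z) -> Q f.
Proof.
move=> QF hi Fh Ff.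
have mF n : measurable_fun U (F n) by case: (QF n).
have iF n : torus.-integrable U (EFin \o (fun z => F n z ^+ 2)) by case: (QF n).
have mf : measurable_fun U f by exact: measurable_fun_cvg mF Ff.
have fh z : U z -> `|f z| <= h z by move=> Uz; apply: le_lim (Ff z Uz) _ => n; exact: Fh.
have fi : torus.-integrable U (EFin \o (fun z => f z ^+ 2)).
  apply: (itg_le mU _ _ hi); first exact: measurable_funX.
  move=> z Uz; rewrite normrX lerXn2r ?nnegrE//; last exact: fh.
  by apply: le_trans (fh z Uz).
split => // e e0.
have [||||_ c] := @Rdominated _ _ _ torus U
      (fun n z => (f z - F n z) ^+ 2) (fun=> 0) (fun z => 4 * h z ^+ 2) mU.
- by move=> n; apply: measurable_funX; exact: measurable_funB.
- exact: itgZ.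
- move=> n z Uz; rewrite normrX.
  have -> : 4 * h z ^+ 2 = (2 * h z) ^+ 2 by ring.
  have h2 : `|f z - F n z| <= 2 * h z.
    rewrite (le_trans (ler_normB _ _))//; have := fh z Uz; have := Fh n z Uz; lra.
  by rewrite lerXn2r ?nnegrE//; apply: le_trans h2.
- move=> z Uz; have -> : (0 : R) = (f z - f z) ^+ 2 by rewrite subrr expr0n.
  have c1 : (fun n => f z - F n z) @ \oo --> f z - f z.
    by apply: cvgB; [exact: cvg_cst|exact: Ff].
  exact: (cvgM c1 c1).
have e4 : 0 < e / 4 by lra.
rewrite Rintegral_cst// mul0r in c.
have /cvgrPdist_lt/(_ _ e4)[n _ /(_ n (leqnn n))/=] := c.
rewrite sub0r normrN => hn.
have [N [p [hp pe]]] := (let: And3 _ _ h := QF n in h) _ e4.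
exists N, p; split => //.
have -> : (fun z => (f z - p z) ^+ 2) = (fun z => ((f z - F n z) + (F n z - p z)) ^+ 2).
  by apply/funext => z; congr (_ ^+ 2); ring.
apply: le_lt_trans (le_sqr _ _ _ _) _ => //.
- exact: measurable_funB.
- by apply: measurable_funB => //; exact: trig_meas hp.
- apply: sqr_int => //; first exact: measurableT_comp.
  by apply: itg_ext (iF n) => z; rewrite sqrrN.
- exact: (B_sqr (mF n) hp (iF n)).
have := ler_norm (\int[torus]_(z in U) ((f z - F n z) ^+ 2)).
move=> hh; have := le_lt_trans hh hn; lra.
Qed.

Let Qtrig N psi : trigpoly N psi -> Q psi.
Proof.
move=> h; split; [exact: trig_meas h|exact: trig_int h|].
move=> e e0; exists N, psi; split => //.
rewrite (@eq_Rintegral _ _ _ torus U (fun=> 0)); last by move=> z _; rewrite subrr expr0n.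
by rewrite Rintegral_cst// mul0r.
Qed.

Let Qindic (A : set X2) : measurable A -> Q (\1_A).
Proof.
apply: trig_monotone_class; [exact: Qtrig|exact: Qlin|].
move=> F f M FM QF Ff; apply: (@Qlim F f (fun=> M)) => //.
by have := cst_int (M ^+ 2); apply: itg_ext => z.
Qed.

Let Qnn f : (forall z, 0 <= f z) -> L2 f -> Q f.
Proof.
move=> f0 lf.
have mf : measurable_fun (setT : set X2) (EFin \o f) by apply/measurable_EFinP; exact: l2_meas lf.
pose F := fun n => (nnsfun_approx measurableT mf n : X2 -> R).
have cF z : F ^~ z @ \oo --> f z.
  have h0 : forall z, [set: X2] z -> (0 <= (EFin \o f) z)%E by move=> x _; rewrite lee_fin.
  have h : (EFin \o F ^~ z) @ \oo --> (f z)%:E.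
    exact: (cvg_nnsfun_approx measurableT mf h0 (x := z) I).
  exact: (fine_cvg h).
apply: (@Qlim F f f).
- move=> n; pose g := nnsfun_approx measurableT mf n.
  have -> : F n = (fun z => \sum_(y <- finmap.enum_fset (fset_set (range g))) (y * \1_(g @^-1` [set y]) z)).
    by apply/funext => z; rewrite /F fimfunE fsbig_finite.
  move: (finmap.enum_fset (fset_set (range g))) => s; elim: s => [|y s IH].
    have -> : (fun z : X2 => \sum_(y <- [::]) (y * \1_(g @^-1` [set y]) z)) = (fun=> 0 : R).
      by apply/funext => z; rewrite big_nil.
    exact: Qtrig (trigpoly0 0).
  have -> : (fun z : X2 => \sum_(j <- y :: s) (j * \1_(g @^-1` [set j]) z)) =
     (fun z => y * \1_(g @^-1` [set y]) z + \sum_(j <- s) (j * \1_(g @^-1` [set j]) z) : R).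
    by apply/funext => z; rewrite big_cons.
  by apply: Qlin => //; apply: Qindic; exact: measurable_sfunP.
- by apply: (integrableS measurableT) => //; exact: l2_sqr.
- move=> n z _; rewrite ger0_norm; last exact: fun_ge0.
  rewrite -(cvg_lim _ (cF z))//; apply: nondecreasing_cvgn_le; last first.
    by apply/cvg_ex; exists (f z); exact: cF.
  by move=> i j ij; have /lefP := nd_nnsfun_approx measurableT mf ij; exact.
- by move=> z _; exact: cF.
Qed.

Lemma L2_density f : L2 f -> forall e, 0 < e ->
  exists N psi, trigpoly N psi /\ nsq (fun z => f z - psi z) < e.
Proof.
move=> lf; have mf := l2_meas lf.
have mn : measurable_fun (setT : set X2) (fun z => `|f z|) by exact: measurableT_comp.
have ln : L2 (fun z => `|f z|).
  by apply: l2P => //; apply: itg_ext (l2_sqr lf) => z; rewrite real_normK ?num_real.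
have l1 : L2 (fun z => 2^-1 * (`|f z| - f z)) by apply: l2Z; exact: l2B.
have l2 : L2 (fun z => 2^-1 * (`|f z| + f z)) by apply: l2Z; exact: l2D.
have q1 : Q (fun z => 2^-1 * (`|f z| - f z)).
  by apply: Qnn => // z; rewrite mulr_ge0// subr_ge0 ler_norm.
have q2 : Q (fun z => 2^-1 * (`|f z| + f z)).
  by apply: Qnn => // z; rewrite mulr_ge0// -lerBlDr sub0r lerNl lerNnormlW.
have : Q f.
  have -> : f = (fun z => -1 * (2^-1 * (`|f z| - f z)) + 2^-1 * (`|f z| + f z)).
    by apply/funext => z; field.
  exact: Qlin.
case=> _ _ fa e /fa[N [p [hp pe]]]; exists N, p; split => //.
by rewrite /nsq int_torus_opencell.
Qed.
End Density.

(** * Projection onto trigonometric polynomials, and weak derivatives *)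

#[global] Instance torus_ae_filter (R : realType) :
  Filter (nbhs (almost_everywhere (@torus R))).
Proof. exact: ae_filter_ringOfSetsType. Qed.

Section Projection.
Context {R : realType}.
Local Notation X2 := (measurableTypeR R * measurableTypeR R)%type.
Local Notation torus := (@torus R).
Implicit Types f g p q : torusfun R.

Lemma sip_0r f : sip f (fun=> 0) = 0.
Proof.
rewrite /sip /int_torus (@eq_Rintegral _ _ _ torus setT (fun=> 0)).
  by rewrite Rintegral_cst// mul0r.
by move=> z _; rewrite mulr0.
Qed.

Section SpanProj.
Context (I : eqType) (F : I -> torusfun R).
Hypothesis FL2 : forall i, L2 (F i).

Lemma span_L2 s f : in_span F s f -> L2 f.
Proof.
apply: span_ind => [|i _|a g h lg lh]; [exact: l2_0|exact: FL2|].
by apply: l2D => //; exact: l2Z.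
Qed.

(** Gram-Schmidt: the new generator is replaced by its component [psi]
    orthogonal to the previous ones.  If [psi] has norm zero, it is orthogonal to
    everything and the previous projection still works. *)
Lemma span_proj s f : L2 f ->
  exists2 p, in_span F s p & forall q, in_span F s q -> sip (fun z => f z - p z) q = 0.
Proof.
elim: s f => [|i s IH] f lf.
  by exists (fun=> 0) => // q ->; exact: sip_0r.
have [p' sp' hp'] := IH f lf; have [r sr hr] := IH (F i) (FL2 i).
have lp' := span_L2 sp'; have lr := span_L2 sr.
pose psi := fun z => F i z - r z.
have lpsi : L2 psi := l2B (FL2 i) lr.
have psiE : F i = (fun z => psi z + r z) by apply/funext => z; rewrite subrK.
have key p : L2 p -> (forall q, in_span F s q -> sip (fun z => f z - p z) q = 0) ->
    sip (fun z => f z - p z) psi = 0 ->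
    forall q, in_span F (i :: s) q -> sip (fun z => f z - p z) q = 0.
  move=> lp h1 h2 q [a [g [sg ->]]]; have lg := span_L2 sg.
  have lfp := l2B lf lp.
  rewrite sip_linr//; rewrite psiE sipDr// h2 !h1// ?addr0 ?mulr0 ?addr0//.
have [n0|n0] := eqVneq (nsq psi) 0.
  exists p'.
    exists 0, p'; split => //.
    by apply/funext => z; rewrite mul0r add0r.
  apply: key => //; apply/eqP; rewrite -sqrf_eq0 eq_le sqr_ge0 andbT.
  by rewrite (le_trans (sip_CS _ lpsi)) ?n0 ?mulr0//; exact: l2B.
pose c := sip f psi / nsq psi.
exists (fun z => c * psi z + p' z).
  exists c, (fun z => - c * r z + p' z); split; first by apply: spanD => //; exact: spanZ.
  by apply/funext => z; rewrite /psi; ring.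
have lcp : L2 (fun z => c * psi z + p' z) by apply: l2D => //; exact: l2Z.
have lcpsi : L2 (fun z => c * psi z) by exact: l2Z.
apply: key => // [q sq|].
  have lq := span_L2 sq.
  rewrite sipBl// sip_linl//.
  have := hp' _ sq; rewrite sipBl// => h1.
  have := hr _ sq; rewrite -/psi => h2.
  by rewrite h2 mulr0 add0r.
rewrite sipBl// sip_linl// sipff (sipC p') (hr _ sp') addr0 /c divfK//.
by rewrite subrr.
Qed.
End SpanProj.

Lemma trig2_L2 i : L2 (@trig2 R i).
Proof.
case: i => p q; apply: (@trigpoly_L2 _ (p.1 + p.2 + (q.1 + q.2))).
by apply: trigpoly_trig2; rewrite ?leq_addr ?leq_addl.
Qed.

Definition is_proj N f p :=
  trigpoly N p /\ forall q, trigpoly N q -> sip (fun z => f z - p z) q = 0.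

Lemma proj_exists N f : L2 f -> exists p, is_proj N f p.
Proof.
move=> lf; have [p sp hp] := span_proj trig2_L2 (allpairs pair (degs N) (degs N)) lf.
by exists p.
Qed.

Lemma is_wpartial_trig f g i N q : L2 f -> L2 g -> is_wpartial i f g ->
  trigpoly N q -> sip f (partial i q) = - sip g q.
Proof. by move=> lf lg [_ _ h] /trigpoly_test; exact: h. Qed.

(** Pairing [g - partial i p] with [q] is minus pairing [f - p] with
    [partial i q], which is a polynomial of the same degree and so gives zero.
    Hence projection commutes with weak differentiation. *)
Lemma proj_partial N i f g p : L2 f -> L2 g -> is_wpartial i f g ->
  is_proj N f p -> is_proj N g (partial i p).
Proof.
move=> lf lg w [tp hp]; split; first exact: trigpoly_partial.
have lp := trigpoly_L2 tp; have ldp := trigpoly_L2 (trigpoly_partial i tp).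
move=> q tq; have lq := trigpoly_L2 tq.
have tdq := trigpoly_partial i tq; have ldq := trigpoly_L2 tdq.
rewrite sipBl//; have := hp _ tdq; rewrite sipBl//.
rewrite (is_wpartial_trig lf lg w tq).
have := trigpoly_ibp i tp tq; rewrite -/(sip _ _) -/(sip _ _) => ->.
by move/eqP; rewrite opprK addrC subr_eq0 => /eqP ->; rewrite subrr.
Qed.

Lemma proj_pythagoras N f p q : L2 f -> is_proj N f p -> trigpoly N q ->
  nsq (fun z => f z - q z) = nsq (fun z => f z - p z) + nsq (fun z => p z - q z).
Proof.
move=> lf [tp hp] tq; have lp := trigpoly_L2 tp; have lq := trigpoly_L2 tq.
have tpq : trigpoly N (fun z => p z - q z).
  have -> : (fun z => p z - q z) = (fun z => p z + -1 * q z).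
    by apply/funext => z; ring.
  by apply: trigpolyD => //; exact: trigpolyZ.
have -> : (fun z => f z - q z) = (fun z => (f z - p z) + (p z - q z)).
  by apply/funext => z; ring.
rewrite nsq_D; [|exact: l2B|exact: l2B].
by rewrite hp// mulr0 addr0.
Qed.

Lemma proj_nsq_le N f p : L2 f -> is_proj N f p -> nsq p <= nsq f.
Proof.
move=> lf pf; have := proj_pythagoras lf pf (trigpoly0 N).
have -> : (fun z => f z - 0) = f by apply/funext => z; rewrite subr0.
have -> : (fun z => p z - 0) = p by apply/funext => z; rewrite subr0.
by move=> ->; rewrite lerDr nsq_ge0.
Qed.

(** A projection is the best approximation in its degree, so it does at least as
    well as the polynomials provided by density. *)
Lemma proj_cvg f (p : nat -> torusfun R) : L2 f -> (forall n, is_proj n f (p n)) ->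
  (fun n => nsq (fun z => f z - p n z)) @ \oo --> 0.
Proof.
move=> lf hp; apply/cvgrPdist_lt => e e0.
have [N [q [tq qe]]] := L2_density lf e0.
exists N => // n /= Nn; rewrite sub0r normrN ger0_norm ?nsq_ge0//.
apply: le_lt_trans qe; rewrite (proj_pythagoras lf (hp n) (trigpoly_le Nn tq)).
by rewrite lerDl nsq_ge0.
Qed.

Lemma sip_cvg f g (p : nat -> torusfun R) : L2 f -> L2 g -> (forall n, L2 (p n)) ->
  (fun n => nsq (fun z => g z - p n z)) @ \oo --> 0 ->
  (fun n => sip f (p n)) @ \oo --> sip f g.
Proof.
move=> lf lg lp c; apply/cvgrPdist_lt => e e0.
pose K := nsq f + 1.
have K0 : 0 < K by rewrite ltr_wpDl// nsq_ge0.
have h0 : 0 < e ^+ 2 / K by rewrite divr_gt0// exprn_gt0.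
have /cvgrPdist_lt/(_ _ h0)[N _ hN] := c.
exists N => // n /= /hN /=; rewrite sub0r normrN ger0_norm ?nsq_ge0// => h.
rewrite -sipBr//; have lgp : L2 (fun z => g z - p n z) := l2B lg (lp n).
rewrite -(@ltr_pXn2r _ 2)// ?nnegrE// ?(ltW e0)//.
rewrite real_normK ?num_real//; apply: le_lt_trans (sip_CS lf lgp) _.
rewrite ltr_pdivlMr// in h; apply: le_lt_trans h; rewrite mulrC.
by rewrite ler_wpM2l ?nsq_ge0// lerDl.
Qed.

(** The derivatives of the projections of [f] are the projections of its weak
    derivatives, so they converge as well. *)
Lemma H1_projections f : H1 f -> exists p : nat -> torusfun R,
  [/\ forall n, trigpoly n (p n),
      (fun n => nsq (fun z => f z - p n z)) @ \oo --> 0 &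
      forall i, (fun n => nsq (fun z => wd i f z - partial i (p n) z)) @ \oo --> 0].
Proof.
move=> [lf wf]; have [p hp] := choice (fun n => proj_exists n lf).
exists p; split.
- by move=> n; case: (hp n).
- exact: proj_cvg.
- move=> i; have [wi lwi] := wf i; apply: proj_cvg => // n.
  exact: proj_partial wi (hp n).
Qed.

(** The projections of [g] are test functions, and both sides pass to the
    limit. *)
Lemma H1_ibp i f g : H1 f -> H1 g -> sip (wd i f) g = - sip f (wd i g).
Proof.
move=> hf hg; have [p [tp cp dp]] := H1_projections hg.
have [lf wf] := hf; have [wi lwi] := wf i; have [lg wg] := hg; have [_ lwg] := wg i.
have lp n : L2 (p n) by exact: trigpoly_L2 (tp n).
have ldp n : L2 (partial i (p n)) by exact: trigpoly_L2 (trigpoly_partial i (tp n)).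
have c1 := sip_cvg lwi lg lp cp.
have c2 := sip_cvg lf lwg ldp (dp i).
rewrite -(cvg_lim _ c1)//; apply: cvg_lim => //.
have -> : (fun n => sip (wd i f) (p n)) = (fun n => - sip f (partial i (p n))).
  by apply/funext => n; rewrite (is_wpartial_trig lf lwi wi (tp n)) opprK.
exact: cvgN.
Qed.

(** Trigonometric polynomials are test functions and separate integrable
    functions. *)
Lemma wpartial_unique i f g h : is_wpartial i f g -> is_wpartial i f h ->
  {ae torus, forall z, g z = h z}.
Proof.
move=> [_ gi hg] [_ hi hh].
have : {ae torus, forall z, g z - h z = 0}.
  apply: trig_uniq; first exact: itgB.
  move=> N phi tphi; have t := trigpoly_test tphi.
  have [M bM] := trigpoly_bounded tphi.
  have mphi := trigpoly_measurable tphi.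
  have aux k : torus.-integrable setT (EFin \o k) ->
      torus.-integrable setT (EFin \o (fun z => k z * phi z)).
    move=> ki; apply: (@itg_le _ _ _ torus setT _ (fun z => M * `|k z|)) => //.
    - by apply: measurable_funM => //; exact: itg_meas ki.
    - by move=> z _; rewrite normrM mulrC ler_wpM2r.
    - by apply: itgZ => //; exact: integrable_norm ki.
  have e : (fun z => (g z - h z) * phi z) = (fun z => g z * phi z - h z * phi z).
    by apply/funext => z; rewrite mulrBl.
  rewrite e /int_torus RintegralB//; try exact: aux.
  by have := hg _ t; rewrite (hh _ t) => /oppr_inj; rewrite /int_torus => ->; rewrite subrr.
by move=> gh; apply: filterS gh => z /eqP; rewrite subr_eq0 => /eqP.
Qed.

Lemma wd_is_wpartial i f g : is_wpartial i f g -> is_wpartial i f (wd i f).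
Proof. by move=> h; exact: (xgetPex (fun=> 0) (ex_intro _ g h)). Qed.

Lemma wd_unique i f g : is_wpartial i f g -> {ae torus, forall z, wd i f z = g z}.
Proof. move=> h; apply: wpartial_unique (h); exact: wd_is_wpartial h. Qed.
End Projection.

(** * Continuous functions on the torus, and linearity of weak derivatives *)

Section ContinuousTorus.
Context {R : realType}.
Local Notation X2 := (measurableTypeR R * measurableTypeR R)%type.
Local Notation torus := (@torus R).
Local Notation leb := (@lebesgue_measure R).
Implicit Types f g : torusfun R.

(** Discretizing the first variable turns [f] into a function that is, on each
    of countably many strips, a continuous function of the second variable
    alone, and [f] is the limit of these functions as the mesh goes to zero. *)
Lemma continuous_plane_measurable f : continuous f ->
  measurable_fun (setT : set X2) f.
Proof.
move=> cf.
pose r n (x : R) : R := (Num.floor (n.+1%:R * x))%:~R / n.+1%:R.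
pose F n (z : X2) : R := f (r n z.1, z.2).
have rP n x : r n x <= x < r n x + n.+1%:R^-1.
  have n0 : 0 < (n.+1%:R : R) by rewrite ltr0n.
  have /andP[h1 h2] := Num.Theory.floor_itv (n.+1%:R * x).
  rewrite /r; apply/andP; split; first by rewrite ler_pdivrMr// [x * _]mulrC.
  by rewrite -[X in _ < _ + X]mul1r -mulrDl ltr_pdivlMr// [x * _]mulrC; move: h2; rewrite intrD.
apply: (@measurable_fun_cvg _ X2 R setT F f) => [n|z _].
  move=> _ B mB; rewrite setTI.
  have -> : F n @^-1` B = \bigcup_(k : int) ([set z : X2 | Num.floor (n.+1%:R * z.1) = k] `&`
      [set z : X2 | f ((k%:~R / n.+1%:R), z.2) \in B]).
    apply/seteqP; split => z /=.
      move=> Bz; exists (Num.floor (n.+1%:R * z.1)) => //; split => //=.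
      exact: mem_set.
    by move=> [k _ [/= <-]] /set_mem.
  apply: countable_bigcupT_measurable; first exact: countableP.
  move=> k; apply: measurableI.
    have -> : [set z : X2 | Num.floor (n.+1%:R * z.1) = k] =
       (fun z : X2 => n.+1%:R * z.1) @^-1` `[k%:~R, (k + 1)%:~R[.
      apply/seteqP; split => z /=; rewrite in_itv/=.
        by move=> <-; exact: Num.Theory.floor_itv.
      by rewrite -Num.Theory.floor_eq => /eqP.
    rewrite -[X in measurable X]setTI.
    have : measurable_fun setT (fun z : X2 => n.+1%:R * z.1 : R).
      by apply: measurable_funM => //; exact: measurable_fst.
    by apply => //; exact: measurable_itv.
  have -> : [set z : X2 | f ((k%:~R / n.+1%:R), z.2) \in B] =
      (fun z : X2 => f ((k%:~R / n.+1%:R), z.2)) @^-1` B.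
    by apply/seteqP; split => z /=; [move=> /set_mem|move=> /mem_set].
  rewrite -[X in measurable X]setTI.
  have : measurable_fun (setT : set X2) (fun z : X2 => f ((k%:~R / n.+1%:R), z.2)).
    have m1 : measurable_fun setT
        ((fun y => f (k%:~R / n.+1%:R, y)) : measurableTypeR R -> R).
      by apply: continuous_measurable_fun; exact: continuous_slice1.
    exact: (measurableT_comp m1 measurable_snd).
  by apply.
have rc : r ^~ z.1 @ \oo --> z.1.
  apply/cvgrPdist_lt => e e0; near=> n.
  have /andP[h1 h2] := rP n z.1.
  rewrite ger0_norm ?subr_ge0// ltrBlDl (lt_trans h2)// ltrD2l.
  by near: n; exact: near_infty_natSinv_lt (PosNum e0).
rewrite [X in _ --> X](_ : _ = f (z.1, z.2)); last by case: z {rc}.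
apply: (@cvg_comp _ _ _ (fun n => (r n z.1, z.2)) f _ (nbhs (z.1, z.2))); last exact: cf.
by apply: (@cvg_pair _ _ _ _ (nbhs (z.1 : R)) (nbhs (z.2 : R))) => //; exact: cvg_cst.
Unshelve. all: by end_near. Qed.

Lemma continuous_cell_bounded f : continuous f -> exists M, forall z, cell z -> `|f z| <= M.
Proof.
move=> cf.
have cc : compact (cell : set (R * R)).
  by apply: compact_setX; exact: segment_compact.
have cw : {within (cell : set (R * R)), continuous f} by exact: continuous_subspaceT.
have /compact_bounded[M [_ hM]] := continuous_compact cw cc.
exists (M + 1) => z zc; apply: hM; first by rewrite ltrDl.
by exists z.
Qed.

Lemma continuous_torus_integrable f : continuous f -> torus.-integrable setT (EFin \o f).
Proof.
move=> cf; have [M hM] := continuous_cell_bounded cf.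
by apply: torus_bnd_integrable hM; exact: continuous_plane_measurable.
Qed.

Lemma integrableM_continuous f g : torus.-integrable setT (EFin \o f) -> continuous g ->
  torus.-integrable setT (EFin \o (fun z => f z * g z)).
Proof.
move=> fi cg; have [M hM] := continuous_cell_bounded cg.
have mg := continuous_plane_measurable cg.
have mf : measurable_fun setT f by exact: itg_meas fi.
have mfg : measurable_fun setT (fun z => f z * g z) by exact: measurable_funM.
have /integrableP[_ fMi] := itgZ M measurableT fi.
apply/integrableP; split; first exact/measurable_EFinP.
apply: le_lt_trans fMi; apply: ae_ge0_le_integral => //.
- by apply: measurableT_comp => //; exact/measurable_EFinP.
- by apply: measurableT_comp => //; apply/measurable_EFinP; exact: measurable_funM.
apply: filterS (@ae_opencell R) => z Uz _ /=; rewrite lee_fin.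
have zc : cell z by case: Uz => h1 h2; split => /=; apply: subset_itv_oo_cc.
have hz := hM z zc.
by rewrite !normrM mulrC ler_wpM2r// (le_trans hz)// ler_norm.
Qed.

Lemma is_wpartial_lin i (a : R) f f' g g' : is_wpartial i f f' -> is_wpartial i g g' ->
  is_wpartial i (fun z => a * f z + g z) (fun z => a * f' z + g' z).
Proof.
move=> [fi fi' hf] [gi gi' hg]; split; try by apply: itgD => //; exact: itgZ.
move=> phi tphi; have [[sphi _]] := (tphi, tphi) => per.
have c0 : continuous phi by have [] := sphi [::].
have ci : continuous (partial i phi) by have [] := sphi [:: i].
have aux (k l : torusfun R) (c : torusfun R) : torus.-integrable setT (EFin \o k) ->
   torus.-integrable setT (EFin \o l) -> continuous c ->
   int_torus (fun x => (a * k x + l x) * c x) =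
   a * int_torus (fun x => k x * c x) + int_torus (fun x => l x * c x).
  move=> ki li cc; have i1 := integrableM_continuous ki cc.
  have i2 := integrableM_continuous li cc.
  rewrite /int_torus -RintegralZl// -RintegralD//; last exact: itgZ.
  by apply: eq_Rintegral => z _; ring.
by rewrite !aux// hf// hg//; ring.
Qed.

Lemma H1_lin (a : R) f g : H1 f -> H1 g -> H1 (fun z => a * f z + g z).
Proof.
move=> [lf wf] [lg wg]; split; first by apply: l2D => //; exact: l2Z.
move=> i; have [pf lpf] := wf i; have [pg lpg] := wg i.
have p := is_wpartial_lin a pf pg; have w := wd_is_wpartial p; split => //.
have l : L2 (fun z => a * wd i f z + wd i g z) by apply: l2D => //; exact: l2Z.
have [_ wi _] := w; have mw : measurable_fun setT (wd i (fun z => a * f z + g z)).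
  exact: itg_meas wi.
apply: l2P => //.
have /integrableP[_ li] := l2_sqr l; apply/integrableP; split.
  by apply/measurable_EFinP; exact: measurable_funX.
apply: le_lt_trans li; rewrite le_eqVlt; apply/orP; left; apply/eqP.
apply: ae_integral; apply: filterS (wd_unique p) => z e _.
by rewrite /= e.
Qed.

Lemma wd_lin i (a : R) f g : H1 f -> H1 g ->
  {ae torus, forall z, wd i (fun z => a * f z + g z) z = a * wd i f z + wd i g z}.
Proof.
move=> [_ wf] [_ wg]; have [pf _] := wf i; have [pg _] := wg i.
exact: wd_unique (is_wpartial_lin a pf pg).
Qed.
End ContinuousTorus.

(** * Functions in H2 are bounded *)

Section SupBound.
Context {R : realType}.
Local Notation X2 := (measurableTypeR R * measurableTypeR R)%type.
Local Notation torus := (@torus R).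
Local Notation leb := (@lebesgue_measure R).
Local Notation L := (2 * pi : R).
Implicit Types f : torusfun R.

Let mcirc : measurable (circ : set (measurableTypeR R)).
Proof. exact: measurable_itv. Qed.

Let circ_int (g : R -> R) : continuous g -> leb.-integrable circ (EFin \o g).
Proof.
move=> cg; apply: continuous_compact_integrable; first exact: segment_compact.
exact: continuous_subspaceT.
Qed.

Let cst_int (c : R) : leb.-integrable circ (EFin \o (fun=> c)).
Proof. by apply: circ_int; exact: cst_continuous. Qed.

Let norm_cont (g : R -> R) : continuous g -> continuous (fun x => `|g x|).
Proof. by move=> cg x; apply: continuous_comp; [exact: cg|exact: norm_continuous]. Qed.

Lemma fubini_cont f : continuous f ->
  leb.-integrable circ (EFin \o (fun x => \int[leb]_(y in circ) f (x, y))) /\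
  int_torus f = \int[leb]_(x in circ) \int[leb]_(y in circ) f (x, y).
Proof.
move=> cf; have fi := continuous_torus_integrable cf.
have E x : circ x -> (\int[leb]_(y in circ) (f (x, y))%:E =
   (\int[leb]_(y in circ) f (x, y))%:E)%E.
  move=> xc; rewrite /Rintegral fineK//; apply: integrable_fin_num => //.
  by apply: circ_int; exact: continuous_slice1.
split; last first.
  rewrite /int_torus /Rintegral (torus_fubini1 fi); congr fine.
  by apply: eq_integral => x /set_mem xc; exact: E.
have fci : (leb \x leb)%E.-integrable setT ((EFin \o f) \_ cell).
  apply/(integrable_mkcond _ measurable_cell).
  exact: (@integrable_mrestr _ _ _ _ _ measurable_cell _ fi).
have gi := @integrable_fubini_F _ _ (measurableTypeR R) (measurableTypeR R) _ (@lebesgue_measure R) (@lebesgue_measure R) ((EFin \o f) \_ cell) fci.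
apply: (eq_integrable mcirc); last exact: (integrableS measurableT mcirc (@subsetT _ _) gi).
move=> x /set_mem xc; rewrite /fubini_F /= -(E x xc) [RHS]integral_mkcond.
apply: eq_integral => y _; rewrite !patchE; case: (boolP (y \in circ)) => yc.
  by rewrite mem_set//; split => //; exact: set_mem.
by rewrite memNset// => -[_ h]; move/negP: yc; apply; exact: mem_set.
Qed.

(** One-dimensional Sobolev inequality: [g x] and [g t] differ by at most the
    integral of the modulus of the derivative; integrate this over [t]. *)
Lemma sup_circ (g dg : R -> R) x : (forall t : R, is_derive t (1 : R) g (dg t)) ->
  continuous dg -> circ x ->
  L * `|g x| <= \int[leb]_(t in circ) `|g t| + L * \int[leb]_(t in circ) `|dg t|.
Proof.
move=> ddg; have -> : dg = 'D_1 g by apply/funext => t; rewrite derive_val.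
have {ddg dg} dg : forall t : R, derivable g t 1 by move=> t; exact: ex_derive.
move=> cdg xc; have cg : continuous g.
  by move=> t; apply: differentiable_continuous; exact/derivable1_diffP.
set D := \int[leb]_(t in circ) `|'D_1 g t|.
have inc a b : 0 <= a -> a <= b -> b <= L -> `|g b - g a| <= D.
  move=> a0 ab bL; have h := ftc ab dg cdg.
  have sub : `[a, b] `<=` (circ : set R).
    move=> t /=; rewrite /circ /= !in_itv/= => /andP[at_ tb].
    by rewrite (le_trans a0 at_) (le_trans tb bL).
  have i1 : leb.-integrable `[a, b] (EFin \o (fun t => 'D_1 g t)).
    by apply: (integrableS mcirc) => //; exact: circ_int.
  have -> : g b - g a = \int[leb]_(t in `[a, b]) 'D_1 g t by rewrite /Rintegral h.
  apply: (le_trans (le_normr_Rintegral _ i1)) => //.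
  have i2 : leb.-integrable circ (EFin \o (fun t => `|'D_1 g t|)).
    by apply: circ_int; exact: norm_cont.
  rewrite /D /Rintegral fine_le//.
  - by apply: integrable_fin_num => //; apply: integrableS i2.
  - exact: integrable_fin_num.
  - apply: ge0_subset_integral => //; first by case/integrableP: i2.
have key t : circ t -> `|g x| <= `|g t| + D.
  move=> tc; have : `|g x - g t| <= D.
    move: xc tc; rewrite /circ /= !in_itv/= => /andP[x0 xL] /andP[t0 tL].
    have [xt|/ltW tx] := leP x t; first by rewrite distrC; exact: inc.
    exact: inc.
  by have := ler_distD 0 (g x) 0; have := lerB_dist (g x) (g t); lra.
have i3 : leb.-integrable circ (EFin \o (fun t => `|g t|)).
  by apply: circ_int; exact: norm_cont.
have c (r : R) : \int[leb]_(t in circ) r = r * L.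
  by rewrite Rintegral_cst//; congr (_ * _); exact: (congr1 fine (@leb_circ R)).
have := @le_Rintegral _ _ _ leb circ (fun=> `|g x|) (fun t => `|g t| + D) mcirc
  (cst_int _) (itgD mcirc i3 (cst_int _)) key.
by rewrite RintegralD// !c mulrC [D * _]mulrC.
Qed.

Let I1 f : R := int_torus (fun z => `|f z|).

Let abs_cont f : continuous f -> continuous (fun z => `|f z|).
Proof. by move=> cf z; apply: continuous_comp; [exact: cf|exact: norm_continuous]. Qed.

Let L0 : 0 <= L. Proof. exact/ltW/pi2_gt0. Qed.

Let slice_dx N f y : trigpoly N f ->
  forall t : R, is_derive t (1 : R) (fun x => f (x, y)) (partial ord0 f (t, y)).
Proof.
move=> hf t; have := @trigpoly_derivable _ _ _ ord0 (t, y) hf.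
by move/derivable_slice0 => /= h; split => //; rewrite partial0E.
Qed.

Let slice_dy N f x : trigpoly N f ->
  forall t : R, is_derive t (1 : R) (fun y => f (x, y)) (partial ord_max f (x, t)).
Proof.
move=> hf t; have := @trigpoly_derivable _ _ _ ord_max (x, t) hf.
by move/derivable_slice1 => /= h; split => //; rewrite partial1E.
Qed.

Let line_bound N f y : trigpoly N f -> circ y ->
  L * \int[leb]_(x in circ) `|f (x, y)| <= I1 f + L * I1 (partial ord_max f).
Proof.
move=> hf yc; have cf := trigpoly_continuous hf.
have cdf := trigpoly_continuous (trigpoly_partial ord_max hf).
have [i1 e1] := fubini_cont (abs_cont cf).
have [i2 e2] := fubini_cont (abs_cont cdf).
rewrite /I1 e1 e2 -!RintegralZl//; last first.
  by apply: circ_int; apply: norm_cont; exact: continuous_slice0.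
rewrite -RintegralD//; last exact: itgZ.
apply: le_Rintegral => //.
- by apply: itgZ => //; apply: circ_int; apply: norm_cont; exact: continuous_slice0.
- by apply: itgD => //; exact: itgZ.
move=> x xc.
exact: (@sup_circ (fun y => f (x, y)) _ y (slice_dy x hf) (continuous_slice1 cdf) yc).
Qed.

(** The one-dimensional inequality is applied in the first variable, then in the
    second to both line integrals that appear. *)
Lemma sup_trigpoly N f z : trigpoly N f -> cell z ->
  L ^+ 2 * `|f z| <= I1 f + L * I1 (partial ord_max f) +
    L * (I1 (partial ord0 f) + L * I1 (partial ord_max (partial ord0 f))).
Proof.
move=> hf [xc yc]; have hd := trigpoly_partial ord0 hf.
have b1 := line_bound hf yc; have b2 := line_bound hd yc.
have cd : continuous (fun t : R => partial ord0 f (t, z.2)).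
  by apply: continuous_slice0; exact: trigpoly_continuous hd.
have := @sup_circ (fun x => f (x, z.2)) _ z.1 (slice_dx z.2 hf) cd xc.
have -> : (z.1, z.2) = z by case: z {xc yc b1 b2 cd}.
move=> h; rewrite expr2 -mulrA.
apply: (le_trans (ler_wpM2l L0 h)).
rewrite mulrDr [X in _ + X](_ : _ = L * (L * \int[leb]_(t in circ) `|partial ord0 f (t, z.2)|))//.
exact: (lerD b1 (ler_wpM2l L0 b2)).
Qed.

Let I1_nsq N f : trigpoly N f -> I1 f <= (L ^+ 2 + nsq f) / 2.
Proof.
move=> hf; have lf := trigpoly_L2 hf; have cf := trigpoly_continuous hf.
have ci : torus.-integrable setT (EFin \o (fun=> 1 : R)).
  by apply: continuous_torus_integrable; exact: cst_continuous.
have -> : (L ^+ 2 + nsq f) / 2 = int_torus (fun z => 2^-1 * (1 + f z ^+ 2)).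
  rewrite /int_torus RintegralZl//; last by apply: itgD => //; exact: l2_sqr.
  rewrite RintegralD//; last exact: l2_sqr.
  by rewrite Rintegral_cst// torusT /= mul1r mulrC.
apply: le_Rintegral => //.
- by apply: continuous_torus_integrable; exact: abs_cont.
- by apply: itgZ => //; apply: itgD => //; exact: l2_sqr.
- move=> z _; have := sqr_ge0 (`|f z| - 1); rewrite sqrrB1 real_normK ?num_real//.
  by move=> h; lra.
Qed.

(** The projections of [f] are bounded on the cell in terms of the L2 norms of
    their derivatives, which are projections of derivatives of [f] and so have
    no larger norm.  The resulting bound [M] passes to the L2 limit because the
    excess of the modulus of [f] over [M] is at most the modulus of [f - p n]. *)
Lemma H2_bounded f : H2 f -> exists M, {ae torus, forall z, `|f z| <= M}.
Proof.
move=> [[lf wf] h2]; have [p hp] := choice (fun n => proj_exists n lf).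
have [w0 l0] := wf ord0; have [w1 l1] := wf ord_max.
have [_ h20] := h2 ord0; have [w01 l01] := h20 ord_max.
pose C := ((L ^+ 2 + nsq f) / 2 + L * ((L ^+ 2 + nsq (wd ord_max f)) / 2) +
  L * ((L ^+ 2 + nsq (wd ord0 f)) / 2 +
       L * ((L ^+ 2 + nsq (wd ord_max (wd ord0 f))) / 2))).
have pC n z : cell z -> L ^+ 2 * `|p n z| <= C.
  move=> zc; have [tp _] := hp n; apply: (le_trans (sup_trigpoly tp zc)).
  have q0 := proj_partial lf l0 w0 (hp n); have q1 := proj_partial lf l1 w1 (hp n).
  have q01 := proj_partial l0 l01 w01 q0.
  have B q g : L2 g -> is_proj n g q -> I1 q <= (L ^+ 2 + nsq g) / 2.
    move=> lg hq; have [tq _] := hq; apply: (le_trans (I1_nsq tq)).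
    by rewrite ler_pM2r// lerD2l; exact: proj_nsq_le hq.
  rewrite /C !lerD ?ler_wpM2l ?lerD ?ler_wpM2l//; exact: B.
pose M := C / L ^+ 2.
have L20 : 0 < L ^+ 2 by rewrite exprn_gt0// pi2_gt0.
have pM n z : cell z -> `|p n z| <= M.
  by move=> zc; rewrite ler_pdivlMr// mulrC; exact: pC.
exists M.
have c := proj_cvg lf hp.
have mf : measurable_fun (setT : set X2) f by exact: l2_meas lf.
pose g : torusfun R := fun z => Num.max (`|f z| - M) 0.
have mg : measurable_fun (setT : set X2) g.
  apply: measurable_maxr => //.
  by apply: measurable_funB => //; exact: measurableT_comp.
have le n : (\int[torus]_z `|(g z ^+ 2)%:E| <= (nsq (fun z => f z - p n z))%:E)%E.
  have lp := trigpoly_L2 (hp n).1; have lfp := l2B lf lp.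
  rewrite /nsq /int_torus /Rintegral fineK; last first.
    by apply: integrable_fin_num => //; exact: l2_sqr.
  apply: ae_ge0_le_integral => //.
  - apply: measurableT_comp => //; apply/measurable_EFinP; exact: measurable_funX.
  - by move=> z _; rewrite lee_fin sqr_ge0.
  - by apply/measurable_EFinP; apply: measurable_funX; exact: l2_meas lfp.
  - apply: filterS (@ae_opencell R) => z Uz _.
    have zc : cell z by case: Uz => u1 u2; split => /=; apply: subset_itv_oo_cc.
    rewrite lee_fin ger0_norm ?sqr_ge0// /g -[leRHS]real_normK ?num_real//.
    rewrite lerXn2r ?nnegrE ?le_max ?lexx ?orbT// ge_max normr_ge0 andbT.
    by have := pM n z zc; have := lerB_dist (f z) (p n z); lra.
have g0 : (\int[torus]_z `|(g z ^+ 2)%:E| = 0)%E.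
  apply/eqP; rewrite eq_le integral_ge0// andbT.
  apply/lee_addgt0Pr => e e0; rewrite add0e.
  have /cvgrPdist_lt/(_ _ e0)[n _ /(_ n (leqnn n))/=] := c.
  rewrite sub0r normrN ger0_norm ?nsq_ge0// => hn.
  by apply: (le_trans (le n)); rewrite lee_fin ltW.
have mg2 : measurable_fun (setT : set X2) (fun z => (g z ^+ 2)%:E).
  by apply/measurable_EFinP; exact: measurable_funX.
have := (ae_eq_integral_abs torus measurableT mg2).1 g0.
move=> h; apply: filterS h => z /(_ I)[] /eqP; rewrite sqrf_eq0 => /eqP gz.
have : `|f z| - M <= g z by rewrite /g le_max lexx.
by rewrite gz subr_le0.
Qed.
End SupBound.

(** * Vector fields and the transport term *)

Section Fields.
Context {R : realType}.
Local Notation X2 := (measurableTypeR R * measurableTypeR R)%type.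
Local Notation torus := (@torus R).
Implicit Types (f g : torusfun R) (u v w e : vfield R).

Lemma L2_L1 f : L2 f -> torus.-integrable setT (EFin \o f).
Proof.
by move=> lf; apply/Lfun1_integrable; apply: Lfun_subset12 lf; rewrite torusT.
Qed.

Lemma ae_sip f g h : {ae torus, forall z, f z = g z} -> sip f h = sip g h.
Proof.
by move=> fg; apply: ae_Rintegral; apply: filterS fg => z fgz _; rewrite fgz.
Qed.

Lemma ipE u v : L2field u -> L2field v -> ip u v = \sum_i sip (u i) (v i).
Proof.
move=> lu lv; rewrite /ip /dot /int_torus Rint_sum// => i; exact: (l2M (lu i) (lv i)).
Qed.

Lemma ipC u v : ip u v = ip v u.
Proof.
by apply: eq_Rintegral => z _; apply: eq_bigr => i _; rewrite mulrC.
Qed.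

Lemma L2field_D u v : L2field u -> L2field v -> L2field (u + v).
Proof. by move=> lu lv i; exact: (l2D (lu i) (lv i)). Qed.

Lemma L2field_B u v : L2field u -> L2field v -> L2field (u - v).
Proof. by move=> lu lv i; exact: (l2B (lu i) (lv i)). Qed.

Lemma ipBl u v w : L2field u -> L2field v -> L2field w -> ip (u - v) w = ip u w - ip v w.
Proof.
move=> lu lv lw; rewrite !ipE//; last exact: L2field_B.
by rewrite -sumrB; apply: eq_bigr => i _; rewrite -sipBl.
Qed.

Lemma ipBr u v w : L2field u -> L2field v -> L2field w -> ip w (u - v) = ip w u - ip w v.
Proof. by move=> *; rewrite !(ipC w) ipBl. Qed.

Lemma ipDr u v w : L2field u -> L2field v -> L2field w -> ip w (u + v) = ip w u + ip w v.
Proof.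
move=> lu lv lw; rewrite !ipE//; last exact: L2field_D.
by rewrite -big_split /=; apply: eq_bigr => i _; rewrite -sipDr.
Qed.

Lemma hnorm_sqr u : L2field u -> hnorm u ^+ 2 = ip u u.
Proof.
move=> lu; rewrite sqr_sqrtr; last by apply: sumr_ge0 => i _; exact: sqr_ge0.
by rewrite ipE//; apply: eq_bigr => i _; rewrite L2norm_sqr// sipff.
Qed.

Lemma hnorm_ge0 u : 0 <= hnorm u. Proof. exact: sqrtr_ge0. Qed.

Lemma vnorm_ge0 u : 0 <= vnorm u. Proof. exact: sqrtr_ge0. Qed.

Lemma gradnorm_sqr f : (forall i, L2 (wd i f)) ->
  gradnorm f ^+ 2 = \sum_i nsq (wd i f).
Proof.
move=> lf; rewrite sqr_sqrtr; last by apply: sumr_ge0 => i _; exact: sqr_ge0.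
by apply: eq_bigr => i _; rewrite L2norm_sqr.
Qed.

Lemma vnorm_sqr u : (forall i, H1 (u i)) ->
  vnorm u ^+ 2 = \sum_i \sum_j nsq (wd j (u i)).
Proof.
move=> hu; rewrite sqr_sqrtr; last by apply: sumr_ge0 => i _; exact: sqr_ge0.
by apply: eq_bigr => i _; apply: gradnorm_sqr => j; case: (hu i) => _ /(_ j)[].
Qed.

Lemma ip_CS u v : L2field u -> L2field v -> `|ip u v| <= hnorm u * hnorm v.
Proof.
move=> lu lv; rewrite -(@ler_pXn2r _ 2)// ?nnegrE ?mulr_ge0 ?hnorm_ge0//.
rewrite real_normK ?num_real// exprMn !hnorm_sqr//.
have q s t : 0 <= s ^+ 2 * ip u u + (t ^+ 2 * ip v v + 2 * s * t * ip u v).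
  have h : 0 <= \sum_i nsq (fun z => s * u i z + t * v i z).
    by apply: sumr_ge0 => i _; exact: nsq_ge0.
  rewrite (_ : _ + _ = \sum_i nsq (fun z => s * u i z + t * v i z))//.
  rewrite !ipE// !mulr_sumr -!big_split; apply: eq_bigr => i _ /=.
  rewrite -!sipff; have l1 := lu i; have l2 := lv i.
  rewrite sipDl ?sipDr ?sipZl//; try exact: l2Z; try by apply: l2D; exact: l2Z.
  rewrite (sipC (u i) (fun z => s * _)) (sipC (u i) (fun z => t * _)).
  rewrite (sipC (v i) (fun z => s * _)) (sipC (v i) (fun z => t * _)).
  by rewrite !sipZl// (sipC (v i) (u i)); ring.
by apply: (discriminant _ _ q); rewrite -hnorm_sqr// sqr_ge0.
Qed.

Lemma hnorm_triangle u v : L2field u -> L2field v -> hnorm (u + v) <= hnorm u + hnorm v.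
Proof.
move=> lu lv; have luv := L2field_D lu lv.
rewrite -(@ler_pXn2r _ 2)// ?nnegrE ?addr_ge0 ?hnorm_ge0//.
rewrite hnorm_sqr// ipDr// !(ipC _ u) !(ipC _ v) !ipDr// -!hnorm_sqr//.
by have := ip_CS lu lv; rewrite (ipC v u) ler_norml => /andP[_]; nra.
Qed.

Lemma H_lin (a : R) u v : H u -> H v -> H (fun i z => a * u i z + v i z).
Proof.
move=> [lu du mu] [lv dv mv]; split.
- by move=> i; apply: l2D; [exact: l2Z (lu i)|exact: lv].
- move=> phi tphi; have [sphi _] := tphi.
  have ci i : continuous (partial i phi) by have [] := sphi [:: i].
  have iu i := integrableM_continuous (L2_L1 (lu i)) (ci i).
  have iv i := integrableM_continuous (L2_L1 (lv i)) (ci i).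
  have eu : \sum_i \int[torus]_z (u i z * partial i phi z) = 0.
    by rewrite -Rint_sum//; exact: du.
  have ev : \sum_i \int[torus]_z (v i z * partial i phi z) = 0.
    by rewrite -Rint_sum//; exact: dv.
  rewrite /int_torus.
  rewrite (@eq_Rintegral _ _ _ torus setT
     (fun z => \sum_i (a * (u i z * partial i phi z) + v i z * partial i phi z))).
    rewrite Rint_sum//; last by move=> i; apply: itgD => //; exact: itgZ.
    rewrite (eq_bigr (fun i => a * \int[torus]_x (u i x * partial i phi x) +
        \int[torus]_x (v i x * partial i phi x))); last first.
      by move=> i _; rewrite RintegralD// ?RintegralZl//; exact: itgZ.
    by rewrite big_split/= -mulr_sumr eu ev mulr0 addr0.
  by move=> z _; apply: eq_bigr => i _; ring.
- move=> i; have iu := L2_L1 (lu i); have iv := L2_L1 (lv i).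
  rewrite /int_torus RintegralD//; last exact: itgZ.
  by rewrite RintegralZl// -/(int_torus _) -/(int_torus _) mu mv mulr0 addr0.
Qed.

Lemma V_lin (a : R) u v : V u -> V v -> V (fun i z => a * u i z + v i z).
Proof.
move=> [hu h1u] [hv h1v]; split; first exact: H_lin.
by move=> i; exact: H1_lin.
Qed.

Let subE u v : u - v = (fun i z => -1 * v i z + u i z).
Proof. by apply/funext => i; apply/funext => z; rewrite mulN1r addrC. Qed.

Lemma H_B u v : H u -> H v -> H (u - v).
Proof. by move=> hu hv; rewrite subE; exact: H_lin. Qed.

Lemma V_B u v : V u -> V v -> V (u - v).
Proof. by move=> hu hv; rewrite subE; exact: V_lin. Qed.

Lemma H_L2 u : H u -> L2field u. Proof. by case. Qed.

Lemma H0 : @H R (fun _ _ => 0).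
Proof.
split.
- by move=> i; exact: l2_0.
- move=> phi _; rewrite /int_torus (@eq_Rintegral _ _ _ torus setT (fun=> 0)).
    by rewrite Rintegral_cst// mul0r.
  by move=> z _; rewrite big1// => i _; rewrite mul0r.
- by move=> i; rewrite /int_torus Rintegral_cst// mul0r.
Qed.

(** For a smooth [g] this is the divergence-free condition tested with [g ^ 2].
    In general [g] is replaced by projections, different ones in the two
    factors: the products [p m p n] are test functions, and the limits in [n]
    and then in [m] each involve one L2-convergent factor against a fixed L2
    function, [v] being bounded. *)
Lemma transport_zero v g : H v -> (forall j, exists M, {ae torus, forall z, `|v j z| <= M}) ->
  H1 g -> \sum_j sip (fun z => v j z * wd j g z) g = 0.
Proof.
move=> [lv dv _] bv hg; have [p [tp cp dp]] := H1_projections hg.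
have [lg wg] := hg; have lwg j : L2 (wd j g) by case: (wg j).
have lp n := trigpoly_L2 (tp n).
have ldp j n := trigpoly_L2 (trigpoly_partial j (tp n)).
have vM j f : L2 f -> L2 (fun z => v j z * f z).
  by have [M hM] := bv j; apply: l2_bndM hM; exact: l2_meas (lv j).
have e0 m n : \sum_j (sip (fun z => v j z * p m z) (partial j (p n)) +
      sip (fun z => v j z * partial j (p m) z) (p n)) = 0.
  have tpp := trigpolyM (tp m) (tp n).
  have := dv _ (trigpoly_test tpp); rewrite /int_torus Rint_sum//; last first.
    move=> j; exact: (l2M (lv j) (trigpoly_L2 (trigpoly_partial j tpp))).
  move=> h; rewrite -[RHS]h; apply: eq_bigr => j _.
  have i1 := l2M (vM j _ (lp m)) (ldp j n); have i2 := l2M (vM j _ (ldp j m)) (lp n).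
  rewrite /sip /int_torus -RintegralD//.
  apply: eq_Rintegral => z _.
  have df : derivable (p m) z (basis_vec j) := trigpoly_derivable (tp m).
  have dg : derivable (p n) z (basis_vec j) := trigpoly_derivable (tp n).
  have -> : partial j (fun z => p m z * p n z) z = p m z * partial j (p n) z +
     p n z * partial j (p m) z by rewrite /partial (deriveM df dg).
  ring.
have cvg_sum2 (F : 'I_2 -> nat -> R) (l : 'I_2 -> R) :
    (forall j, F j @ \oo --> l j) -> (fun n => \sum_j F j n) @ \oo --> \sum_j l j.
  move=> h; under eq_fun do rewrite 2!big_ord_recl big_ord0.
  rewrite 2!big_ord_recl big_ord0; apply: cvgD; first exact: h.
  by apply: cvgD; [exact: h|exact: cvg_cst].
have e1 m : \sum_j (sip (fun z => v j z * p m z) (wd j g) +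
      sip (fun z => v j z * partial j (p m) z) g) = 0.
  have c : (fun n => \sum_j (sip (fun z => v j z * p m z) (partial j (p n)) +
      sip (fun z => v j z * partial j (p m) z) (p n))) @ \oo -->
    \sum_j (sip (fun z => v j z * p m z) (wd j g) +
      sip (fun z => v j z * partial j (p m) z) g).
    apply: cvg_sum2 => j; apply: cvgD; last by apply: sip_cvg => //; exact: vM.
    by apply: sip_cvg => //; exact: vM.
  rewrite -(cvg_lim _ c)//; apply: cvg_lim => //.
  by under eq_fun do rewrite e0; exact: cvg_cst.
have e2 : \sum_j (sip (fun z => v j z * wd j g z) g + sip (fun z => v j z * g z) (wd j g)) = 0.
  have c : (fun m => \sum_j (sip (fun z => v j z * wd j g z) (p m) +
      sip (fun z => v j z * g z) (partial j (p m)))) @ \oo -->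
     \sum_j (sip (fun z => v j z * wd j g z) g + sip (fun z => v j z * g z) (wd j g)).
    apply: cvg_sum2 => j; apply: cvgD; first by apply: sip_cvg => //; exact: vM.
    by apply: sip_cvg => //; exact: vM.
  rewrite -(cvg_lim _ c)//; apply: cvg_lim => //.
  have -> : (fun m => \sum_j (sip (fun z => v j z * wd j g z) (p m) +
      sip (fun z => v j z * g z) (partial j (p m)))) = (fun=> 0).
    apply/funext => m; rewrite -[RHS](e1 m); apply: eq_bigr => j _.
    by congr (_ + _); apply: eq_Rintegral => z _; ring.
  exact: cvg_cst.
have e3 : \sum_j (sip (fun z => v j z * wd j g z) g + sip (fun z => v j z * g z) (wd j g)) =
    2 * \sum_j sip (fun z => v j z * wd j g z) g.
  rewrite mulr_sumr; apply: eq_bigr => j _; rewrite mulr_natl mulr2n; congr (_ + _).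
  by apply: eq_Rintegral => z _; ring.
by move: e2; rewrite e3 => /eqP; rewrite mulf_eq0 pnatr_eq0/= => /eqP.
Qed.
End Fields.

(** * The energy identity at a fixed time *)

Section Stationary.
Context {R : realType}.
Local Notation X2 := (measurableTypeR R * measurableTypeR R)%type.
Local Notation torus := (@torus R).
Implicit Types (f g : torusfun R) (u v w e phi : vfield R).

Lemma is_leray_ip (g p : vfield R) phi : is_leray g p -> H phi -> ip p phi = ip g phi.
Proof.
move=> [lg hp h] hphi; have := h _ hphi.
by rewrite ipBl//; [move/eqP; rewrite subr_eq0 => /eqP|exact: H_L2|exact: H_L2].
Qed.

Lemma DA_V u : DA u -> V u.
Proof. by move=> [hu h2]; split => // i; case: (h2 i). Qed.

Lemma DA_bounded u : DA u -> forall j, exists M, {ae torus, forall z, `|u j z| <= M}.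
Proof. by move=> [_ h2] j; exact: H2_bounded. Qed.

(** Against a divergence-free field the Leray projection drops out, and each
    second derivative is integrated by parts in H1. *)
Lemma ip_stokes u a e : is_A u a -> V e ->
  ip a e = \sum_i \sum_j sip (wd j (u i)) (wd j (e i)).
Proof.
move=> [[hu h2] hl] [he h1]; have := is_leray_ip hl he.
have [ll hna _] := hl; have le := H_L2 he.
have la : L2field a.
  move=> i; have := H_L2 hna i => /l2N.
  by rewrite (_ : (fun x => - (- a) i x) = a i)//; apply/funext => z; rewrite opprK.
have -> : ip (- a) e = - ip a e.
  rewrite !ipE//; last exact: H_L2 hna.
  rewrite -sumrN; apply: eq_bigr => i _.
  rewrite -[RHS]mulN1r -sipZl//; congr sip; apply/funext => z.
  by rewrite mulN1r.
move/eqP; rewrite eqr_oppLR => /eqP ->; rewrite ipE// -sumrN; apply: eq_bigr => i _.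
have lj j : L2 (wd j (wd j (u i))) by have [_ /(_ j)[_ /(_ j)[]]] := h2 i.
rewrite /sip /laplacian.
have -> : (fun z => (\sum_j wd j (wd j (u i)) z) * e i z) =
    (fun z => \sum_j (wd j (wd j (u i)) z * e i z)).
  by apply/funext => z; rewrite mulr_suml.
rewrite /int_torus Rint_sum//; last by move=> j; exact: (l2M (lj j) (le i)).
rewrite -sumrN; apply: eq_bigr => j _.
have [_ hw] := h2 i; have := H1_ibp j (hw j) (h1 i); rewrite /sip /int_torus => ->.
by rewrite opprK.
Qed.

Lemma L2_boundedM u : DA u -> forall j f, L2 f -> L2 (fun z => u j z * f z).
Proof.
move=> hu j f lf; have [M hM] := DA_bounded hu j; apply: l2_bndM hM lf.
by apply: l2_meas; case: hu => [/H_L2 + _]; exact.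
Qed.

Lemma ip_advect u w e : (forall j f, L2 f -> L2 (fun z => u j z * f z)) ->
  (forall i, H1 (w i)) -> L2field e ->
  ip (advect u w) e = \sum_i \sum_j sip (fun z => u j z * wd j (w i) z) (e i).
Proof.
move=> bu hw le.
have lw i j : L2 (wd j (w i)) by have [_ /(_ j)[]] := hw i.
have la : L2field (advect u w).
  by move=> i; apply: l2_sum => j; exact: bu.
rewrite ipE//; apply: eq_bigr => i _; rewrite /sip /advect.
have -> : (fun z => (\sum_j u j z * wd j (w i) z) * e i z) =
    (fun z => \sum_j (u j z * wd j (w i) z * e i z)).
  by apply/funext => z; rewrite mulr_suml.
by rewrite /int_torus Rint_sum// => j; exact: (l2M (bu j _ (lw i j)) (le i)).
Qed.

Lemma wd_B i f g : H1 f -> H1 g ->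
  {ae torus, forall z, wd i (f - g) z = wd i f z - wd i g z}.
Proof.
move=> hf hg; have := wd_lin i (-1) hg hf.
have -> : (fun z => -1 * g z + f z) = f - g.
  by apply/funext => z; rewrite mulN1r addrC.
by move=> h; apply: filterS h => z ->; rewrite mulN1r addrC.
Qed.

Lemma H1_B f g : H1 f -> H1 g -> H1 (f - g).
Proof.
move=> hf hg; have := H1_lin (-1) hg hf.
have -> // : (fun z => -1 * g z + f z) = f - g.
by apply/funext => z; rewrite mulN1r addrC.
Qed.

(** With [e = v - u], (v.grad)v - (u.grad)u = (e.grad)u + (v.grad)e, and the last
    term is orthogonal to [e]. *)
Lemma advect_difference u v : DA u -> DA v ->
  ip (advect v v) (v - u) - ip (advect u u) (v - u) =
  trilinear (v - u) u (v - u).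
Proof.
move=> du dv; have [hu h1u] := DA_V du; have [hv h1v] := DA_V dv.
have bu := L2_boundedM du; have bv := L2_boundedM dv.
have he := H_B hv hu; have le := H_L2 he.
have be j f : L2 f -> L2 (fun z => (v - u) j z * f z).
  move=> lf; have := l2B (bv j f lf) (bu j f lf).
  have -> // : (fun z => v j z * f z - u j z * f z) = (fun z => (v - u) j z * f z).
  by apply/funext => z; rewrite -mulrBl.
have lw w i j : (forall i, H1 (w i)) -> L2 (wd j (w i)).
  by move=> h; have [_ /(_ j)[]] := h i.
have h1e i : H1 ((v - u) i) by exact: H1_B.
have key i j : sip (fun z => v j z * wd j (v i) z) ((v - u) i) -
      sip (fun z => u j z * wd j (u i) z) ((v - u) i) =
    sip (fun z => (v - u) j z * wd j (u i) z) ((v - u) i) +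
      sip (fun z => v j z * wd j ((v - u) i) z) ((v - u) i).
  have l1 := bv j _ (lw v i j h1v); have l2 := bu j _ (lw u i j h1u).
  have l3 := be j _ (lw u i j h1u); have l4 := bv j _ (lw (v - u) i j h1e).
  apply: (etrans (esym (sipBl l1 l2 (le i)))); apply: (etrans _ (sipDl l3 l4 (le i))).
  apply: ae_sip.
  apply: filterS (wd_B j (h1v i) (h1u i)) => z wz.
  rewrite (_ : wd j ((v - u) i) z = wd j (v i) z - wd j (u i) z)//.
  rewrite (_ : (v - u) j z = v j z - u j z)//; ring.
rewrite /trilinear !ip_advect// -sumrB.
have t0 i := transport_zero hv (DA_bounded dv) (h1e i).
apply: eq_bigr => i _; rewrite -sumrB (eq_bigr _ (fun j _ => key i j)).
apply: (etrans (big_split _ _ _ _ _)).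
by apply: (etrans (congr1 (fun x => _ + x) (t0 i))); exact: addr0.
Qed.

Lemma ip_scale_dot f (m e : vfield R) : ip (scale f m) e = sip f (dot e m).
Proof.
rewrite /ip /sip; congr int_torus; apply/funext => z.
by rewrite /dot /scale mulr_sumr; apply: eq_bigr => i _; ring.
Qed.

Lemma ip_equation nu (F w a b : vfield R) e :
  L2field F -> L2field w -> L2field a -> L2field b -> L2field e ->
  eq_field (w + (fun i x => nu * a i x) + b) F ->
  ip w e = ip F e - nu * ip a e - ip b e.
Proof.
move=> lF lw la lb le h; rewrite !ipE// mulr_sumr -!sumrB; apply: eq_bigr => i _.
have l1 := l2Z nu (la i); have l2 := l2B (lF i) l1.
rewrite -sipZl// -!sipBl//; apply: ae_sip.
apply: filterS h => z /(_ i) <-.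
rewrite (_ : (w + (fun i x => nu * a i x) + b) i z = w i z + nu * a i z + b i z)//; ring.
Qed.

Lemma is_A_L2 u a : is_A u a -> L2field a.
Proof.
move=> [_ [_ /H_L2 ha _]] i; have := l2N (ha i).
by rewrite (_ : (fun x => - (- a) i x) = a i)//; apply/funext => z; rewrite opprK.
Qed.

Lemma vnorm_form u v : V u -> V v ->
  (\sum_i \sum_j sip (wd j (v i)) (wd j ((v - u) i))) -
  (\sum_i \sum_j sip (wd j (u i)) (wd j ((v - u) i))) = vnorm (v - u) ^+ 2.
Proof.
move=> [hu h1u] [hv h1v]; have h1e i : H1 ((v - u) i) by exact: H1_B.
have lw w i j : (forall i, H1 (w i)) -> L2 (wd j (w i)).
  by move=> h; have [_ /(_ j)[]] := h i.
rewrite vnorm_sqr// -sumrB; apply: eq_bigr => i _; rewrite -sumrB; apply: eq_bigr => j _.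
have l1 := lw v i j h1v; have l2 := lw u i j h1u; have l3 := lw (v - u) i j h1e.
rewrite -sipBl// -sipff; apply: ae_sip.
by apply: filterS (wd_B j (h1v i) (h1u i)) => z wz; rewrite -wz.
Qed.

(** Both equations are tested with [v - u], which lies in H, so that every Leray
    projection drops out. *)
Lemma energy_identity (nu mu : R) (f m wu wv u v au av bu bv p : vfield R) (J : torusfun R) :
  H f -> H wu -> H wv -> L2 J ->
  is_A u au -> is_A v av -> is_B u u bu -> is_B v v bv ->
  is_leray (scale J m) p ->
  eq_field (wu + (fun i x => nu * au i x) + bu) f ->
  eq_field (wv + (fun i x => nu * av i x) + bv) (fun i x => f i x - mu * p i x) ->
  ip (wv - wu) (v - u) = - nu * vnorm (v - u) ^+ 2 - trilinear (v - u) u (v - u)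
     - mu * sip J (dot (v - u) m).
Proof.
move=> hf hwu hwv lJ Au Av Bu Bv hp equ eqv.
have du : DA u by case: Au. have dv : DA v by case: Av.
have [hu _] := DA_V du; have [hv _] := DA_V dv.
have Ve : V (v - u) by apply: V_B; exact: DA_V.
have he : H (v - u) by case: Ve.
have le := H_L2 he; have lf := H_L2 hf.
have hHp : H p by case: hp. have lp := H_L2 hHp.
have lau := is_A_L2 Au; have lav := is_A_L2 Av.
have lbu : L2field bu by case: Bu => _ /H_L2.
have lbv : L2field bv by case: Bv => _ /H_L2.
have lFp : L2field (fun i x => f i x - mu * p i x).
  by move=> i; exact: (l2B (lf i) (l2Z mu (lp i))).
rewrite ipBl//; try exact: H_L2.
rewrite (ip_equation lFp _ lav lbv le eqv); last exact: H_L2.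
rewrite (ip_equation lf _ lau lbu le equ); last exact: H_L2.
have -> : ip (fun i x => f i x - mu * p i x) (v - u) =
    ip f (v - u) - mu * ip p (v - u).
  rewrite !ipE// mulr_sumr -sumrB; apply: eq_bigr => i _.
  by have l1 := l2Z mu (lp i); rewrite -sipZl// -sipBl.
rewrite (is_leray_ip hp he) ip_scale_dot.
rewrite (ip_stokes Au Ve) (ip_stokes Av Ve) (is_leray_ip Bu he) (is_leray_ip Bv he).
have arith (a b c d g F n2 tr : R) : a - b = n2 -> c - d = tr ->
  (F - mu * g - nu * a - c) - (F - nu * b - d) = - nu * n2 - tr - mu * g.
  by move=> <- <-; ring.
exact: arith (vnorm_form (DA_V du) (DA_V dv)) (advect_difference du dv).
Qed.
End Stationary.

(** * A smooth step *)

Section SmoothStep.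
Context {R : realType}.
Implicit Types (f g : R -> R) (x : R) (k n : nat).

(** Finite differentiability as a recursion, so that stability under the
    operations of calculus is an induction on [n]. *)
Fixpoint diffn n f : Prop :=
  if n is n'.+1 then (forall x, derivable f x 1) /\ diffn n' (derive1 f) else True.

Lemma diffn_derivable f : (forall n, diffn n f) -> forall n x, derivable (derive1n n f) x 1.
Proof.
move=> hf n; elim: n f hf => [|n IH] f hf x; first by case: (hf 1%N).
rewrite /derive1n iterSr -/(derive1n n (derive1 f)); apply: IH => m.
by case: (hf m.+1).
Qed.

Lemma diffn_step n f g : (forall x, is_derive x (1 : R) f (g x)) -> diffn n g -> diffn n.+1 f.
Proof.
move=> fg gn; split; first by move=> x; have := fg x => D; exact: ex_derive.
have -> // : derive1 f = g.
by apply/funext => x; rewrite derive1E; have := fg x => D; rewrite derive_val.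
Qed.

Lemma diffnW n f : diffn n.+1 f -> diffn n f.
Proof. by elim: n f => // n IH f /= [h1 h2]; split => //; exact: IH. Qed.

Lemma diffn_is_derive n f : diffn n.+1 f -> forall x, is_derive x (1 : R) f (derive1 f x).
Proof. by move=> [h _] x; split => //; rewrite derive1E. Qed.

Lemma diffn_lin n (a : R) f g : diffn n f -> diffn n g -> diffn n (fun x => a * f x + g x).
Proof.
elim: n f g => // n IH f g hf hg.
apply: (@diffn_step _ _ (fun x => a * derive1 f x + derive1 g x)).
  move=> x; have D1 := diffn_is_derive hf x; have D2 := diffn_is_derive hg x.
  exact: (@is_deriveD _ _ _ (a *: f) g).
by apply: IH; [case: hf|case: hg].
Qed.

Lemma diffnM n f g : diffn n f -> diffn n g -> diffn n (fun x => f x * g x).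
Proof.
elim: n f g => // n IH f g hf hg.
apply: (@diffn_step _ _ (fun x => 1 * (f x * derive1 g x) + g x * derive1 f x)).
  move=> x; have D1 := diffn_is_derive hf x; have D2 := diffn_is_derive hg x.
  by rewrite mul1r; exact: (@is_deriveM _ _ f g).
apply: diffn_lin; apply: IH.
- exact: diffnW.
- by case: hg.
- exact: diffnW.
- by case: hf.
Qed.

Lemma diffn_cst n (c : R) : diffn n (fun=> c).
Proof.
elim: n c => // n IH c; apply: (@diffn_step _ _ (fun=> 0)) => // x.
Qed.

Lemma diffnV n f : (forall x, f x != 0) -> diffn n f -> diffn n (fun x => (f x)^-1).
Proof.
move=> f0; elim: n => // n IH hf.
apply: (@diffn_step _ _ (fun x => -1 * ((f x)^-1 * (f x)^-1 * derive1 f x) + 0)).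
  move=> x; have D := diffn_is_derive hf x; have D1 := is_deriveV (f0 x) D.
  apply: is_derive_eq; rewrite /GRing.scale /= addr0 mulN1r mulNr; congr (- (_ * _)).
  by rewrite expr2 invfM.
have h := IH (diffnW hf); apply: diffn_lin; last exact: diffn_cst.
by apply: diffnM; [exact: diffnM|case: hf].
Qed.

Lemma diffn_affine n f (c d : R) : diffn n f -> diffn n (fun x => f (c * x + d)).
Proof.
elim: n f => // n IH f hf.
apply: (@diffn_step _ _ (fun x => c * derive1 f (c * x + d) + 0)).
  move=> x; have D := diffn_is_derive hf (c * x + d).
  have D2 : is_derive x (1 : R) (fun x : R => c * x + d) c.
    have D3 : is_derive x (1 : R) (c *: (id : R -> R) + cst d) c.
      by apply: is_derive_eq; rewrite /GRing.scale /= mulr1 addr0.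
    exact: D3.
  have := @is_derive1_comp _ f (fun x => c * x + d) x _ _ D D2; rewrite mulrC addr0; exact.
by apply: diffn_lin; [apply: IH; case: hf|exact: diffn_cst].
Qed.

(** [x ^ - k exp (- 1 / x)] on the positive half line, extended by 0.  The
    derivatives of members of this family are combinations of members. *)
Definition flat k x : R := if 0 < x then x^-1 ^+ k * expR (- x^-1) else 0.

Lemma flat_ge0 k x : 0 <= flat k x.
Proof.
rewrite /flat; case: ifP => // x0; rewrite mulr_ge0 ?expR_ge0// exprn_ge0// invr_ge0 ltW//.
Qed.

(** From [y ^ k.+1 / k.+1`! <= exp y] at [y = 1 / x]. *)
Lemma flat_le k x : 0 < x -> flat k x <= (k.+1)`!%:R * x.
Proof.
move=> x0; rewrite /flat x0 expRN.
have y0 : 0 < x^-1 by rewrite invr_gt0.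
rewrite ler_pdivrMr ?expR_gt0//.
have h := expR_ge1Dxn k (ltW y0).
have h' : x^-1 ^+ k.+1 / (k.+1)`!%:R <= expR x^-1 by apply: le_trans h; rewrite lerDr.
have f0 : 0 < (k.+1)`!%:R :> R by rewrite ltr0n fact_gt0.
rewrite ler_pdivrMr// in h'.
have -> : x^-1 ^+ k = x^-1 ^+ k.+1 * x by rewrite exprSr -mulrA mulVf ?mulr1// gt_eqF.
rewrite [_ * x * _]mulrAC ler_pM2r// mulrC //.
Qed.

Lemma is_derive_flat k x :
  is_derive x (1 : R) (flat k) (- k%:R * flat k.+1 x + flat k.+2 x).
Proof.
have [x0|x0|->] := ltgtP x 0.
- rewrite /flat ltNge (ltW x0)/= mulr0 addr0.
  have D0 : is_derive x (1 : R) (cst (0 : R)) 0 by exact: is_derive_cst.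
  apply: near_eq_is_derive D0.
  by near=> y; rewrite ifF//; apply/negbTE; rewrite -leNgt ltW//; near: y; exact: lt_nbhsl.
- rewrite /flat x0.
  have xn0 : x != 0 by rewrite gt_eqF.
  have D1 : is_derive x (1 : R) (fun y : R => y^-1) (- x ^- 2).
    have D0 := @is_deriveV _ (id : R -> R) x 1 1 xn0 (is_derive_id _ _).
    by apply: is_derive_eq; rewrite /GRing.scale /= mulr1.
  have D2 := @is_deriveX _ _ (fun y : R => y^-1) k x 1 _ D1.
  have D3 : is_derive x (1 : R) (fun y : R => expR (- y^-1)) (expR (- x^-1) * - - x ^- 2).
    exact: (@is_derive1_comp _ expR (fun y : R => - y^-1)).
  have D4 := @is_deriveM _ _ ((fun y : R => y^-1) ^+ k) (fun y : R => expR (- y^-1)) x 1 _ _ D2 D3.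
  apply: (@near_eq_is_derive _ _ _
      ((fun y : R => y^-1) ^+ k * (fun y : R => expR (- y^-1)))).
    near=> y; rewrite ifT; last by near: y; exact: lt_nbhsr.
    by rewrite mulrfctE exprfctE.
  apply: is_derive_eq; rewrite /GRing.scale /= exprfctE opprK -exprVn.
  case: k {D2 D3 D4} => [|k]; rewrite /= ?exprS; ring.
  (* at 0 the difference quotient of [flat k] is [flat k.+1] itself *)
- have q : (fun h : R => h^-1 *: ((flat k \o shift 0) (h *: (1 : R)) - flat k 0)) @ 0^' --> (0 : R).
    have -> : (fun h : R => h^-1 *: ((flat k \o shift 0) (h *: (1 : R)) - flat k 0)) = flat k.+1.
      apply/funext => h; rewrite /= /GRing.scale /= mulr1 addr0 /flat ltxx subr0.
      by case: ifP => _; rewrite ?mulr0// exprS mulrA.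
    apply: (@squeeze_cvgr _ _ _ _ (cst 0) (fun h => (k.+2)`!%:R * `|h|)).
    + near=> h; rewrite flat_ge0/=; have [h0|h0] := ltP 0 h.
        by rewrite ger0_norm ?(ltW h0)//; exact: flat_le.
      by rewrite /flat ltNge h0/= mulr_ge0.
    + exact: cvg_cst.
    + have c : (fun h : R => `|h|) @ 0^' --> (0 : R).
        apply: cvg_within_filter.
        have := @norm_continuous _ R (0 : R); rewrite /continuous_at normr0; exact.
      have := @cvgM _ _ _ _ (fun=> (k.+2)`!%:R) _ _ _ (cvg_cst _) c.
      by rewrite mulr0; exact.
  split; first by apply/cvg_ex; exists 0.
  by rewrite /flat ltxx mulr0 addr0; apply/cvg_lim.
Unshelve. all: by end_near. Qed.

Lemma diffn_flat n k : diffn n (flat k).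
Proof.
elim: n k => // n IH k.
apply: diffn_step (is_derive_flat k) _.
by apply: diffn_lin; exact: IH.
Qed.

(** A smooth step from 0 on the negative half line to 1 from 1 on; the
    denominator never vanishes because [x] or [1 - x] is positive. *)
Definition sstep x : R := flat 0 x * (flat 0 x + flat 0 (1 - x))^-1.

Lemma flat_gt0 k x : 0 < x -> 0 < flat k x.
Proof. by move=> x0; rewrite /flat x0 mulr_gt0 ?expR_gt0// exprn_gt0// invr_gt0. Qed.

Lemma flat_eq0 k x : x <= 0 -> flat k x = 0.
Proof. by move=> x0; rewrite /flat ltNge x0. Qed.

Let den_gt0 x : 0 < flat 0 x + flat 0 (1 - x).
Proof.
have [x0|x0] := ltP 0 x; first by rewrite ltr_pwDl ?flat_gt0// flat_ge0.
by rewrite ltr_wpDl ?flat_ge0// flat_gt0// subr_gt0 (le_lt_trans x0).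
Qed.

Lemma sstep_le0 x : x <= 0 -> sstep x = 0.
Proof. by move=> x0; rewrite /sstep flat_eq0// mul0r. Qed.

Lemma sstep_ge1 x : 1 <= x -> sstep x = 1.
Proof.
move=> x1; rewrite /sstep (@flat_eq0 _ (1 - x)) ?subr_le0// addr0 divff// gt_eqF//.
by rewrite flat_gt0// (lt_le_trans ltr01).
Qed.

Lemma sstep_itv x : 0 <= sstep x <= 1.
Proof.
rewrite /sstep divr_ge0 ?flat_ge0 ?(ltW (den_gt0 _))//=.
by rewrite ler_pdivrMr// mul1r lerDl flat_ge0.
Qed.

Let diffn_den n : diffn n (fun x => flat 0 x + flat 0 (1 - x)).
Proof.
have -> : (fun x => flat 0 x + flat 0 (1 - x)) =
    (fun x => 1 * flat 0 x + flat 0 (-1 * x + 1)).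
  by apply/funext => x; rewrite mul1r mulN1r [- x + _]addrC.
by apply: diffn_lin; [exact: diffn_flat|apply: (@diffn_affine _ _ (-1) 1); exact: diffn_flat].
Qed.

Lemma diffn_sstep n : diffn n sstep.
Proof.
apply: diffnM; first exact: diffn_flat.
by apply: diffnV => // x; rewrite gt_eqF.
Qed.

(** Thanks to the sign, the rescaled derivatives are approximate identities. *)
Lemma derive_sstep_ge0 x : 0 <= derive1 sstep x.
Proof.
have D1 : is_derive x (1 : R) (flat 0) (flat 2 x).
  by have := is_derive_flat 0 x; rewrite oppr0 mul0r add0r.
have D2 : is_derive x (1 : R) (fun y => flat 0 (1 - y)) (- flat 2 (1 - x)).
  have D3 : is_derive (1 - x) (1 : R) (flat 0) (flat 2 (1 - x)).
    by have := is_derive_flat 0 (1 - x); rewrite oppr0 mul0r add0r.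
  have D4 : is_derive x (1 : R) (fun y : R => 1 - y) (-1).
    have D5 : is_derive x (1 : R) (cst (1 : R) - (id : R -> R)) (-1).
      by apply: is_derive_eq; rewrite sub0r.
    exact: D5.
  by have := @is_derive1_comp _ (flat 0) (fun y => 1 - y) x _ _ D3 D4; rewrite mulrN1.
have D5 := @is_deriveD _ _ _ (flat 0) (fun y => flat 0 (1 - y)) x 1 _ _ D1 D2.
have n0 : flat 0 x + flat 0 (1 - x) != 0 by rewrite gt_eqF.
have D6 := @is_deriveV _ (flat 0 + (fun y => flat 0 (1 - y))) x _ 1 n0 D5.
have D7 := @is_deriveM _ _ (flat 0) (fun y => (flat 0 y + flat 0 (1 - y))^-1) x 1 _ _ D1 D6.
rewrite derive1E (@derive_val _ _ _ _ _ _ _ D7) /GRing.scale /=.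
set d := (flat 0 + _) x.
have dE : d = flat 0 x + flat 0 (1 - x) by [].
have d0 : 0 < d by rewrite dE.
have -> : flat 0 x * (- d ^- 2 * (flat 2 x - flat 2 (1 - x))) +
   (flat 0 x + flat 0 (1 - x))^-1 * flat 2 x =
   d ^- 2 * (flat 0 x * flat 2 (1 - x) + flat 0 (1 - x) * flat 2 x).
  rewrite -dE; have -> : flat 0 (1 - x) = d - flat 0 x by rewrite dE addrC addKr.
  by field; rewrite gt_eqF.
by rewrite mulr_ge0 ?invr_ge0 ?exprn_ge0 ?(ltW d0)// addr_ge0// mulr_ge0// flat_ge0.
Qed.

Lemma continuous_derive_sstep : continuous (derive1 sstep).
Proof.
move=> x; apply: differentiable_continuous; apply/derivable1_diffP.
by case: (diffn_sstep 2) => _ [].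
Qed.

Lemma is_derive_sstep x : is_derive x (1 : R) sstep (derive1 sstep x).
Proof. exact: diffn_is_derive (diffn_sstep 1) x. Qed.
End SmoothStep.

(** * From the distributional to the integrated time derivative *)

Section TimeIdentity.
Context {R : realType}.
Local Notation leb := (@lebesgue_measure R).
Implicit Types (g G : R -> R).

Lemma derive_sstep_out (x : R) : x < 0 \/ 1 < x -> derive1 (@sstep R) x = 0.
Proof.
rewrite derive1E => -[x0|x1].
  rewrite (@near_eq_derive _ _ _ _ (cst (0 : R))) ?derive_cst//.
  by near=> y; rewrite sstep_le0// ltW//; near: y; exact: lt_nbhsl.
rewrite (@near_eq_derive _ _ _ _ (cst (1 : R))) ?derive_cst//.
by near=> y; rewrite sstep_ge1// ltW//; near: y; exact: lt_nbhsr.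
Unshelve. all: by end_near. Qed.

(** The step that starts at [a] and is complete at [a + 1 / c]. *)
Definition tstep (c a x : R) : R := sstep (c * x + - (c * a)).

Definition dtstep (c a x : R) : R := c * derive1 (@sstep R) (c * x + - (c * a)).

Lemma is_derive_tstep c a x : is_derive x (1 : R) (tstep c a) (dtstep c a x).
Proof.
have D2 : is_derive x (1 : R) (c *: (id : R -> R) + cst (- (c * a))) c.
  have D0 := @is_deriveD _ _ _ (c *: (id : R -> R)) (cst (- (c * a))) x 1 _ _ (is_deriveZ c (is_derive_id x 1)) (is_derive_cst _ _ _).
  by apply: (is_derive_eq D0); rewrite /GRing.scale /= mulr1 addr0.
have := @is_derive1_comp _ (@sstep R) (fun x => c * x + - (c * a)) x _ _
  (is_derive_sstep _) D2.
by rewrite [_ * c]mulrC; exact.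
Qed.

Lemma continuous_dtstep c a : continuous (dtstep c a).
Proof.
move=> x; apply: (@continuousM _ _ (fun=> c) (fun x => derive1 (@sstep R) (c * x + - (c * a)))); first exact: cst_continuous.
apply: (@continuous_comp _ _ _ (fun x : R => c * x + - (c * a)) (derive1 (@sstep R))); last exact: continuous_derive_sstep.
apply: (@continuousD _ _ _ (fun x => c * x) (fun=> - (c * a))); last exact: cst_continuous.
by apply: (@continuousM _ _ (fun=> c) id); [exact: cst_continuous|exact: cvg_id].
Qed.

Lemma dtstep_ge0 c a x : 0 <= c -> 0 <= dtstep c a x.
Proof. by move=> c0; rewrite mulr_ge0// derive_sstep_ge0. Qed.

Lemma Rint_oo_cc (a b : R) g : leb.-integrable `[a, b] (EFin \o g) ->
  \int[leb]_(t in `]a, b[) g t = \int[leb]_(t in `[a, b]) g t.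
Proof.
move=> ig; rewrite Rintegral_itv_bndo_bndc; last first.
  by apply: integrableS ig => //; exact: subset_itv_oo_cc.
apply: Rintegral_itv_obnd_cbnd.
by apply: integrableS ig => //; exact: subset_itv_oc_cc.
Qed.

Lemma ftc_derive (g dg : R -> R) (a b : R) : a <= b ->
  (forall x, is_derive x (1 : R) g (dg x)) -> continuous dg ->
  (\int[leb]_(x in `[a, b]) (dg x)%:E = (g b - g a)%:E)%E.
Proof.
move=> ab D; have -> : dg = (fun x => 'D_1 g x) by apply/funext => x; rewrite derive_val.
by apply: ftc => // x; exact: ex_derive.
Qed.

Section Fixed.
Context (T : R) (T0 : 0 < T).
Context (g G : R -> R).
Hypothesis cg : {within `[0, T], continuous g}.

Let cc_int f : {within `[0, T], continuous f} -> leb.-integrable `[0, T] (EFin \o f).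
Proof. by move=> cf; apply: continuous_compact_integrable => //; exact: segment_compact. Qed.

Lemma int_dtstep c a : 0 <= a -> 1 <= c * (T - a) -> 0 <= c ->
  \int[leb]_(t in `]0, T[) dtstep c a t = 1.
Proof.
move=> a0 cT c0; rewrite Rint_oo_cc; last first.
  by apply: cc_int; apply: continuous_subspaceT; exact: continuous_dtstep.
rewrite /Rintegral (ftc_derive (ltW T0) (is_derive_tstep c a) (@continuous_dtstep c a)).
rewrite /= /tstep sstep_ge1; last by rewrite -mulrBr.
by rewrite sstep_le0 ?subr0// mulr0 add0r oppr_le0 mulr_ge0.
Qed.

(** The derivatives of the steps are nonnegative, have integral 1 and vanish
    beyond the distance [1 / c n] after [a]. *)
Lemma cvg_dtstep (c : nat -> R) a : 0 < a -> a < T -> (forall n, 0 < c n) ->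
  (forall n, 1 <= c n * (T - a)) -> (fun n => (c n)^-1) @ \oo --> 0 ->
  (fun n => \int[leb]_(t in `]0, T[) (g t * dtstep (c n) a t)) @ \oo --> g a.
Proof.
move=> a0 aT c0 cT cc; apply/cvgrPdist_le => e e0.
have ca : {for a, continuous g}.
  have := cg; rewrite continuous_within_itvP// => -[+ _ _]; apply.
  by rewrite in_itv/= a0.
have /cvgrPdist_le/(_ e e0) := ca; rewrite near_nbhs => -[d /= d0 hd].
have /cvgrPdist_lt/(_ d d0)[N _ hN] := cc.
exists N => // n /= Nn; have {hN} := hN n Nn; rewrite /= sub0r normrN.
rewrite gtr0_norm ?invr_gt0// => cd.
have ik : leb.-integrable `]0, T[ (EFin \o dtstep (c n) a).
  apply: (@integrableS _ _ _ leb `[0, T]) => //; first exact: subset_itv_oo_cc.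
  by apply: cc_int; apply: continuous_subspaceT; exact: continuous_dtstep.
have cgk : {within `[0, T], continuous (fun t => g t * dtstep (c n) a t)}.
  move=> t; apply: continuousM; first exact: cg.
  by apply: continuous_subspaceT; exact: continuous_dtstep.
have igk : leb.-integrable `]0, T[ (EFin \o (fun t => g t * dtstep (c n) a t)).
  apply: (@integrableS _ _ _ leb `[0, T]) => //; first exact: subset_itv_oo_cc.
  exact: cc_int.
have k1 := int_dtstep (ltW a0) (cT n) (ltW (c0 n)).
have ga : g a = \int[leb]_(t in `]0, T[) (g a * dtstep (c n) a t).
  by rewrite RintegralZl// k1 mulr1.
have igak : leb.-integrable `]0, T[ (EFin \o (fun t => g a * dtstep (c n) a t)).
  exact: itgZ.
rewrite {1}ga -RintegralB//.
apply: le_trans (le_normr_Rintegral _ _) _ => //; first exact: itgB.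
apply: (@le_trans _ _ (\int[leb]_(t in `]0, T[) (e * dtstep (c n) a t))); last first.
  by rewrite RintegralZl// k1 mulr1.
apply: le_Rintegral => //.
- exact: (integrable_norm (itgB _ igak igk)).
- exact: itgZ.
move=> t _; rewrite -mulrBl normrM (ger0_norm (dtstep_ge0 _ _ (ltW (c0 n)))).
have [tin|] := boolP (a <= t <= a + (c n)^-1).
  rewrite ler_wpM2r ?dtstep_ge0 ?(ltW (c0 n))//; apply: hd.
  rewrite /ball_ /=; case/andP: tin => h1 h2; rewrite ler0_norm ?subr_le0//.
  by rewrite opprB ltrBlDl (le_lt_trans h2)// ltrD2l.
rewrite negb_and -!ltNge => tout.
have -> : dtstep (c n) a t = 0.
  rewrite /dtstep derive_sstep_out ?mulr0//; case/orP: tout => h; [left|right].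
    by rewrite subr_lt0 ltr_pM2l.
  rewrite -mulrBr -(@ltr_pM2l _ (c n)^-1) ?invr_gt0// mulKf ?gt_eqF// mulr1.
  by rewrite ltrBrDl.
by rewrite !mulr0.
Qed.

Hypothesis iG : leb.-integrable `]0, T[ (EFin \o G).
Hypothesis weak : forall psi, Cc_infty T psi ->
  \int[leb]_(t in `]0, T[) (g t * derive1 psi t) =
  - \int[leb]_(t in `]0, T[) (G t * psi t).

(** Test with the difference of a step at [a] and a step at [b].  Its derivative
    concentrates at [a] and at [b], while the function itself tends boundedly to
    the indicator of the interval between them. *)
Lemma weak_increment a b : 0 < a -> a <= b -> b < T ->
  g b - g a = \int[leb]_(t in `]a, b]) G t.
Proof.
move=> a0 ab bT; have aT := le_lt_trans ab bT; have b0 := lt_le_trans a0 ab.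
have Tb : 0 < T - b by rewrite subr_gt0.
(* the width is less than [T - b], so that the step at [b] is complete before [T] *)
pose c n : R := n.+2%:R / (T - b).
have c0 n : 0 < c n by rewrite divr_gt0.
have cinv n : (c n)^-1 = (T - b) / n.+2%:R by rewrite /c invf_div.
have cTb n : 1 <= c n * (T - b) by rewrite divfK ?gt_eqF// ler1n.
have cTa n : 1 <= c n * (T - a).
  by rewrite (le_trans (cTb n))// ler_wpM2l ?(ltW (c0 n))// lerD2l lerN2.
have cc : (fun n => (c n)^-1) @ \oo --> 0.
  have h : (fun n => (T - b) * n.+1%:R^-1) @ \oo --> (T - b) * 0.
    by apply: cvgM; [exact: cvg_cst|exact: cvg_harmonic].
  rewrite -cvg_shiftS mulr0 in h.
  by under eq_fun do rewrite cinv.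
pose psi n := fun t => -1 * tstep (c n) b t + tstep (c n) a t.
have dpsi n t : derive1 (psi n) t = dtstep (c n) a t - dtstep (c n) b t.
  have D1 := is_derive_tstep (c n) a t; have D2 := is_derive_tstep (c n) b t.
  have D3 := @is_deriveD _ _ _ (-1 *: tstep (c n) b) (tstep (c n) a) t 1 _ _
    (is_deriveZ _ D2) D1.
  by rewrite derive1E (@derive_val _ _ _ _ _ _ _ D3) /GRing.scale /= mulN1r addrC.
have Cpsi n : Cc_infty T (psi n).
  split.
    apply: diffn_derivable => k; apply: diffn_lin;
      by apply: diffn_affine; exact: diffn_sstep.
  exists a, (b + (c n)^-1); split => //.
    rewrite cinv -ltrBrDl ltr_pdivrMr// ltr_pMr// ltr1n//.
  move=> t; rewrite negb_and -!ltNge /psi /tstep => /orP[ta|tb].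
    have h x : a <= x -> sstep (c n * t + - (c n * x)) = 0.
      by move=> ax; rewrite sstep_le0// subr_le0 ler_pM2l// (le_trans (ltW ta)).
    by rewrite !h// mulr0 addr0.
  have h x : x <= b -> 1 <= c n * t + - (c n * x).
    move=> xb; rewrite -mulrBr -(@ler_pM2l _ (c n)^-1) ?invr_gt0// mulKf ?gt_eqF// mulr1.
    by rewrite lerBrDl (le_trans _ (ltW tb))// lerD2r.
  by rewrite !sstep_ge1 ?mulr1 ?addNr ?h.
have psi1 n t : `|psi n t| <= 1.
  have /andP[h1 h2] := sstep_itv (c n * t + - (c n * b)).
  have /andP[h3 h4] := sstep_itv (c n * t + - (c n * a)).
  by rewrite /psi /tstep ler_norml; apply/andP; split; lra.
have psilim t : (fun n => psi n t) @ \oo --> (\1_(`]a, b]) t : R).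
  have lim x : (fun n => tstep (c n) x t) @ \oo --> ((x < t)%R%:R : R).
    case: ltP => xt; last first.
      apply: cvg_near_cst; apply: nearW => n.
      by rewrite /tstep sstep_le0// subr_le0 ler_pM2l.
    apply: cvg_near_cst; have tx0 : 0 < t - x by rewrite subr_gt0.
    have /cvgrPdist_lt/(_ _ tx0)[N _ hN] := cc.
    exists N => // n /= /hN /=; rewrite sub0r normrN gtr0_norm ?invr_gt0// => h.
    rewrite /tstep sstep_ge1// -mulrBr -(@ler_pM2l _ (c n)^-1) ?invr_gt0//.
    by rewrite mulKf ?gt_eqF// mulr1 ltW.
  have -> : (\1_(`]a, b]) t : R) = -1 * (b < t)%R%:R + (a < t)%R%:R.
    rewrite indicE; have [at_|ta] := ltP a t; have [bt|tb] := ltP b t.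
    - by rewrite memNset/= ?mulr1 ?addNr// in_itv/= at_/= leNgt bt.
    - by rewrite mem_set/= ?mulr0 ?add0r// in_itv/= at_ tb.
    - by move: (lt_le_trans (le_lt_trans ab bt) ta); rewrite ltxx.
    - by rewrite memNset/= ?mulr0 ?add0r// in_itv/= ltNge ta.
  by apply: cvgD; [apply: cvgM; [exact: cvg_cst|exact: lim]|exact: lim].
have cga := cvg_dtstep a0 aT c0 cTa cc.
have cgb := cvg_dtstep b0 bT c0 cTb cc.
have mG : measurable_fun `]0, T[ G by exact: itg_meas iG.
have cont_psi n : continuous (psi n).
  move=> t; apply: differentiable_continuous; apply/derivable1_diffP.
  by case: (Cpsi n) => /(_ 0%N t).
have mpsi n : measurable_fun `]0, T[ (psi n).
  by apply: measurable_funTS; exact: continuous_measurable_fun.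
have [|||||_ cG] := @Rdominated _ _ _ leb `]0, T[
    (fun n t => G t * psi n t) (fun t => G t * \1_(`]a, b]) t) (fun t => `|G t|) _.
- exact: measurable_itv.
- by move=> n; exact: (measurable_funM mG (mpsi n)).
- exact: integrable_norm.
- by move=> n t _; rewrite normrM ler_piMr.
- by move=> t _; apply: cvgM; [exact: cvg_cst|exact: psilim].
have igk x n : leb.-integrable `]0, T[ (EFin \o (fun t => g t * dtstep (c n) x t)).
  apply: (@integrableS _ _ _ leb `[0, T]) => //; first exact: subset_itv_oo_cc.
  apply: cc_int => t; apply: continuousM; first exact: cg.
  by apply: continuous_subspaceT; exact: continuous_dtstep.
have E n : \int[leb]_(t in `]0, T[) (g t * dtstep (c n) a t) -
    \int[leb]_(t in `]0, T[) (g t * dtstep (c n) b t) =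
    - \int[leb]_(t in `]0, T[) (G t * psi n t).
  rewrite -weak// -RintegralB//; apply: eq_Rintegral => t _.
  by rewrite dpsi mulrBr.
have c1 : (fun n => - \int[leb]_(t in `]0, T[) (G t * psi n t)) @ \oo --> g a - g b.
  have -> : (fun n => - \int[leb]_(t in `]0, T[) (G t * psi n t)) =
      (fun n => \int[leb]_(t in `]0, T[) (g t * dtstep (c n) a t) -
         \int[leb]_(t in `]0, T[) (g t * dtstep (c n) b t)).
    by apply/funext => n; rewrite E.
  exact: cvgB.
have := cvgN cG => c2.
have : g a - g b = - \int[leb]_(t in `]0, T[) (G t * \1_(`]a, b]) t).
  by rewrite -(cvg_lim _ c1)//; apply: cvg_lim => //; exact: c2.
rewrite -opprB => /oppr_inj ->.
have sub : `]a, b] `<=` `]0, T[.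
  by move=> t /=; rewrite !in_itv/= => /andP[h1 h2]; rewrite (lt_trans a0)// (le_lt_trans h2).
rewrite -[in RHS](setIidr sub) Rintegral_mkcondr; apply: eq_Rintegral => t _.
by rewrite patchE indicE; case: (_ \in _); rewrite ?mulr1 ?mulr0.
Qed.
End Fixed.
End TimeIdentity.

(** * Representatives of Bochner measurable curves *)

Section Bochner.
Context {R : realType}.
Local Notation X1 := (measurableTypeR R).
Local Notation torus := (@torus R).
Local Notation leb := (@lebesgue_measure R).
Implicit Types (u v w phi : vfield R).

Lemma hnorm_N u : hnorm (- u) = hnorm u.
Proof.
rewrite /hnorm; congr Num.sqrt; apply: eq_bigr => i _; congr (_ ^+ 2).
by rewrite /L2norm -[in RHS](@oppe_Lnorm _ _ _ torus); congr (fine 'N[_]_(_)[_])%E.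
Qed.

Lemma hnorm_dist u v : L2field u -> L2field v -> `|hnorm u - hnorm v| <= hnorm (u - v).
Proof.
move=> lu lv; have luv := L2field_B lu lv.
have h1 : hnorm u <= hnorm (u - v) + hnorm v.
  by have := hnorm_triangle luv lv; rewrite subrK.
have lvu := L2field_B lv lu.
have h2 : hnorm v <= hnorm (u - v) + hnorm u.
  by have := hnorm_triangle lvu lu; rewrite subrK -(hnorm_N (v - u)) opprB.
by rewrite ler_norml; apply/andP; split; lra.
Qed.

Lemma hnorm_cvg (s : nat -> vfield R) w : L2field w -> (forall n, L2field (s n)) ->
  (fun n => hnorm (w - s n)) @ \oo --> (0 : R) ->
  (fun n => hnorm (s n)) @ \oo --> hnorm w.
Proof.
move=> lw ls c; apply/cvgrPdist_lt => e e0.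
have /cvgrPdist_lt/(_ _ e0)[N _ hN] := c.
exists N => // n /= /hN /=; rewrite sub0r normrN ger0_norm ?hnorm_ge0//.
exact: le_lt_trans (hnorm_dist lw (ls n)).
Qed.

Lemma ip_cvg (s : nat -> vfield R) w phi : L2field w -> (forall n, L2field (s n)) ->
  L2field phi -> (fun n => hnorm (w - s n)) @ \oo --> (0 : R) ->
  (fun n => ip (s n) phi) @ \oo --> ip w phi.
Proof.
move=> lw ls lphi c; apply/cvgrPdist_lt => e e0.
have p0 : 0 < hnorm phi + 1 by rewrite ltr_wpDl ?hnorm_ge0.
have q0 : 0 < e / (hnorm phi + 1) by rewrite divr_gt0.
have /cvgrPdist_lt/(_ _ q0)[N _ hN] := c.
exists N => // n /= /hN /=; rewrite sub0r normrN ger0_norm ?hnorm_ge0// ltr_pdivlMr// => h.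
rewrite -ipBl//; have lws := L2field_B lw (ls n).
apply: le_lt_trans (ip_CS lws lphi) _; apply: le_lt_trans h.
by rewrite ler_wpM2l ?hnorm_ge0// lerDl.
Qed.

Lemma simple_fieldE n (E : 'I_n -> set R) (c : 'I_n -> vfield R) t :
  (\sum_(k < n) (fun i x => \1_(E k) t * c k i x)) =
  (fun i x => \sum_(k < n) (\1_(E k) t * c k i x)) :> vfield R.
Proof. by apply/funext => i; apply/funext => x; rewrite !fct_sumE. Qed.

Lemma simple_L2 n (E : 'I_n -> set R) (c : 'I_n -> vfield R) t :
  (forall k, L2field (c k)) -> L2field (\sum_(k < n) (fun i x => \1_(E k) t * c k i x)).
Proof.
move=> lc; rewrite simple_fieldE => i; apply: l2_sum => k.
by apply: l2Z; exact: lc.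
Qed.

Lemma simple_ip n (E : 'I_n -> set R) (c : 'I_n -> vfield R) t phi :
  (forall k, L2field (c k)) -> L2field phi ->
  ip (\sum_(k < n) (fun i x => \1_(E k) t * c k i x)) phi =
  \sum_(k < n) \1_(E k) t * ip (c k) phi.
Proof.
move=> lc lphi; have l := simple_L2 E t lc.
rewrite ipE// simple_fieldE.
under [RHS]eq_bigr do rewrite ipE// mulr_sumr.
rewrite exchange_big /=; apply: eq_bigr => i _.
rewrite {1}/sip /int_torus.
transitivity (\int[torus]_x \sum_(k < n) (\1_(E k) t * (c k i x * phi i x))).
  by apply: eq_Rintegral => x _; rewrite mulr_suml; apply: eq_bigr => k _; rewrite mulrA.
have lk k := l2M (lc k i) (lphi i).
rewrite Rint_sum//; last by move=> k; exact: (itgZ _ _ (lk k)).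
by apply: eq_bigr => k _; rewrite RintegralZl.
Qed.

(** Off a null Borel set, [w] is a limit of simple functions; once it is put to
    zero on that set, its pairings are Borel as limits of simple functions
    everywhere.  The bound [W] comes from [2 r <= 1 + r ^ 2], by which a square
    integrable norm is integrable on a bounded interval. *)
Lemma bochner_representative (T : R) (w : R -> vfield R) : L2time H hnorm T w ->
  exists w' : R -> vfield R, [/\ forall t, H (w' t),
    {ae leb, forall t, 0 < t < T -> w' t = w t},
    forall phi, H phi -> measurable_fun (`]0, T[ : set X1) (fun t => ip (w' t) phi) &
    exists W : R -> R, leb.-integrable `]0, T[ (EFin \o W) /\
      forall t, 0 < t < T -> hnorm (w' t) <= W t].
Proof.
move=> [aeX [s [ss aes]] fin].
have [N1 [mN1 N10 sN1]] := aeX; have [N2 [mN2 N20 sN2]] := aes.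
pose N : set X1 := N1 `|` N2.
have mN : measurable N by exact: measurableU.
have N0 : leb N = 0%E by exact: null_set_setU.
have gX t : ~ N t -> 0 < t < T -> H (w t).
  by move=> Nt tT; apply: contrapT => h; apply: Nt; left; apply: sN1 => /= /(_ tT).
have gs t : ~ N t -> 0 < t < T -> (fun n => hnorm (w t - s n t)) @ \oo --> (0 : R).
  by move=> Nt tT; apply: contrapT => h; apply: Nt; right; apply: sN2 => /= /(_ tT).
pose w' t : vfield R := if (t \notin N) && (0 < t < T) then w t else (fun _ _ => 0).
have Hw' t : H (w' t).
  rewrite /w'; case: ifPn => [/andP[/negP Nt tT]|_]; last exact: H0.
  by apply: gX => // tN; apply: Nt; exact: mem_set.
have ls n t : L2field (s n t).
  by have [k [E [c [_ Xc ->]]]] := ss n; apply: simple_L2 => j; exact: H_L2.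
have ms n phi : L2field phi -> measurable_fun (setT : set X1) (fun t => ip (s n t) phi).
  move=> lphi; have [k [E [c [mE Xc sE]]]] := ss n.
  have -> : (fun t => ip (s n t) phi) = (fun t => \sum_(j < k) \1_(E j) t * ip (c j) phi).
    by apply/funext => t; rewrite sE simple_ip// => j; exact: H_L2.
  apply: measurable_sum => j; apply: measurable_funM => //.
  have mEj : measurable (E j : set X1) by exact: mE.
  exact: (@measurable_indic _ X1 R setT _ mEj).
have mss n : measurable_fun (setT : set X1) (fun t => ip (s n t) (s n t)).
  have [k [E [c [mE Xc sE]]]] := ss n.
  have -> : (fun t => ip (s n t) (s n t)) =
      (fun t => \sum_(j < k) \1_(E j) t * ip (s n t) (c j)).
    apply/funext => t; rewrite {1}sE simple_ip//; last by move=> j; exact: H_L2.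
    by apply: eq_bigr => j _; rewrite ipC.
  apply: measurable_sum => j; apply: measurable_funM.
    have mEj : measurable (E j : set X1) by exact: mE.
    exact: (@measurable_indic _ X1 R setT _ mEj).
  by apply: ms; exact: H_L2.
have ip0 phi : ip (fun _ _ => 0) phi = 0.
  rewrite /ip /int_torus (@eq_Rintegral _ _ _ torus setT (fun=> 0)).
    by rewrite Rintegral_cst// mul0r.
  by move=> z _; rewrite /dot big1// => i _; rewrite mul0r.
have lim (F : nat -> R -> R) (f : R -> R) :
    (forall t, ~ N t -> 0 < t < T -> F ^~ t @ \oo --> f t) ->
    (forall t, N t -> f t = 0) ->
    (forall n, measurable_fun (setT : set X1) (F n)) ->
    measurable_fun (`]0, T[ : set X1) f.
  move=> c f0 mF.
  apply: (@measurable_fun_cvg _ X1 R _ (fun n t => \1_(~` N) t * F n t)).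
    move=> n; apply: measurable_funTS; apply: measurable_funM => //.
    by apply: measurable_indic; exact: measurableC.
  move=> t; rewrite /= in_itv/= => tT; have [tN|tN] := pselect (N t).
    rewrite f0//; apply: cvg_near_cst; apply: nearW => n.
    by rewrite indicE memNset ?mul0r// => /(_ tN).
  have -> : (fun n => \1_(~` N) t * F n t) = F ^~ t.
    by apply/funext => n; rewrite indicE mem_set// mul1r.
  exact: c.
have w'0 t : N t -> w' t = (fun _ _ => 0).
  by move=> tN; rewrite /w' (mem_set tN).
have w'w t : ~ N t -> 0 < t < T -> w' t = w t.
  by move=> tN tT; rewrite /w' tT memNset.
exists w'; split => //.
- exists N; split => // t /= h; apply: contrapT => tN; apply: h => tT; exact: w'w.
- move=> phi hphi; apply: (lim (fun n t => ip (s n t) phi)).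
  + move=> t tN tT; rewrite w'w//; apply: ip_cvg => //; [|exact: H_L2|exact: gs].
    by apply: H_L2; exact: gX.
  + by move=> t tN; rewrite w'0.
  + by move=> n; apply: ms; exact: H_L2.
have mw2 : measurable_fun (`]0, T[ : set X1) (fun t => ip (w' t) (w' t)).
  apply: (lim (fun n t => ip (s n t) (s n t))) => //.
  + move=> t tN tT; rewrite w'w//; have lw : L2field (w t) by apply: H_L2; exact: gX.
    have c := hnorm_cvg lw (ls ^~ t) (gs t tN tT).
    have -> : (fun n => ip (s n t) (s n t)) = (fun n => hnorm (s n t) * hnorm (s n t)).
      by apply/funext => n; rewrite -hnorm_sqr// expr2.
    by rewrite -hnorm_sqr// expr2; exact: cvgM.
  + by move=> t tN; rewrite w'0.
have i2 : leb.-integrable `]0, T[ (EFin \o (fun t => ip (w' t) (w' t))).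
  apply/integrableP; split; first exact/measurable_EFinP.
  apply: le_lt_trans fin; rewrite le_eqVlt; apply/orP; left; apply/eqP.
  apply: ae_integral; exists N; split => // t /= h; apply: contrapT => tN; apply: h.
  rewrite in_itv/= => tT; rewrite w'w// ger0_norm -hnorm_sqr ?sqr_ge0//;
    by apply: H_L2; exact: gX.
exists (fun t => 2^-1 * (1 + ip (w' t) (w' t))); split.
  apply: itgZ; first exact: measurable_itv.
  apply: itgD => //; apply: (@integrableS _ _ _ leb `[0, T]) => //.
    exact: subset_itv_oo_cc.
  apply: continuous_compact_integrable; first exact: segment_compact.
  by apply: continuous_subspaceT; exact: cst_continuous.
move=> t _; rewrite -hnorm_sqr; last exact: H_L2.
by have := sqr_ge0 (hnorm (w' t) - 1); nra.
Qed.
End Bochner.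

(** * Absolutely continuous curves in H *)

Section Decay.
Context {R : realType}.
Local Notation X1 := (measurableTypeR R).
Local Notation torus := (@torus R).
Local Notation leb := (@lebesgue_measure R).
Implicit Types (u v w phi : vfield R) (e we : R -> vfield R).

(** The integral of [g - f] is that of its absolute value. *)
Lemma ae_le_Rintegral (f g : R -> R) (D : set X1) : measurable D ->
  leb.-integrable D (EFin \o f) -> leb.-integrable D (EFin \o g) ->
  {ae leb, forall x, D x -> f x <= g x} ->
  \int[leb]_(x in D) f x <= \int[leb]_(x in D) g x.
Proof.
move=> mD fi gi fg; rewrite -subr_ge0 -RintegralB//.
rewrite (@ae_Rintegral _ X1 R leb _ (fun x => `|g x - f x|)).
  by apply: Rintegral_ge0 => x _; exact: normr_ge0.
have [N [mN N0 sN]] := fg; exists N; split => // x /= h; apply: sN => /= k.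
by apply: h => Dx; rewrite ger0_norm// subr_ge0 k.
Qed.

(** Let [s] be the supremum of the times at which [G] is at most [G a].  The
    condition at [s] transfers the bound from such a time to the left of [s] to
    [s] itself, and then to times beyond [s] unless [s = b]. *)
Lemma local_decrease (a b : R) (G : R -> R) : a <= b ->
  (forall t, a <= t <= b -> exists2 d, 0 < d & forall s1 s2,
     a <= s1 -> s1 <= t -> t <= s2 -> s2 <= b -> t - d < s1 -> s2 < t + d -> G s2 <= G s1) ->
  G b <= G a.
Proof.
move=> ab loc; pose S := [set t | a <= t <= b /\ G t <= G a].
have Sa : S a by rewrite /S /= lexx ab.
have hS : has_sup S by split; [exists a|exists b => t [/andP[]]].
have sa : a <= sup S by apply: ub_le_sup => //; case: hS.
have sb : sup S <= b by apply: ge_sup; [exists a|move=> t [/andP[]]].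
have [|d d0 hd] := loc (sup S); first by rewrite sa.
have [t [/andP[at_ tb] Gt]] := sup_adherent d0 hS.
move=> dt; have ts : t <= sup S by apply: ub_le_sup; [case: hS|split => //; rewrite at_].
have : S (Num.min b (sup S + d / 2)).
  have h2 : 0 < d / 2 by rewrite divr_gt0.
  have h1 : sup S <= Num.min b (sup S + d / 2) by rewrite le_min sb lerDl ltW.
  split; first by rewrite (le_trans sa h1) ge_min lexx.
  apply: le_trans Gt; apply: hd => //; first by rewrite ge_min lexx.
  by rewrite gt_min; apply/orP; right; rewrite ltrD2l gtr_pMr// invf_lt1// ltr1n.
move=> Sm; have := ub_le_sup (proj2 hS) Sm.
rewrite ge_min => /orP[bs|]; last by rewrite gerDl leNgt divr_gt0.
have sE : sup S = b by apply/le_anti/andP.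
by case: Sm => _; rewrite sE (min_idPl _)// lerDl divr_ge0// ltW.
Qed.

(** Absolute continuity in H in a weak form: the increments are integrals only
    after pairing with a fixed field.  This is what a distributional derivative
    gives, and the bound [W] on the norm of the derivative makes up for it. *)
Record accurve (T : R) e we (W : R -> R) : Prop := ACCurve {
  ac_H : forall t, 0 <= t <= T -> H (e t);
  ac_continuous : forall s, 0 <= s <= T ->
    (fun t => hnorm (e t - e s)) @ within `[0, T] (nbhs s) --> (0 : R);
  ac_dH : forall t, H (we t);
  ac_measurable : forall phi, H phi ->
    measurable_fun (`]0, T[ : set X1) (fun t => ip (we t) phi);
  ac_bound : leb.-integrable `]0, T[ (EFin \o W);
  ac_le : forall t, 0 < t < T -> hnorm (we t) <= W t;
  ac_increment : forall phi a b, H phi -> 0 < a -> a <= b -> b < T ->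
    ip (e b - e a) phi = \int[leb]_(t in `]a, b]) ip (we t) phi }.

Lemma ac_integrable T e we W phi : accurve T e we W -> H phi ->
  leb.-integrable `]0, T[ (EFin \o (fun t => ip (we t) phi)).
Proof.
move=> C hphi; apply: (@itg_le _ X1 R leb _ _ (fun t => hnorm phi * W t)).
- exact: measurable_itv.
- exact: (ac_measurable C).
- move=> t; rewrite /= in_itv /= => tT.
  apply: le_trans (ip_CS (H_L2 (ac_dH C t)) (H_L2 hphi)) _.
  by rewrite mulrC ler_wpM2l ?hnorm_ge0// (ac_le C).
- by apply: itgZ; [exact: measurable_itv|exact: (ac_bound C)].
Qed.

Let sub_exchange (a b c d : vfield R) : a - b - (c - d) = a - c - (b - d).
Proof. by rewrite !opprB addrACA [- b - c]addrC addrACA. Qed.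

Lemma accurve_sub T e we W e' we' W' : accurve T e we W -> accurve T e' we' W' ->
  accurve T (fun t => e t - e' t) (fun t => we t - we' t) (fun t => W t + W' t).
Proof.
move=> C C'; split.
- by move=> t tT; apply: H_B; [exact: (ac_H C)|exact: (ac_H C')].
- move=> s sT; have h : (fun t => hnorm (e t - e s) + hnorm (e' t - e' s)) @ within `[0, T] (nbhs s) --> (0 : R).
    by rewrite -[X in _ --> X]addr0; apply: cvgD; [exact: (ac_continuous C)|exact: (ac_continuous C')].
  apply: (squeeze_cvgr _ (cvg_cst 0) h).
  rewrite near_withinE; apply: nearW => t /=; rewrite in_itv /= => tT; rewrite hnorm_ge0 /=.
  have l1 := L2field_B (H_L2 (ac_H C tT)) (H_L2 (ac_H C sT)).
  have l2 := L2field_B (H_L2 (ac_H C' sT)) (H_L2 (ac_H C' tT)).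
  have := hnorm_triangle l1 l2; rewrite -(hnorm_N (e' s - e' t)) opprB.
  by rewrite -[e' s - e' t]opprB sub_exchange.
- by move=> t; apply: H_B; [exact: (ac_dH C)|exact: (ac_dH C')].
- move=> phi hphi; have := measurable_funB (ac_measurable C hphi) (ac_measurable C' hphi).
  apply: eq_measurable_fun => t _ /=; rewrite ipBl//; apply: H_L2 => //;
    [exact: (ac_dH C)|exact: (ac_dH C')].
- by apply: itgD; [exact: measurable_itv|exact: (ac_bound C)|exact: (ac_bound C')].
- move=> t tT; have l := H_L2 (ac_dH C t); have l' := H_L2 (ac_dH C' t).
  have lN : L2field (- we' t) by move=> i; exact: l2N (l' i).
  apply: le_trans (hnorm_triangle l lN) _; rewrite hnorm_N.
  by apply: lerD; [exact: (ac_le C)|exact: (ac_le C')].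
- move=> phi a b hphi a0 ab bT; have aT := le_lt_trans ab bT; have b0 := lt_le_trans a0 ab.
  have aI : 0 <= a <= T by rewrite !ltW.
  have bI : 0 <= b <= T by rewrite !ltW.
  have sub : `]a, b] `<=` `]0, T[.
    by move=> t /=; rewrite !in_itv /= => /andP[h1 h2]; rewrite (lt_trans a0)//= (le_lt_trans h2).
  have iS f : leb.-integrable `]0, T[ (EFin \o f) -> leb.-integrable `]a, b] (EFin \o f).
    by apply: integrableS => //; exact: measurable_itv.
  have i1 := iS _ (ac_integrable C hphi); have i2 := iS _ (ac_integrable C' hphi).
  rewrite (@eq_Rintegral _ _ _ leb `]a, b] (fun t => ip (we t) phi - ip (we' t) phi)); last first.
    by move=> t _; rewrite ipBl//; apply: H_L2 => //; [exact: (ac_dH C)|exact: (ac_dH C')].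
  rewrite RintegralB//.
  rewrite -(ac_increment C)// -(ac_increment C')//.
  rewrite -ipBl; [|by apply: L2field_B; apply: H_L2; apply: (ac_H C)
    |by apply: L2field_B; apply: H_L2; apply: (ac_H C')|exact: H_L2].
  by rewrite sub_exchange.
Qed.

Section FromStrong.
Variable lambda1 : R.
Hypothesis lambda1_gt0 : 0 < lambda1.
Hypothesis poincare : forall w, V w -> lambda1 * hnorm w ^+ 2 <= vnorm w ^+ 2.

Lemma CtimeV_hnorm T (u : R -> vfield R) : CtimeV T u -> forall s, 0 <= s <= T ->
  (fun t => hnorm (u t - u s)) @ within `[0, T] (nbhs s) --> (0 : R).
Proof.
move=> [hV hc] s sT; have l0 : 0 < Num.sqrt lambda1 by rewrite sqrtr_gt0.
have h : (fun t => (Num.sqrt lambda1)^-1 * vnorm (u t - u s)) @ within `[0, T] (nbhs s) --> (0 : R).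
  by rewrite -[X in _ --> X](mulr0 (Num.sqrt lambda1)^-1); apply: cvgMr; exact: hc.
apply: (squeeze_cvgr _ (cvg_cst 0) h).
rewrite near_withinE; apply: nearW => t /=; rewrite in_itv /= => tT; rewrite hnorm_ge0 /=.
rewrite ler_pdivlMl// -(@ler_pXn2r _ 2)// ?nnegrE ?mulr_ge0 ?hnorm_ge0 ?vnorm_ge0 ?(ltW l0)//.
by rewrite exprMn sqr_sqrtr ?(ltW lambda1_gt0)//; apply: poincare; apply: V_B; exact: hV.
Qed.

Lemma strong_accurve T (u w : R -> vfield R) : 0 < T -> CtimeV T u -> L2time H hnorm T w ->
  is_time_derivative T u w -> exists we W, accurve T u we W /\
    {ae leb, forall t, 0 < t < T -> we t = w t}.
Proof.
move=> T0 hC hw hd; have [we [Hwe aew mwe [W [iW leW]]]] := bochner_representative hw.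
exists we, W; split => //.
have cu := CtimeV_hnorm hC.
have Hu t : 0 <= t <= T -> H (u t) by move=> tT; case: hC => /(_ t tT)[].
have iwe phi : H phi -> leb.-integrable `]0, T[ (EFin \o (fun t => ip (we t) phi)).
  move=> hphi; apply: (@itg_le _ X1 R leb _ _ (fun t => hnorm phi * W t)).
  - exact: measurable_itv.
  - exact: mwe.
  - move=> t; rewrite /= in_itv /= => tT.
    apply: le_trans (ip_CS (H_L2 (Hwe t)) (H_L2 hphi)) _.
    by rewrite mulrC ler_wpM2l ?hnorm_ge0// leW.
  - by apply: itgZ => //; exact: measurable_itv.
split => // phi a b hphi a0 ab bT.
have aT := le_lt_trans ab bT; have b0 := lt_le_trans a0 ab.
rewrite ipBl; [|by apply: H_L2; apply: Hu; rewrite !ltW..|exact: H_L2].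
apply: (@weak_increment _ T T0 (fun t => ip (u t) phi)) => //.
- apply/subspace_continuousP => s; rewrite /= in_itv /= => sT.
  have h : (fun t => hnorm (u t - u s) * hnorm phi) @ within `[0, T] (nbhs s) --> (0 : R).
    by rewrite -[X in _ --> X](mul0r (hnorm phi)); apply: cvgMl; exact: cu.
  suff : (fun t => ip (u t) phi) @ within `[0, T] (nbhs s) --> ip (u s) phi by [].
  apply/cvgrPdist_lt => eps eps0; have /cvgrPdist_lt/(_ _ eps0) := h.
  rewrite !near_withinE; apply: filterS => t hlt /[dup] tI /hlt /=.
  rewrite sub0r normrN; apply: le_lt_trans; rewrite distrC.
  move: tI; rewrite /= in_itv /= => tT.
  have lt := H_L2 (Hu _ tT); have ls := H_L2 (Hu _ sT); have lphi := H_L2 hphi.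
  rewrite -ipBl//; apply: le_trans (ip_CS (L2field_B lt ls) lphi) _.
  exact: ler_norm.
- exact: iwe.
- move=> psi hpsi; rewrite (hd psi hpsi phi hphi); congr (- _).
  apply: ae_Rintegral; have [N [mN N0 sN]] := aew; exists N; split => // t /= h; apply: sN => /= k.
  by apply: h; rewrite in_itv /= => tT; rewrite k.
Qed.

End FromStrong.

End Decay.

(** * Decay of the energy *)

Section EnergyDecay.
Context {R : realType}.
Local Notation X1 := (measurableTypeR R).
Local Notation leb := (@lebesgue_measure R).
Implicit Types (e we : R -> vfield R).

Lemma H_D (u v : vfield R) : H u -> H v -> H (u + v).
Proof.
move=> hu hv; have := H_lin 1 hu hv; rewrite (_ : (fun i z => _) = u + v)//.
by apply/funext => i; apply/funext => z; rewrite mul1r.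
Qed.

Lemma itg_cst_itv (a b K : R) : leb.-integrable `]a, b] (EFin \o (fun=> K)).
Proof.
apply: (@integrableS _ _ _ leb `[a, b]) => //; first exact: subset_itv_oc_cc.
apply: continuous_compact_integrable; first exact: segment_compact.
by apply: continuous_subspaceT; exact: cst_continuous.
Qed.

Lemma ac_hnorm_cvg T e we W t : accurve T e we W -> 0 <= t <= T ->
  (fun r => hnorm (e r)) @ within `[0, T] (nbhs t) --> hnorm (e t).
Proof.
move=> C tT; have c := ac_continuous C tT.
apply/cvgrPdist_lt => eps eps0; have /cvgrPdist_lt/(_ _ eps0) := c.
rewrite !near_withinE; apply: filterS => r hlt /[dup] tI /hlt /=.
rewrite sub0r normrN ger0_norm ?hnorm_ge0//; apply: le_lt_trans; rewrite distrC.
move: tI; rewrite /= in_itv /= => rT.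
exact: hnorm_dist (H_L2 (ac_H C rT)) (H_L2 (ac_H C tT)).
Qed.

Lemma ac_near T e we W t w : accurve T e we W -> 0 <= t <= T -> 0 < w ->
  exists2 d, 0 < d & forall r, 0 <= r <= T -> `|t - r| < d ->
    hnorm (e r - e t) < w /\ `|hnorm (e t) ^+ 2 - hnorm (e r) ^+ 2| < w.
Proof.
move=> C tT w0; have c := ac_continuous C tT.
have cn := ac_hnorm_cvg C tT.
have c2 : (fun r => hnorm (e r) * hnorm (e r)) @ within `[0, T] (nbhs t) --> hnorm (e t) * hnorm (e t).
  exact: cvgM.
have /cvgrPdist_lt/(_ _ w0) := c; have /cvgrPdist_lt/(_ _ w0) := c2.
rewrite !near_withinE => /nbhs_ballP[d1 /= d10 h1] /nbhs_ballP[d2 /= d20 h2].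
exists (Num.min d1 d2); first by rewrite lt_min d10.
move=> r rT; rewrite lt_min => /andP[r1 r2].
have rI : `[0, T]%classic r by rewrite /= in_itv.
have := h1 _ r1 rI; have := h2 _ r2 rI; rewrite /= sub0r normrN ger0_norm ?hnorm_ge0//.
Qed.

(** [|y|^2 - |x|^2 = <y - x, x + y>]: the weak increment formula applies with the
    fixed field [e s1 + e s2], and no product rule is involved. *)
Lemma ac_increment_sqr T e we W s1 s2 : accurve T e we W ->
  0 < s1 -> s1 <= s2 -> s2 < T ->
  hnorm (e s2) ^+ 2 - hnorm (e s1) ^+ 2 =
  \int[leb]_(r in `]s1, s2]) ip (we r) (e s1 + e s2).
Proof.
move=> C s10 s12 s2T; have s1T := le_lt_trans s12 s2T; have s20 := lt_le_trans s10 s12.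
have h1 : H (e s1) by apply: (ac_H C); rewrite !ltW.
have h2 : H (e s2) by apply: (ac_H C); rewrite !ltW.
have l1 := H_L2 h1; have l2 := H_L2 h2.
rewrite -(ac_increment C)//; last exact: H_D.
rewrite ipBl//; last exact: L2field_D.
rewrite !ipDr// (ipC (e s2) (e s1)) !hnorm_sqr//.
have ar (x y z : R) : x - z = y + x - (z + y) by ring.
exact: ar.
Qed.

(** On a short interval around [t] the curve varies by less than [2 w], so that
    [<we r, e s1 + e s2>] differs from [2 <we r, e r>] by at most [4 w W r], and the
    differential inequality applies to the latter. *)
Lemma ac_decay_step T e we W c t0 : accurve T e we W -> 0 <= c -> 0 <= t0 ->
  {ae leb, forall t, t0 < t < T -> 2 * ip (we t) (e t) <= - c * hnorm (e t) ^+ 2} ->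
  forall t w, t0 < t < T -> 0 < w -> exists2 d, 0 < d & forall s1 s2,
    t0 < s1 -> s1 <= t -> t <= s2 -> s2 < T -> t - d < s1 -> s2 < t + d ->
    hnorm (e s2) ^+ 2 - hnorm (e s1) ^+ 2 <=
      (- c * hnorm (e s2) ^+ 2 + 2 * c * w) * (s2 - s1)
      + 4 * w * \int[leb]_(r in `]s1, s2]) W r /\
    hnorm (e s1) ^+ 2 - hnorm (e s2) ^+ 2 <= 2 * w.
Proof.
move=> C c0 t00 ineq t w /andP[t0t tT] w0.
have t0' := le_lt_trans t00 t0t.
have tI : 0 <= t <= T by rewrite !ltW.
have [d d0 hd] := ac_near C tI w0; exists d => // s1 s2 ts1 s1t ts2 s2T ds1 ds2.
have s12 := le_trans s1t ts2.
have hI r : s1 <= r <= s2 -> [/\ 0 < r < T, H (e r), hnorm (e r - e t) < w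
    & `|hnorm (e t) ^+ 2 - hnorm (e r) ^+ 2| < w].
  move=> /andP[r1 r2]; have r0 : 0 < r by apply: lt_le_trans r1; exact: le_lt_trans ts1.
  have rT := le_lt_trans r2 s2T; have rI : 0 <= r <= T by rewrite !ltW.
  have [] := hd r rI.
    by rewrite ltr_norml; apply/andP; split; lra.
  by split => //; [rewrite r0|exact: (ac_H C)].
have [|s10 hs1 n1 q1] := hI s1; first by rewrite lexx.
have [|s20 hs2 n2 q2] := hI s2; first by rewrite lexx s12.
have near2 (x y z : R) : `|x - y| < w -> `|x - z| < w -> y - z <= 2 * w.
  by rewrite !ltr_norml => /andP[? ?] /andP[? ?]; lra.
split; last exact: near2 q1 q2.
have ht := ac_H C tI.
rewrite (ac_increment_sqr C)//; last by case/andP: s10.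
pose K := - c * hnorm (e s2) ^+ 2 + 2 * c * w.
have sub : `]s1, s2] `<=` `]0, T[.
  move=> r /=; rewrite !in_itv /= => /andP[h1 h2].
  by rewrite (lt_trans _ h1) ?(le_lt_trans h2)//; case/andP: s10.
have iS f : leb.-integrable `]0, T[ (EFin \o f) -> leb.-integrable `]s1, s2] (EFin \o f).
  by apply: integrableS => //; exact: measurable_itv.
have iW := iS _ (ac_bound C).
have iW4 : leb.-integrable `]s1, s2] (EFin \o (fun r => 4 * w * W r)).
  by apply: itgZ => //; exact: measurable_itv.
have iK : leb.-integrable `]s1, s2] (EFin \o (fun=> K)) by exact: itg_cst_itv.
have -> : K * (s2 - s1) + 4 * w * \int[leb]_(r in `]s1, s2]) W r =
   \int[leb]_(r in `]s1, s2]) (K + 4 * w * W r).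
  rewrite RintegralD// Rintegral_cst// RintegralZl//; congr (_ * _ + _).
  rewrite [X in fine X](lebesgue_measure_itv `]s1, s2]) /= lte_fin; case: ltP => //= s21.
  by rewrite (le_anti (introT andP (conj s12 s21))) subrr.
apply: ae_le_Rintegral.
- exact: measurable_itv.
- by apply: iS; apply: (ac_integrable C); exact: H_D.
- by apply: itgD => //; exact: measurable_itv.
have [N [mN N0 sN]] := ineq; exists N; split => // r /= h; apply: sN => /= k.
apply: h; rewrite in_itv /= => /andP[r1 r2].
have [|r0 hr nr qr] := hI r; first by rewrite ltW.
have {}k : 2 * ip (we r) (e r) <= - c * hnorm (e r) ^+ 2.
  by apply: k; rewrite (lt_trans ts1 r1); case/andP: r0.
have hw := ac_dH C r; have lw := H_L2 hw; have lr := H_L2 hr.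
have bnd x : H (e x) -> hnorm (e x - e t) < w -> ip (we r) (e x) - ip (we r) (e r) <= 2 * w * W r.
  move=> hx nx; have lx := H_L2 hx; rewrite -ipBr//.
  have lxr := L2field_B lx lr.
  apply: le_trans (ler_norm _) _; apply: le_trans (ip_CS lw lxr) _.
  rewrite mulrC; apply: ler_pM; rewrite ?hnorm_ge0//; last by apply: (ac_le C).
  have := hnorm_triangle (L2field_B lx (H_L2 ht)) (L2field_B (H_L2 ht) lr).
  rewrite subrKA -(hnorm_N (e t - e r)) opprB => tri; apply: le_trans tri _.
  have ar (y z : R) : y < w -> z < w -> y + z <= 2 * w by move=> *; lra.
  exact: ar.
rewrite ipDr//; [|exact: H_L2..].
have b1 := bnd s1 hs1 n1; have b2 := bnd s2 hs2 n2.
have qq : hnorm (e s2) ^+ 2 - hnorm (e r) ^+ 2 <= 2 * w by exact: near2 q2 qr.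
rewrite /K.
have ar (p1 p2 p E2 E Wr : R) : 2 * p <= - c * E -> p1 - p <= 2 * w * Wr ->
   p2 - p <= 2 * w * Wr -> E2 - E <= 2 * w -> p1 + p2 <= - c * E2 + 2 * c * w + 4 * w * Wr.
  by move=> a1 a2 a3 a4; have := ler_wpM2l c0 a4; lra.
exact: (ar _ _ _ _ _ _ k b1 b2 qq).
Qed.

(** Over a short interval, [exp (c t) |e t|^2] increases by at most [w] times the
    increment of a function of time that does not depend on [w].  So its
    increase over the whole interval is at most [w M] for every positive [w]. *)
Lemma ac_decay_pos T e we W c t0 : accurve T e we W -> 0 <= c -> 0 <= t0 ->
  {ae leb, forall t, t0 < t < T -> 2 * ip (we t) (e t) <= - c * hnorm (e t) ^+ 2} ->
  forall a b, t0 < a -> a <= b -> b < T ->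
  expR (c * b) * hnorm (e b) ^+ 2 <= expR (c * a) * hnorm (e a) ^+ 2.
Proof.
move=> C c0 t00 ineq a b t0a ab bT.
have a0 := le_lt_trans t00 t0a.
pose I s t := \int[leb]_(r in `]s, t]) W r.
have iW s t : 0 < s -> t < T -> leb.-integrable `]s, t] (EFin \o W).
  move=> s0 tT; apply: (integrableS _ _ _ (ac_bound C)); [exact: measurable_itv..|].
  move=> r /=; rewrite !in_itv /= => /andP[h1 h2].
  by rewrite (lt_trans _ h1)// (le_lt_trans h2).
have I0 s t : 0 < s -> t < T -> 0 <= I s t.
  move=> s0 tT; apply: Rintegral_ge0 => r; rewrite /= in_itv /= => /andP[h1 h2].
  apply: le_trans (hnorm_ge0 (we r)) _; apply: (ac_le C).
  by rewrite (lt_trans s0 h1) (le_lt_trans h2).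
have IB s t : a <= s -> s <= t -> t <= b -> I a t - I a s = I s t.
  move=> as_ st tb; apply: Rintegral_itvB; [|by rewrite bnd_simp..].
  by apply: iW => //; exact: le_lt_trans bT.
pose M := 4 * expR (c * T) * (c * (b - a) + I a b).
have M0 : 0 <= M.
  rewrite mulr_ge0 ?mulr_ge0 ?expR_ge0// addr_ge0 ?I0// mulr_ge0// subr_ge0//.
apply/ler_addgt0Pr => eps eps0.
pose w := eps / (M + 1).
have w0 : 0 < w by rewrite divr_gt0// ltr_wpDl.
have wM : w * M <= eps.
  by rewrite /w mulrAC ler_pdivrMr ?ltr_wpDl// ler_wpM2l ?lerDl// ltW.
pose G t := expR (c * t) * hnorm (e t) ^+ 2 - w * (4 * expR (c * T) * (c * t + I a t)).
have : G b <= G a.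
  apply: local_decrease => // t /andP[at_ tb].
  have [|d d0 hd] := ac_decay_step C c0 t00 ineq (t := t) _ w0.
    by rewrite (lt_le_trans t0a)// (le_lt_trans tb).
  exists d => // s1 s2 as1 s1t ts2 s2b ds1 ds2.
  have s12 := le_trans s1t ts2; have s2T := le_lt_trans s2b bT.
  have [||h1 h2] := hd s1 s2 _ s1t ts2 _ ds1 ds2; [exact: lt_le_trans as1|by []|].
  have i12 := IB s1 s2 as1 s12 s2b.
  have i120 : 0 <= I s1 s2 by apply: I0 => //; exact: lt_le_trans as1.
  have e12 : expR (c * s2) - expR (c * s1) <= expR (c * s2) * (c * (s2 - s1)).
    have := expR_ge1Dx (c * s1 - c * s2); rewrite expRB.
    rewrite -(@ler_pM2l _ (expR (c * s2))) ?expR_gt0//.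
    rewrite [X in _ <= X]mulrC divfK ?gt_eqF ?expR_gt0// => h; lra.
  have eT : expR (c * s2) <= expR (c * T) by rewrite ler_expR ler_wpM2l// ltW.
  rewrite /G -/(I _ _).
  have ar (x1 x2 xT E1 E2 J h J1 J2 : R) : 0 <= h -> 0 <= J -> 0 <= x2 -> x2 <= xT -> 0 <= E1 ->
    x2 - x1 <= x2 * (c * h) -> E2 - E1 <= (- c * E2 + 2 * c * w) * h + 4 * w * J ->
    E1 - E2 <= 2 * w -> h = s2 - s1 -> J2 - J1 = J ->
    x2 * E2 - w * (4 * xT * (c * s2 + J2)) <= x1 * E1 - w * (4 * xT * (c * s1 + J1)).
    move=> h0 J0 x20 xT2 E10 b1 b2 b3 hh JJ.
    have k1 := ler_wpM2r E10 b1.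
    have k2 := ler_wpM2l x20 b2.
    have k3 := ler_wpM2l (mulr_ge0 x20 (mulr_ge0 c0 h0)) b3.
    have k4 : x2 * (4 * w * (c * h + J)) <= xT * (4 * w * (c * h + J)).
      apply: ler_wpM2r => //; apply: mulr_ge0; first by apply: mulr_ge0 => //; exact: ltW.
      by rewrite addr_ge0// mulr_ge0.
    have k5 : xT * (4 * w * (c * h + J)) = w * (4 * xT * (c * s2 + J2)) - w * (4 * xT * (c * s1 + J1)).
      by rewrite -JJ hh; ring.
    lra.
  apply: (ar _ _ _ _ _ (I s1 s2) (s2 - s1)) => //; rewrite ?subr_ge0 ?expR_ge0 ?sqr_ge0//.
rewrite /G.
have ar (x y J JJ : R) : JJ = 0 -> x - w * (4 * expR (c * T) * (c * b + J)) <= y - w * (4 * expR (c * T) * (c * a + JJ)) ->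
   w * (4 * expR (c * T) * (c * (b - a) + J)) <= eps -> x <= y + eps.
  by move=> ->; lra.
move=> /ar h; apply: h wM.
by rewrite /I set_itv_ge ?bnd_simp ?ltxx// Rintegral_set0.
Qed.

(** The estimate between two later times extends to [t0] by continuity. *)
Lemma ac_decay T e we W c t0 : accurve T e we W -> 0 <= c -> 0 <= t0 ->
  {ae leb, forall t, t0 < t < T -> 2 * ip (we t) (e t) <= - c * hnorm (e t) ^+ 2} ->
  forall t, t0 <= t < T ->
  hnorm (e t) ^+ 2 <= expR (- c * (t - t0)) * hnorm (e t0) ^+ 2.
Proof.
move=> C c0 t00 ineq t /andP[]; rewrite le_eqVlt => /orP[/eqP <- _|t0t tT].
  by rewrite subrr mulr0 expR0 mul1r.
suff h : expR (c * t) * hnorm (e t) ^+ 2 <= expR (c * t0) * hnorm (e t0) ^+ 2.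
  rewrite (_ : - c * (t - t0) = c * t0 - c * t); last by ring.
  by rewrite expRB mulrAC ler_pdivlMr ?expR_gt0// mulrC.
have t0T : 0 <= t0 <= T by rewrite t00 ltW// (lt_trans t0t).
have cE := ac_hnorm_cvg C t0T.
have cx : (fun s => expR (c * s)) @ within `[0, T] (nbhs t0) --> expR (c * t0).
  apply: cvg_within_filter; apply: (@continuous_comp _ _ _ (fun s => c * s) expR); last exact: continuous_expR.
  by apply: (@continuousM _ _ (fun=> c) id); [exact: cst_continuous|exact: cvg_id].
have cF : (fun s => expR (c * s) * (hnorm (e s) * hnorm (e s))) @ within `[0, T] (nbhs t0) -->
    expR (c * t0) * (hnorm (e t0) * hnorm (e t0)).
  by apply: cvgM => //; exact: cvgM.
rewrite [X in _ <= _ * X]expr2.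
have cR : (fun s => expR (c * s) * (hnorm (e s) * hnorm (e s))) @ t0^'+ -->
    expR (c * t0) * (hnorm (e t0) * hnorm (e t0)).
  apply: cvg_trans cF; apply: cvg_app => P hP.
  have {}hP : nbhs t0 [set x | x \in `[0, T] -> P x] by exact: hP.
  suff : nbhs t0 [set x | t0 < x -> P x] by [].
  apply: filterS2 hP (lt_nbhsl t0t) => x /= hx xt t0x; apply: hx.
  by rewrite in_itv /= (le_trans t00 (ltW t0x)) (ltW (lt_trans xt tT)).
apply: (cvgr_to_ge cR).
near=> s; rewrite -expr2; apply: (ac_decay_pos C c0 t00 ineq) => //.
by near: s; exact: nbhs_right_le.
Unshelve. all: by end_near. Qed.

End EnergyDecay.

(** * The pointwise differential inequality *)

Section Pointwise.
Context {R : realType}.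
Local Notation X1 := (measurableTypeR R).
Local Notation torus := (@torus R).
Local Notation leb := (@lebesgue_measure R).
Implicit Types (e u v : vfield R).

(** The multiple [(a + 1) e] is written as a linear combination, the form in which
    [V] is known to be stable. *)
Lemma vnorm_scale (a : R) e : V e ->
  vnorm (fun i z => a * e i z + e i z) ^+ 2 = (a + 1) ^+ 2 * vnorm e ^+ 2.
Proof.
move=> he; have [_ h1e] := he; have [_ h1s] := V_lin a he he.
apply: (etrans (vnorm_sqr h1s)).
apply: (etrans _ (congr1 (fun x => (a + 1) ^+ 2 * x) (esym (vnorm_sqr h1e)))).
rewrite mulr_sumr; apply: eq_bigr => i _.
rewrite mulr_sumr; apply: eq_bigr => j _.
have [_ /(_ j)[_ lw]] := h1e i.
rewrite /nsq -RintegralZl//; last exact: l2_sqr lw.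
apply: ae_Rintegral; apply: filterS (wd_lin j a (h1e i) (h1e i)) => z -> _.
by rewrite -exprMn mulrDl mul1r.
Qed.

Let large_multiple (nu a q : R) :
  0 < nu -> 0 < a -> 0 < q -> a * q = nu -> (a + 1) ^+ 2 * q <= nu / 4 -> False.
Proof.
move=> nu0 a0 q0 aq; rewrite expr2.
by have := mulr_gt0 (mulr_gt0 a0 a0) q0; lra.
Qed.

Let negative_coefficient (nu C g n : R) : 0 < nu -> 0 < g -> 0 < n -> C < 0 ->
  (forall a, 0 <= nu / 4 * g + C / nu * ((a + 1) ^+ 2 * g) * n) -> False.
Proof.
move=> nu0 g0 n0 Cn; pose q : R := - (C / nu) * n.
have q0 : 0 < q by rewrite mulr_gt0// oppr_gt0 pmulr_llt0// invr_gt0.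
move=> /(_ (nu / q)).
have -> : nu / 4 * g + C / nu * ((nu / q + 1) ^+ 2 * g) * n =
    (nu / 4 - (nu / q + 1) ^+ 2 * q) * g.
  by rewrite [in RHS]/q; ring.
rewrite pmulr_lge0// subr_ge0; apply: large_multiple => //; first exact: divr_gt0.
by rewrite divfK ?gt_eqF.
Qed.

Section Estimate.
Variables (nu lambda1 Cnl Cfr U1 eta Ceta c1 mu h : R).
Variables (m : vfield R) (Ih : torusfun R -> torusfun R).
Hypotheses (nu_gt0 : 0 < nu) (lambda1_gt0 : 0 < lambda1) (mu_gt0 : 0 < mu).
Hypothesis poincare : forall e, V e -> lambda1 * hnorm e ^+ 2 <= vnorm e ^+ 2.
Hypothesis nonlinear : forall e w, V e -> V w ->
  `|trilinear e w e| <=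
    nu / 4 * vnorm e ^+ 2 + Cnl / nu * vnorm w ^+ 2 * hnorm e ^+ 2.

(** With a negative [Cnl], taking large multiples of [e] for [w] in the bound on
    the trilinear form would make its right-hand side negative.  For a
    nonnegative [Cnl] that bound is monotone in the norm of [w]. *)
Lemma nonlinear_sign e : V e -> Cnl < 0 -> hnorm e ^+ 2 = 0.
Proof.
move=> he Cn; apply/eqP; apply: contrapT => /negP n0.
have n_gt0 : 0 < hnorm e ^+ 2 by rewrite lt0r n0 sqr_ge0.
have g_gt0 : 0 < vnorm e ^+ 2 by apply: lt_le_trans (poincare he); exact: mulr_gt0.
apply: (negative_coefficient nu_gt0 g_gt0 n_gt0 Cn) => a.
rewrite -(vnorm_scale a he).
exact: le_trans (normr_ge0 _) (nonlinear he (V_lin a he he)).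
Qed.

Hypothesis friction : forall e, V e ->
  H1 (dot e m) /\ H1norm (dot e m) ^+ 2 <= Cfr * vnorm e ^+ 2.
Hypothesis etaL : Cnl / nu * U1 ^+ 2 * eta <= nu / 4.
Hypothesis kernel_bound : forall e, V e ->
  hnorm e ^+ 2 <= Ceta * L2norm (dot e m) ^+ 2 + eta * vnorm e ^+ 2.
Hypothesis I_L2 : forall f, L2 f -> L2 (Ih f).
Hypothesis I_approx : forall f, H1 f -> L2norm (f - Ih f) <= c1 * h * gradnorm f.
Hypothesis mu_low : 2 * (Cnl / nu * U1 ^+ 2) * Ceta <= mu.
Hypothesis mu_up : c1 ^+ 2 * Cfr * mu * h ^+ 2 <= nu / 4.

Let feedback_arith (P D J S g : R) :
  D <= c1 ^+ 2 * h ^+ 2 * (Cfr * g) -> J = P + D - 2 * (P - S) -> 0 <= J ->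
  0 <= g -> - mu * S <= - (mu / 2) * P + nu / 8 * g.
Proof.
move=> h1' h2' h3' h4'; have := ler_wpM2r h4' mu_up.
by have := ler_wpM2l (ltW mu_gt0) h1'; have := mulr_ge0 (ltW mu_gt0) h3'; rewrite h2'; lra.
Qed.

Let kernel_arith (L P g : R) :
  2 * L * Ceta * P <= mu * P -> L * eta * g <= nu / 4 * g ->
  L * (Ceta * P + eta * g) <= mu / 2 * P + nu / 4 * g.
Proof. by move=> *; lra. Qed.

Let rate_arith (g b s n P K : R) :
  - mu * s <= - (mu / 2) * P + nu / 8 * g ->
  - (nu / 4 * g + K) <= b -> K <= mu / 2 * P + nu / 4 * g -> nu * (lambda1 * n) <= nu * g ->
  0 <= g -> 2 * (- nu * g - b - mu * s) <= - (nu * lambda1 / 2) * n.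
Proof. by move=> h1 h2 h3 h4 h5; have := mulr_ge0 (ltW nu_gt0) h5; lra. Qed.

(** With [J] the interpolant of [phi = e.m],
    [2 <J, phi> = |phi|^2 + |J|^2 - |phi - J|^2]; the term [|J|^2] is dropped and the
    interpolation error [|phi - J|^2] is controlled by [mu_up]. *)
Lemma feedback_bound e : V e ->
  - mu * sip (Ih (dot e m)) (dot e m) <=
  - (mu / 2) * L2norm (dot e m) ^+ 2 + nu / 8 * vnorm e ^+ 2.
Proof.
move=> he; have [h1 fr] := friction he; pose phi := dot e m; rewrite -/phi.
have lphi : L2 phi by case: h1.
have lJ := I_L2 lphi; have ld : L2 (phi - Ih phi) by exact: (l2B lphi lJ).
have a1 := I_approx h1.
have gr : gradnorm phi ^+ 2 <= Cfr * vnorm e ^+ 2.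
  apply: le_trans fr; rewrite [X in _ <= X]sqr_sqrtr ?addr_ge0 ?sqr_ge0//.
  by rewrite lerDr sqr_ge0.
have d2 : nsq (phi - Ih phi) <= c1 ^+ 2 * h ^+ 2 * (Cfr * vnorm e ^+ 2).
  rewrite -L2norm_sqr//; apply: le_trans (_ : (c1 * h * gradnorm phi) ^+ 2 <= _).
    by rewrite ler_pXn2r ?nnegrE ?L2norm_ge0//; apply: le_trans a1; exact: L2norm_ge0.
  by rewrite !exprMn ler_wpM2l// mulr_ge0 ?sqr_ge0.
have id : nsq (Ih phi) = nsq phi + nsq (phi - Ih phi) - 2 * (nsq phi - sip (Ih phi) phi).
  have e1 := nsq_D lJ ld; have e2 := sipBr lphi lJ lJ.
  have e0 : (fun z => Ih phi z + (phi - Ih phi) z) = phi.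
    by apply/funext => z; rewrite /= addrC subrK.
  rewrite sipff in e2; rewrite e0 [sip _ (phi - _)]e2 in e1.
  have ar (P J D S : R) : P = J + 2 * (S - J) + D -> J = P + D - 2 * (P - S) by move=> ->; ring.
  exact: ar e1.
have J0 := nsq_ge0 (Ih phi).
rewrite L2norm_sqr//.
exact: feedback_arith d2 id J0 (sqr_ge0 _).
Qed.

(** Of the dissipation, one quarter absorbs the nonlinear term, one quarter the
    gradient in the kernel inequality and one eighth the interpolation error;
    the feedback absorbs the other term of the kernel inequality. *)
Lemma decay_rate e w : V e -> V w -> vnorm w <= U1 ->
  2 * (- nu * vnorm e ^+ 2 - trilinear e w e - mu * sip (Ih (dot e m)) (dot e m))
  <= - (nu * lambda1 / 2) * hnorm e ^+ 2.
Proof.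
move=> he hw wU; have fb := feedback_bound he; have po := poincare he.
have := nonlinear he hw; rewrite ler_norml => /andP[nl _].
have kb := kernel_bound he.
have g0 := sqr_ge0 (vnorm e); have n0 := sqr_ge0 (hnorm e).
have p0 := sqr_ge0 (L2norm (dot e m)).
have w2 : vnorm w ^+ 2 <= U1 ^+ 2.
  by rewrite ler_pXn2r ?nnegrE ?vnorm_ge0//; apply: le_trans wU; exact: vnorm_ge0.
have key : Cnl / nu * vnorm w ^+ 2 * hnorm e ^+ 2 <=
    mu / 2 * L2norm (dot e m) ^+ 2 + nu / 4 * vnorm e ^+ 2.
  have [C0|C0] := ltP Cnl 0.
    by rewrite nonlinear_sign// mulr0 addr_ge0// mulr_ge0// ltW// divr_gt0.
  have Cn : 0 <= Cnl / nu by rewrite divr_ge0// ltW.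
  apply: le_trans (_ : Cnl / nu * U1 ^+ 2 * hnorm e ^+ 2 <= _).
    by apply: ler_wpM2r => //; exact: ler_wpM2l.
  have L0 : 0 <= Cnl / nu * U1 ^+ 2 by rewrite mulr_ge0// sqr_ge0.
  apply: le_trans (ler_wpM2l L0 kb) _.
  have k1 := ler_wpM2r p0 mu_low; have k2 := ler_wpM2r g0 etaL.
  exact: kernel_arith k1 k2.
have k3 := ler_wpM2l (ltW nu_gt0) po.
exact: rate_arith fb nl key k3 g0.
Qed.

End Estimate.
End Pointwise.

(** * The decay estimate *)

Section MainAux.
Context {R : realType}.
Local Notation leb := (@leb R).

#[global] Instance leb_ae_filter : Filter (nbhs (almost_everywhere leb)).
Proof. exact: ae_filter_ringOfSetsType. Qed.

Lemma ae_ess_sup_from (t0 U : R) (g : R -> R) : ess_sup_from t0 g = U%:E ->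
  {ae leb, forall t, t0 <= t -> g t <= U}.
Proof.
move=> gU; have [N [mN N0 sN]] := ess_sup_ge (mrestr leb (measurable_itv `[t0, +oo[)) (EFin \o g).
exists (N `&` `[t0, +oo[); split; [|exact: N0|].
  by apply: measurableI => //; exact: measurable_itv.
move=> t /= h; have [tt0|tt0] := leP t0 t; last first.
  by exfalso; apply: h; rewrite leNgt tt0.
split; last by rewrite /= in_itv /= tt0.
apply: sN => /= k; apply: h => _; rewrite -lee_fin; apply: le_trans k _.
by rewrite -gU.
Qed.

End MainAux.

Theorem theorem7p4 (R : realType) (nu lambda1 Cnl Cfr : R)
    (f u0 v0 m : vfield R) (u v p : R -> vfield R)
    (t0 U1 eta Ceta c0 c1 mu h : R) (Ih : R -> torusfun R -> torusfun R)
    (hnu : 0 < nu)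
    (hlambda1 : 0 < lambda1)
    (hpoincare : forall e, V e -> lambda1 * hnorm e ^+ 2 <= vnorm e ^+ 2)
    (hCnl : forall e w, V e -> V w ->
       `|trilinear e w e| <=
         nu / 4 * vnorm e ^+ 2 + Cnl / nu * vnorm w ^+ 2 * hnorm e ^+ 2)
    (hf : H f)
    (hu0 : V u0)
    (hu : strong_solution nu (fun=> f) u0 u)
    (ht0 : 0 <= t0)
    (hU1 : ess_sup_from t0 (fun t => vnorm (u t)) = U1%:E)
    (hm : forall i, W1inf (m i))
    (hm1 : unit_field m)
    (hker : kernel_free m)
    (hCfr : forall e, V e ->
       H1 (dot e m) /\ H1norm (dot e m) ^+ 2 <= Cfr * vnorm e ^+ 2) :
  let Lambda := Cnl / nu * U1 ^+ 2 in
  forall (heta : 0 < eta)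
    (hLeta : Lambda * eta <= nu / 4)
    (hCeta : forall e, V e ->
       hnorm e ^+ 2 <= Ceta * L2norm (dot e m) ^+ 2 + eta * vnorm e ^+ 2)
    (hc0 : 0 < c0) (hc1 : 0 < c1)
    (hI : interpolants Ih c0 c1)
    (hh : 0 < h)
    (hmu : 0 < mu)
    (hmu_low : 2 * Lambda * Ceta <= mu)
    (hmu_up : c1 ^+ 2 * Cfr * mu * h ^+ 2 <= nu / 4)
    (hv0 : V v0)
    (* p(t) is the P_sigma-projection appearing in the equation for v *)
    (hp : {ae leb, forall t, 0 < t ->
       is_leray (scale (Ih h (dot (v t - u t) m)) m) (p t)})
    (hv : strong_solution nu (fun t i x => f i x - mu * p t i x) v0 v),
  forall t, t0 <= t ->
    hnorm (v t - u t) ^+ 2 <=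
      expR (- (nu * lambda1 / 2) * (t - t0)) * hnorm (v t0 - u t0) ^+ 2.

Proof.
move=> Lambda heta hLeta hCeta hc0 hc1 hI hh hmu hmulow hmuup hv0 hp hv t t0t.
have [wu [su eu _]] := hu; have [wv [sv ev _]] := hv.
pose T := t + 1; have T0 : 0 < T by rewrite ltr_wpDl// (le_trans ht0).
have tT : t < T by rewrite ltrDl.
have [Cu _ Lu du] := su T T0; have [Cv _ Lv dv] := sv T T0.
have [wu' [Wu [acu eqwu]]] := strong_accurve hlambda1 hpoincare T0 Cu Lu du.
have [wv' [Wv [acv eqwv]]] := strong_accurve hlambda1 hpoincare T0 Cv Lv dv.
have C := accurve_sub acv acu.
have c0' : 0 <= nu * lambda1 / 2 by rewrite divr_ge0// mulr_ge0// ltW.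
apply: (ac_decay C c0' ht0) => //; last by rewrite t0t.
have aeU := ae_ess_sup_from hU1.
apply: filterS (filterI (filterI eu ev) (filterI (filterI eqwu eqwv) (filterI hp aeU))) => s.
move=> [[Eu Ev] [[Wus Wvs] [hps Us]]] /andP[t0s sT].
have s0 := le_lt_trans ht0 t0s.
have [au [bu [Au Bu EQu]]] := Eu s0; have [av [bv [Av Bv EQv]]] := Ev s0.
have s0T : 0 < s < T by rewrite s0.
rewrite Wus// Wvs//.
have Hwu : H (wu s) by rewrite -Wus//; exact: (ac_dH acu).
have Hwv : H (wv s) by rewrite -Wvs//; exact: (ac_dH acv).
have [VuS VvS] : V (u s) /\ V (v s) by split; apply: DA_V; [case: Au|case: Av].
have Ve := V_B VvS VuS.
have [I1 _ _ _ I2] := hI _ hh.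
have [h1 _] := hCfr _ Ve.
have lJ : L2 (Ih h (dot (v s - u s) m)) by apply: I1; case: h1.
rewrite (energy_identity hf Hwu Hwv lJ Au Av Bu Bv (hps s0) EQu EQv).
exact: (decay_rate hnu hlambda1 hmu hpoincare hCnl hCfr hLeta hCeta I1 I2 hmulow hmuup Ve VuS (Us (ltW t0s))).
Qed.
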